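(* Let $X=L_1(R^d)$ and $Y=L_\infty(R^d)$. Then $$\liminf_{t\to\infty}V_{SR}(X,Y;t)=C^{(2)}_{SR}>0 .$$
   Context: Schrödinger problem (S): $v=v(t,x)$, $x\in R^d$, solves the free Schrödinger equation $-i\,\frac{\partial v}{\partial t}=0.5\sum_{k=1}^d\frac{\partial^2v}{\partial x_k^2}$ ($i^2=-1$) with initial condition $\lim_{t\to0}v(t,x)=f(x)$ in the $L_p$ sense for some $p\in[1,\infty]$. The solution is written $v(t,\cdot)=U_tf(\cdot)$. For a rearrangement invariant space $X$ over $R^d$ (norm depending only on the distribution function of $|f|$), the fundamental function is $\phi(X,\delta)=\sup_{A:\,m(A)\le\delta}\|I(A)\|X$, with $m$ Lebesgue measure and $I(A)$ the indicator of $A$. For rearrangement invariant spaces $X,Y$ over $R^d$ and $t>2$, $$V_{SR}(X,Y;t)=\sup_{f\in X,\,f\ne0}\frac{t^{-d/2}\,\|U_tf\|Y}{\|f\|X\cdot\phi(X,t^{-d})}.$$ *)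

(* Defs.v *)
From HB Require Import structures.
From mathcomp Require Import all_boot all_order all_algebra.
From mathcomp Require Import complex.
From mathcomp Require Import all_classical all_reals all_analysis.

Set Implicit Arguments.
Unset Strict Implicit.
Unset Printing Implicit Defensive.

Import Order.TTheory GRing.Theory Num.Theory.
Import numFieldNormedType.Exports.

Local Open Scope classical_set_scope.
Local Open Scope ring_scope.
Local Open Scope complex_scope.

(* R^d is 'rV[R]_d with the topology of the library; its sigma-algebra is the
   one generated by the coordinates. *)
Section measurable_rV.
Context (R : realType) (d : nat).

Let coord (i : 'I_d) (x : 'rV[R]_d) : measurableTypeR R := x ord0 i.

Let rV_set0 : g_sigma_preimage coord set0.
Proof. exact: sigma_algebra0. Qed.

Let rV_setC A : g_sigma_preimage coord A -> g_sigma_preimage coord (~` A).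
Proof. exact: sigma_algebraC. Qed.

Let rV_bigcup (F : (set 'rV[R]_d)^nat) :
  (forall i, g_sigma_preimage coord (F i)) ->
  g_sigma_preimage coord (\bigcup_i F i).
Proof. exact: sigma_algebra_bigcup. Qed.

HB.instance Definition _ := @isMeasurable.Build
  (measure_tuple_display R.-ocitv.-measurable.-sigma)
  'rV[R]_d (g_sigma_preimage coord) rV_set0 rV_setC rV_bigcup.

End measurable_rV.

Section lebesgue_rV.
Context (R : realType).

Lemma measurable_coord (d : nat) (i : 'I_d) :
  measurable_fun [set: 'rV[R]_d]
    (fun x : 'rV[R]_d => x ord0 i : measurableTypeR R).
Proof.
move=> _ Y mY; rewrite setTI; apply: sub_sigma_algebra => /=.
rewrite -bigcup_seq/=; exists i => /=; first by rewrite mem_index_enum.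
by exists Y => //; rewrite setTI.
Qed.

Lemma measurable_fun_coordP (d : nat) (d1 : measure_display)
    (T : measurableType d1) (f : T -> 'rV[R]_d) :
  (forall i, measurable_fun [set: T]
     (fun z => f z ord0 i : measurableTypeR R)) ->
  measurable_fun [set: T] f.
Proof.
move=> mf; apply: (measurability
  (\big[setU/set0]_(i < d) preimage_set_system setT
     (fun x : 'rV[R]_d => x ord0 i : measurableTypeR R) measurable)) => //.
move=> _ [B + <-]; rewrite -bigcup_seq => -[i /= _ [A mA <-]].
by rewrite setTI; exact: mf.
Qed.

Definition rV_cons (d : nat) (z : measurableTypeR R * 'rV[R]_d) :
  'rV[R]_d.+1 := row_mx (z.1)%:M z.2 : 'rV[R]_(1 + d).

Lemma measurable_rV_cons (d : nat) :
  measurable_fun [set: measurableTypeR R * 'rV[R]_d] (@rV_cons d).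
Proof.
apply: measurable_fun_coordP => i.
have [j ij|j ij] := split_ordP (i : 'I_(1 + d)).
  rewrite (_ : (fun _ => _) = fst); first exact: measurable_fst.
  apply/funext => z; rewrite ij.
  by apply: etrans (row_mxEl _ _ _ _) _; rewrite (ord1 j) mxE eqxx mulr1n.
rewrite (_ : (fun _ => _) = (fun x : 'rV[R]_d => x ord0 j) \o snd).
  exact: measurableT_comp (measurable_coord j) measurable_snd.
by apply/funext => z; rewrite ij; exact: row_mxEr.
Qed.

(* Lebesgue measure on R^d as the d-fold product of the one on R *)
Fixpoint lebesgue_rV (d : nat) : set 'rV[R]_d -> \bar R :=
  if d is d'.+1 then
    pushforward (lebesgue_measure \x @lebesgue_rV d')%E (@rV_cons d')
  else \d_(0 : 'rV[R]_0).

Definition rV_uncons (d : nat) (x : 'rV[R]_d.+1) :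
    measurableTypeR R * 'rV[R]_d :=
  (x ord0 ord0, \row_(i < d) x ord0 (lift ord0 i)).

Lemma rV_consK (d : nat) : cancel (@rV_cons d) (@rV_uncons d).
Proof.
move=> [a y]; congr (_, _).
  rewrite (_ : ord0 = lshift d ord0 :> 'I_(1 + d)); last exact/val_inj.
  by apply: etrans (row_mxEl _ _ _ _) _; rewrite mxE eqxx mulr1n.
apply/rowP => i; rewrite mxE.
rewrite (_ : lift ord0 i = rshift 1 i :> 'I_(1 + d)); last exact/val_inj.
exact: row_mxEr.
Qed.

Lemma measurable_rV_uncons (d : nat) :
  measurable_fun [set: 'rV[R]_d.+1] (@rV_uncons d).
Proof.
apply/measurable_fun_pair; first exact: measurable_coord.
apply: measurable_fun_coordP => i.
rewrite (_ : (fun _ => _) = fun x : 'rV[R]_d.+1 => x ord0 (lift ord0 i)).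
  exact: measurable_coord.
by apply/funext => x; rewrite mxE.
Qed.

Section rV_cons_measure.
Context (d : nat) (m : {sigma_finite_measure set 'rV[R]_d -> \bar R}).

Let rV_cons_measure : set 'rV[R]_d.+1 -> \bar R :=
  pushforward (lebesgue_measure \x m)%E (@rV_cons d).

HB.instance Definition _ := Measure.copy rV_cons_measure
  (measure_function_pushforward__canonical__measure_function_Measure
     (lebesgue_measure \x m)%E (@measurable_rV_cons d)).

Let rV_cons_measure_sigma_finite : sigma_finite [set: _] rV_cons_measure.
Proof.
have /sigma_finiteP[F [FT ndF Foo]] := sigma_finiteT (@lebesgue_measure R).
have /sigma_finiteP[G [GT ndG Goo]] := sigma_finiteT m.
exists (fun n => @rV_uncons d @^-1` (F n `*` G n)).
  rewrite -preimage_bigcup (_ : \bigcup_n (F n `*` G n) = setT)//.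
  rewrite -subTset => -[x y] _.
  have [[i _ Fx] [j _ Gy]] : (\bigcup_n F n) x /\ (\bigcup_n G n) y.
    by rewrite -FT -GT.
  exists (maxn i j) => //; split => /=.
    by move: x Fx; exact/subsetPset/ndF/leq_maxl.
  by move: y Gy; exact/subsetPset/ndG/leq_maxr.
move=> n; have [mF Fn] := Foo n; have [mG Gn] := Goo n; split.
  rewrite -[X in measurable X]setTI; apply: measurable_rV_uncons => //.
  exact: measurableX.
rewrite /rV_cons_measure /pushforward -comp_preimage.
rewrite (_ : _ \o _ = id); last by apply/funext => z; exact: rV_consK.
by rewrite preimage_id product_measure1E// lte_mul_pinfty// ge0_fin_numE.
Qed.

HB.instance Definition _ := Measure_isSigmaFinite.Build _ _ _ rV_cons_measure
  rV_cons_measure_sigma_finite.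

Lemma pushforward_rV_cons :
  exists m' : {sigma_finite_measure set 'rV[R]_d.+1 -> \bar R},
    m' = rV_cons_measure :> (set 'rV[R]_d.+1 -> \bar R).
Proof. by exists rV_cons_measure. Qed.

End rV_cons_measure.

Lemma lebesgue_rV_ex (d : nat) :
  exists m : {sigma_finite_measure set 'rV[R]_d -> \bar R},
    m = @lebesgue_rV d :> (set 'rV[R]_d -> \bar R).
Proof.
elim: d => [|d [m Em]]; last by rewrite /= -Em; exact: pushforward_rV_cons.
by exists \d_(0 : 'rV[R]_0).
Qed.

Section lebesgue_rV_instance.
Variable d : nat.
Local Notation mu := (@lebesgue_rV d).

Let lebesgue_rV0 : mu set0 = 0%E.
Proof. by have [m <-] := lebesgue_rV_ex d; exact: measure0. Qed.

Let lebesgue_rV_ge0 A : (0 <= mu A)%E.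
Proof. by have [m <-] := lebesgue_rV_ex d; exact: measure_ge0. Qed.

Let lebesgue_rV_sigma_additive : semi_sigma_additive mu.
Proof.
by have [m <-] := lebesgue_rV_ex d; exact: measure_semi_sigma_additive.
Qed.

HB.instance Definition _ := isMeasure.Build _ _ _ mu
  lebesgue_rV0 lebesgue_rV_ge0 lebesgue_rV_sigma_additive.

Let lebesgue_rV_sigma_finite : sigma_finite [set: _] mu.
Proof. by have [m <-] := lebesgue_rV_ex d; exact: sigma_finiteT. Qed.

HB.instance Definition _ := Measure_isSigmaFinite.Build _ _ _ mu
  lebesgue_rV_sigma_finite.

End lebesgue_rV_instance.
End lebesgue_rV.

(* R[i] carries no R-normed-module structure in the library: derivatives with
   respect to real variables are taken componentwise. *)
Section complex_valued.
Context (R : realType).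

Definition cderivable (V : normedModType R) (F : V -> R[i]) (a u : V) : Prop :=
  derivable (fun x => complex.Re (F x)) a u /\
  derivable (fun x => complex.Im (F x)) a u.

Definition cderive (V : normedModType R) (F : V -> R[i]) (a u : V) : R[i] :=
  'D_u (fun x => complex.Re (F x)) a +i* 'D_u (fun x => complex.Im (F x)) a.

Definition ccontinuous_at (T : topologicalType) (F : T -> R[i]) (a : T) :
    Prop :=
  complex.Re (F x) @[x --> a] --> complex.Re (F a) /\
  complex.Im (F x) @[x --> a] --> complex.Im (F a).

Definition cmeasurable (d : measure_display) (T : measurableType d)
    (F : T -> R[i]) : Prop :=
  measurable_fun [set: T] (fun x => complex.Re (F x) : measurableTypeR R) /\
  measurable_fun [set: T] (fun x => complex.Im (F x) : measurableTypeR R).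

End complex_valued.

Section schrodinger.
Context (R : realType) (d : nat).
Local Notation Rd := 'rV[R]_d.
Local Notation mu := (@lebesgue_rV R d).
Implicit Types (f g : Rd -> R[i]) (v : R -> Rd -> R[i]).

Definition Lpnorm (p : \bar R) f : \bar R :=
  Lnorm mu p (fun x => (Normc.normc (f x))%:E).

Definition dt v (t : R) (x : Rd) : R[i] := cderive (fun s : R => v s x) t 1.

Definition dx v (k : 'I_d) (t : R) (x : Rd) : R[i] :=
  cderive (v t) x (delta_mx ord0 k).

(* v is C^1 in t and C^2 in x for t > 0 (only the derivatives that occur in
   the equation are constrained) *)
Definition C12 v : Prop :=
  forall (t : R) (x : Rd), 0 < t ->
  let jointly_continuous (w : R -> Rd -> R[i]) :=
    ccontinuous_at (fun z : R * Rd => w z.1 z.2) (t, x) in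
  [/\ jointly_continuous v,
      cderivable (fun s : R => v s x) t 1 /\ jointly_continuous (dt v)
    & forall k : 'I_d,
        [/\ cderivable (v t) x (delta_mx ord0 k),
            cderivable (dx v k t) x (delta_mx ord0 k),
            jointly_continuous (dx v k)
          & jointly_continuous (dx (dx v k) k)]].

Definition free_schrodinger v : Prop :=
  forall (t : R) (x : Rd), 0 < t ->
    - (0 +i* 1) * dt v t x = 2^-1 * \sum_(k < d) dx (dx v k) k t x.

(* The initial condition alone does not determine a solution at later times
   (Tychonoff-type solutions vanish near t = 0 but not later), so v is also
   required to be an L_p-continuous curve for t > 0. *)
Definition Lp_curve_from (p : \bar R) f v : Prop :=
  (fun s => Lpnorm p (fun x => v s x - f x)) @ 0^'+ --> 0%E /\
  forall t : R, 0 < t ->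
    (fun s => Lpnorm p (fun x => v s x - v t x)) @ t --> 0%E.

Definition schrodinger_solution f v : Prop :=
  [/\ C12 v, free_schrodinger v &
      exists2 p : \bar R, (1 <= p)%E & Lp_curve_from p f v].

(* Function norms NX, NY stand for rearrangement invariant spaces X, Y:
   f belongs to X when it is measurable and NX f < +oo. *)
Implicit Types NX NY : (Rd -> R[i]) -> \bar R.

Definition in_space NX f : Prop := cmeasurable f /\ (NX f < +oo)%E.

(* g is a version of U_t f.  If v is a solution with initial value f then
   U_t f = v t (constant sequences below).  Since a general f in L_1 (for
   example |x|^-a on the unit ball, d/2 <= a < d) is not the L_p limit of a
   solution for any p, U_t is extended by continuity from X to Y so as to be
   defined on all of X = L_1. *)
Definition schrodinger_flow NX NY (t : R) f g : Prop :=
  exists (f_ : nat -> Rd -> R[i]) (v_ : nat -> R -> Rd -> R[i]),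
  [/\ forall n, cmeasurable (f_ n) /\ schrodinger_solution (f_ n) (v_ n),
      (fun n => NX (fun x => f_ n x - f x)) @ \oo --> 0%E
    & (fun n => NY (fun x => v_ n t x - g x)) @ \oo --> 0%E].

Definition fundamental NX (delta : R) : \bar R :=
  ereal_sup [set NX (fun x => (\1_A x)%:C) |
    A in [set A : set Rd | measurable A /\ (mu A <= delta%:E)%E]].

Definition V_SR NX NY (t : R) : \bar R :=
  ereal_sup [set q : \bar R | exists f g,
    [/\ in_space NX f, ~ {ae mu, forall x, f x = 0},
        cmeasurable g, schrodinger_flow NX NY t f g &
        q = ((t `^ (- d%:R / 2))%:E * NY g /
             (NX f * fundamental NX (t ^- d)))%E]].

End schrodinger.

(* Main.v *)
(** By scaling, V_SR(t) is t^(d/2) times the norm of U_t from L_1 to L_oo.  A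
    Gaussian wave packet, whose evolution is explicit, bounds it below.

    The upper bound is the dispersive estimate |v(t,y)| <= C t^(-d/2) |f|_1, which
    has to be proved for every classical solution that is an L_p-continuous curve
    starting at f, without a uniqueness theorem at hand.  Pair v(s) with the
    explicit solution w(s) whose value at time t is a Gaussian of width h centred
    at y.  With a compactly supported cutoff of radius r, Green's formula shows
    that the derivative of the pairing in s only involves derivatives of the
    cutoff; it is O(1/r^2) because v(s) is bounded in L_1 with a Gaussian weight,
    uniformly on [s0, t].  So, letting r grow, the pairing at time t is bounded by
    the pairing near time 0, hence by |f|_1 sup |w(0)| <= C t^(-d/2) |f|_1, while
    it concentrates at v(t,y) as h goes to 0. *)
Require Import Defs.
From mathcomp Require Import all_boot all_order all_algebra.
From mathcomp Require Import complex.
From mathcomp Require Import all_classical all_reals all_analysis.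
From mathcomp Require Import measurable_realfun ess_sup_inf normal_distribution.
From mathcomp Require Import ring lra.

Import Order.TTheory GRing.Theory Num.Theory.
Import numFieldNormedType.Exports.

Set Implicit Arguments.
Unset Strict Implicit.
Unset Printing Implicit Defensive.

Local Open Scope classical_set_scope.
Local Open Scope ring_scope.

(** * Measurability and Fubini on R^d *)

(** The exponent [p] of the initial condition is arbitrary, so along a solution the only norm used
    is L_1 with the weight [exp(- c |x - y|^2)], which every L_p norm controls up to a constant. The
    kernel is dominated by the square of such a weight: one copy integrates the solution, the other
    absorbs the factor [|x - y|^2] that appears when derivatives of the kernel meet derivatives of
    the cutoff. The decay has one source. The kernel has modulus at most [|z|^(-d/2)] with
    [z = h^2 + i (s - t)], and [|z| >= t / 2] as soon as [s <= t / 2], whatever [h] is. The other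
    constants may degenerate with [h], but each is multiplied by something chosen after [h]: the
    closeness of the starting time [s0] to 0, or [1 / r^2]. Only the real part of the pairing is
    followed, which gives one-sided real inequalities; the constant phase [th] of the kernel directs
    them at [Re v], [Im v] and their opposites. Sharp constants are not sought: two positive bounds
    for all [t >= 1] already make the lower limit a positive real number. *)

Section rV_measurability.
Context (R : realType).

(* F is the pointwise limit of its compositions with rounding down to the grid
   of mesh 1/(n+1). *)
Lemma continuous_measurable_rV (d : nat) (F : 'rV[R]_d -> R) :
  continuous F -> measurable_fun [set: 'rV[R]_d] F.
Proof.
move=> cF.
pose a n (x : 'rV[R]_d) : 'rV[R]_d :=
  \row_i ((Num.floor (n.+1%:R * x ord0 i))%:~R / n.+1%:R).
apply: (@measurable_realfun.measurable_fun_cvg _ _ _ _ (fun n x => F (a n x))).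
- move=> n _ Y mY; rewrite setTI.
  pose E (k : 'rV[int]_d) : set 'rV[R]_d :=
    \bigcap_(i in [set: 'I_d])
      [set x | Num.floor (n.+1%:R * x ord0 i) = k ord0 i].
  pose G (k : 'rV[int]_d) : set 'rV[R]_d :=
    if F (\row_i ((k ord0 i)%:~R / n.+1%:R)) \in Y then E k else set0.
  (* Rounded points range over a countable grid, so the preimage is a countable union of half-open
     cells. *)
  rewrite (_ : _ @^-1` Y = \bigcup_k G k); last first.
    apply/seteqP; split => [x /= Yx|x /= [k _]].
      exists (\row_i (Num.floor (n.+1%:R * x ord0 i))) => //.
      rewrite /G (_ : \row_i _ = a n x); last by apply/rowP => i; rewrite !mxE.
      by rewrite mem_set// => i _ /=; rewrite mxE.
    rewrite /G; case: ifPn => // /set_mem Yk Ek.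
    rewrite (_ : a n x = \row_i ((k ord0 i)%:~R / n.+1%:R))//.
    by apply/rowP => i; rewrite !mxE; rewrite Ek.
  apply: countable_bigcupT_measurable => // k; rewrite /G; case: ifPn => // _.
  apply: fin_bigcap_measurable => // i _.
  rewrite [X in measurable X](_ : _ = (fun x : 'rV[R]_d => x ord0 i) @^-1`
     `[(k ord0 i)%:~R / n.+1%:R, (k ord0 i + 1)%:~R / n.+1%:R[ ); last first.
    apply/seteqP; split => x /=; rewrite in_itv/= ler_pdivrMr// ltr_pdivlMr//.
      by move/eqP; rewrite floor_eq mulrC.
    by move=> H; apply/eqP; rewrite floor_eq mulrC.
  by rewrite -[X in measurable X]setTI; apply: measurable_coord.
move=> x _; apply: (@cvg_comp _ _ _ (fun n => a n x) F _ (nbhs x)); last exact: cF.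
move=> B /= /nbhs_ballP[e /= e0 eB].
near=> n; apply: eB; split => // i j; rewrite (ord1 i) mxE.
rewrite /ball/=.
have n0 : 0 < n.+1%:R :> R by rewrite ltr0n.
have /andP[h1 h2] := floor_itv (n.+1%:R * x ord0 j).
rewrite intrD in h2.
have -> : x ord0 j - (Num.floor (n.+1%:R * x ord0 j))%:~R / n.+1%:R =
    (n.+1%:R * x ord0 j - (Num.floor (n.+1%:R * x ord0 j))%:~R) / n.+1%:R.
  by field; rewrite lt0r_neq0.
rewrite ger0_norm; last by rewrite divr_ge0 ?subr_ge0// ltW.
apply: (@lt_trans _ _ n.+1%:R^-1).
  by rewrite ltr_pdivrMr// mulVf ?lt0r_neq0// ltrBlDl.
near: n.
exact: (near_infty_natSinv_lt (PosNum e0)).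
Unshelve. all: by end_near. Qed.

Lemma measurable_rV_cons1 (d : nat) (z : R) :
  measurable_fun [set: 'rV[R]_d] (fun x => rV_cons (z : measurableTypeR R, x)).
Proof.
by apply: measurableT_comp; [exact: measurable_rV_cons|exact: measurable_pair1].
Qed.

Lemma rV_cons0 (d : nat) (z : R) (x : 'rV[R]_d) :
  rV_cons (z : measurableTypeR R, x) ord0 ord0 = z.
Proof.
by have /(congr1 fst) := rV_consK (z : measurableTypeR R, x).
Qed.

Lemma rV_consS (d : nat) (z : R) (x : 'rV[R]_d) (i : 'I_d) :
  rV_cons (z : measurableTypeR R, x) ord0 (lift ord0 i) = x ord0 i.
Proof.
have /(congr1 snd)/rowP/(_ i) := rV_consK (z : measurableTypeR R, x).
by rewrite mxE.
Qed.

Local Notation mu d := (@lebesgue_rV R d).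
Local Open Scope ereal_scope.

(** True by computation; it exhibits the measure in the pushforward form that the change of
    variables lemmas expect. *)
Lemma integral_lebesgue_rVS (d : nat) (G : 'rV[R]_d.+1 -> \bar R) :
  \int[mu d.+1]_x G x =
  \int[pushforward (lebesgue_measure \x mu d) (@rV_cons R d)]_x G x.
Proof. by []. Qed.

Lemma ge0_integral_rV_cons (d : nat) (G : 'rV[R]_d.+1 -> \bar R) :
  measurable_fun [set: 'rV[R]_d.+1] G -> (forall x, 0 <= G x) ->
  \int[mu d.+1]_x G x =
  \int[lebesgue_measure]_z \int[mu d]_x G (rV_cons (z, x)).
Proof.
move=> mG G0.
rewrite integral_lebesgue_rVS.
rewrite (ge0_integral_pushforward (@measurable_rV_cons R d))//.
rewrite preimage_setT.
apply: (fubini_tonelli1 (G \o @rV_cons R d)) => [|x]; last exact: G0.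
by apply: measurableT_comp => //; exact: measurable_rV_cons.
Qed.

Lemma integrable_rV_cons (d : nat) (G : 'rV[R]_d.+1 -> \bar R) :
  measurable_fun [set: 'rV[R]_d.+1] G ->
  (mu d.+1).-integrable [set: 'rV[R]_d.+1] G ->
  (lebesgue_measure \x mu d).-integrable setT (G \o @rV_cons R d).
Proof.
move=> mG /integrableP[_ iG]; apply/integrableP; split.
  by apply: measurableT_comp => //; exact: measurable_rV_cons.
move: iG; rewrite integral_lebesgue_rVS (ge0_integral_pushforward (@measurable_rV_cons R d))//=.
exact: measurableT_comp.
Qed.

Lemma integral_rV_cons (d : nat) (G : 'rV[R]_d.+1 -> \bar R) :
  (mu d.+1).-integrable [set: 'rV[R]_d.+1] G ->
  \int[mu d.+1]_x G x =
  \int[lebesgue_measure]_z \int[mu d]_x G (rV_cons (z, x)).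
Proof.
move=> iG; have mG := measurable_int _ iG.
have iG' := integrable_rV_cons mG iG.
rewrite integral_lebesgue_rVS (integral_pushforward (@measurable_rV_cons R d))//=.
by rewrite -integral12_prod_meas1.
Qed.

Lemma integral_rV_cons_swap (d : nat) (G : 'rV[R]_d.+1 -> \bar R) :
  (mu d.+1).-integrable [set: 'rV[R]_d.+1] G ->
  \int[mu d.+1]_x G x =
  \int[mu d]_x \int[lebesgue_measure]_z G (rV_cons (z, x)).
Proof.
move=> iG; have mG := measurable_int _ iG.
have iG' := integrable_rV_cons mG iG.
rewrite integral_lebesgue_rVS (integral_pushforward (@measurable_rV_cons R d))//=.
by rewrite -integral21_prod_meas1.
Qed.

Lemma integral_rV_prod (d : nat) (g : 'I_d -> R -> R) :
  (forall i, measurable_fun setT (g i)) -> (forall i z, (0 <= g i z)%R) ->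
  \int[mu d]_x (\prod_(i < d) g i (x ord0 i))%:E =
  \prod_(i < d) \int[lebesgue_measure]_z (g i z)%:E.
Proof.
elim: d g => [|d IH] g mg g0.
  under eq_integral do rewrite big_ord0.
  by rewrite big_ord0 integral_cst// mul1e; exact: diracT.
rewrite ge0_integral_rV_cons; last 2 first.
- apply/measurable_EFinP; apply: measurable_prod => i _.
  by apply: measurableT_comp; [exact: mg|exact: measurable_coord].
- by move=> x; rewrite lee_fin prodr_ge0.
have mgd : measurable_fun [set: 'rV[R]_d]
    (fun x => (\prod_(i < d) g (lift ord0 i) (x ord0 i))%:E).
  apply/measurable_EFinP; apply: measurable_prod => i _.
  by apply: measurableT_comp; [exact: mg|exact: measurable_coord].
under eq_integral => z _.
  under eq_integral => x _.
    rewrite big_ord_recl rV_cons0.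
    under eq_bigr do rewrite rV_consS.
    rewrite EFinM.
    over.
  rewrite ge0_integralZl//; last 2 first.
  - by move=> x _; rewrite lee_fin prodr_ge0.
  - by rewrite lee_fin.
  rewrite (IH (fun i => g (lift ord0 i)))// muleC.
  over.
rewrite ge0_integralZl//.
- by rewrite muleC big_ord_recl.
- by apply/measurable_EFinP; exact: mg.
- by move=> z _; rewrite lee_fin.
- by apply: prode_ge0 => i _; apply: integral_ge0 => z _; rewrite lee_fin.
Qed.

End rV_measurability.

(** * Boxes, lines and Gaussians *)

Section boxes.
Context (R : realType).
Local Notation mu d := (@lebesgue_rV R d).

Definition box (d : nat) (y : 'rV[R]_d) (r : R) : set 'rV[R]_d :=
  [set x | forall i, `|x ord0 i - y ord0 i| <= r].

Lemma measurable_box (d : nat) (y : 'rV[R]_d) (r : R) : measurable (box y r).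
Proof.
rewrite (_ : box y r = \bigcap_(i in [set: 'I_d])
   ((fun x : 'rV[R]_d => x ord0 i) @^-1` `[y ord0 i - r, y ord0 i + r])).
  apply: fin_bigcap_measurable => // i _.
  by rewrite -[X in measurable X]setTI; apply: measurable_coord.
apply/seteqP; split => x /= H i; last first.
  by have := H i I; rewrite /= in_itv/= ler_distl.
by move=> _; have := H i; rewrite /= in_itv/= ler_distl.
Qed.

Lemma compact_box (d : nat) (y : 'rV[R]_d) (r : R) : compact (box y r).
Proof.
rewrite (_ : box y r = [set x : 'rV[R]_d | forall i,
   `[y ord0 i - r, y ord0 i + r]%classic (x ord0 i)]).
  apply: (@rV_compact R d (fun i => `[y ord0 i - r, y ord0 i + r]%classic)) => i.
  exact: segment_compact.
by apply/seteqP; split => x /= H i; have := H i; rewrite in_itv/= ler_distl.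
Qed.

Lemma indic_box (d : nat) (y : 'rV[R]_d) (r : R) (x : 'rV[R]_d) :
  \1_(box y r) x = \prod_(i < d) \1_`[y ord0 i - r, y ord0 i + r] (x ord0 i) :> R.
Proof.
rewrite indicE; have [xb|xb] := boolP (x \in box y r).
  rewrite big1// => i _; rewrite indicE mem_set//=.
  by move/set_mem : xb => /(_ i); rewrite in_itv/= ler_distl.
have /existsNP[i Hi] : ~ (forall i, `|x ord0 i - y ord0 i| <= r).
  by move=> H; move/negP : xb; apply; apply/mem_set.
rewrite (bigD1 i)//= indicE memNset ?mul0r//= => H; apply: Hi.
by move: H; rewrite in_itv/= ler_distl.
Qed.

Lemma lebesgue_box (d : nat) (y : 'rV[R]_d) (r : R) : 0 <= r ->
  mu d (box y r) = ((r *+ 2) ^+ d)%:E.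
Proof.
move=> r0; rewrite -[X in mu d X]setIT -integral_indic//; last exact: measurable_box.
under eq_integral do rewrite indic_box.
rewrite (integral_rV_prod (g := fun i z => \1_`[y ord0 i - r, y ord0 i + r] z))//; last first.
  by move=> i; exact: measurable_indic.
rewrite -[RHS](_ : (\prod_(i < d) (r *+ 2)%:E)%E = _); last first.
  by rewrite prodEFin prodr_const card_ord.
apply: eq_bigr => i _; rewrite integral_indic// setIT [LHS](lebesgue_measure_itv `[y ord0 i - r, y ord0 i + r])/= lte_fin.
rewrite -EFinD; have -> : y ord0 i + r - (y ord0 i - r) = r *+ 2 by ring.
case: ifPn => //; rewrite -leNgt => h.
by have -> : r = 0 by [lra]; rewrite mul0rn.
Qed.

Lemma continuous_box_integrable (d : nat) (F : 'rV[R]_d -> R) (y : 'rV[R]_d)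
    (r : R) : 0 <= r -> continuous F ->
  (mu d).-integrable (box y r) (EFin \o F).
Proof.
move=> r0 cF; apply: measurable_bounded_integrable.
- exact: measurable_box.
- by rewrite [X in (X < _)%E](lebesgue_box y r0) ltry.
- by apply: measurable_funTS; exact: continuous_measurable_rV.
have : compact [set F x | x in box y r].
  apply: continuous_compact; last exact: compact_box.
  exact: continuous_subspaceT.
by move=> /compact_bounded[M [Mr HM]]; exists M; split => // N MN x Bx; apply: HM => //; exists x.
Qed.

Lemma bounded_box_integrable (d : nat) (G : 'rV[R]_d -> R) (y : 'rV[R]_d)
    (r M : R) : 0 <= r -> measurable_fun [set: 'rV[R]_d] G ->
  (forall x, `|G x| <= M * \1_(box y r) x) ->
  (mu d).-integrable [set: 'rV[R]_d] (EFin \o G).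
Proof.
move=> r0 mG GM.
apply: (@le_integrable _ _ _ _ _ _ _ (EFin \o (fun x => M * \1_(box y r) x))) => //.
- exact/measurable_EFinP.
- by move=> x _; rewrite /= lee_fin (le_trans (GM x))// ler_norm.
rewrite (_ : _ \o _ = fun x => (M%:E * (\1_(box y r) x)%:E)%E)//.
apply: integrableZl => //; apply/integrableP; split.
  by apply/measurable_EFinP; apply: measurable_indic; exact: measurable_box.
rewrite (eq_integral (fun x => (\1_(box y r) x)%:E)); last first.
  by move=> x _; rewrite gee0_abs// lee_fin.
rewrite integral_indic ?setIT//; last exact: measurable_box.
by rewrite [X in (X < _)%E](lebesgue_box y r0) ltry.
Qed.

Definition upd (d : nat) (k : 'I_d) (z : R) (x : 'rV[R]_d) : 'rV[R]_d :=
  \row_j (if j == k then z else x ord0 j).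

Lemma upd_rV_cons0 (d : nat) (z z0 : R) (x : 'rV[R]_d) :
  upd ord0 z (rV_cons (z0 : measurableTypeR R, x)) = rV_cons (z : measurableTypeR R, x).
Proof.
apply/rowP => j; rewrite mxE; have [j0|->] := unliftP ord0 j; last by rewrite eqxx rV_cons0.
by move=> ->; rewrite !rV_consS eq_sym (negbTE (neq_lift _ _)).
Qed.

Lemma upd_rV_consS (d : nat) (k : 'I_d) (z z0 : R) (x : 'rV[R]_d) :
  upd (lift ord0 k) z (rV_cons (z0 : measurableTypeR R, x)) =
  rV_cons (z0 : measurableTypeR R, upd k z x).
Proof.
apply/rowP => j; rewrite mxE; have [j0|->] := unliftP ord0 j.
  by move=> ->; rewrite !rV_consS mxE (inj_eq lift_inj).
by rewrite !rV_cons0 (negbTE (neq_lift _ _)).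
Qed.

(** Fubini with the direction [k] integrated innermost. The induction on [d] freezes the first
    coordinate until [k] becomes [ord0]. The majorant [M * \1_(box y r)] makes the signed Fubini
    theorem applicable and is inherited by slices. *)
Lemma integral_lines_eq0 (d : nat) (k : 'I_d) (G : 'rV[R]_d -> R)
    (y : 'rV[R]_d) (r M : R) : 0 <= r -> 0 <= M ->
  measurable_fun [set: 'rV[R]_d] G ->
  (forall x, `|G x| <= M * \1_(box y r) x) ->
  (forall x, \int[lebesgue_measure]_z (G (upd k z x))%:E = 0)%E ->
  (\int[mu d]_x (G x)%:E = 0)%E.
Proof.
move=> r0 M0; elim: d k G y => [[]//|d IH] k G y mG GM G0.
have iG := bounded_box_integrable r0 mG GM.
have [k'|] := unliftP ord0 k => kE; last first.
  rewrite integral_rV_cons_swap//.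
  apply: integral0_eq => x _ /=; rewrite -[RHS](G0 (rV_cons (0 : measurableTypeR R, x))).
  by apply: eq_integral => z _; rewrite kE upd_rV_cons0.
rewrite integral_rV_cons//; apply: integral0_eq => z _ /=.
apply: (IH k' (fun x => G (rV_cons (z, x))) (\row_i y ord0 (lift ord0 i))).
- by apply: (measurableT_comp mG); exact: measurable_rV_cons1.
- move=> x; apply: (le_trans (GM _)); rewrite ler_wpM2l// !indicE ler_nat.
  have [|//] := boolP (_ \in box y r) => /set_mem Bx; rewrite mem_set// => i.
  by have := Bx (lift ord0 i); rewrite rV_consS mxE.
- move=> x; rewrite -[RHS](G0 (rV_cons (z, x))) kE.
  by apply: eq_integral => z' _; rewrite upd_rV_consS.
Qed.

Lemma integral_gauss_fin (c m : R) : 0 < c ->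
  (\int[lebesgue_measure]_z (expR (- (c * (z - m) ^+ 2)))%:E < +oo)%E.
Proof.
(* The deviation for which the normal density has exponent [- c (z - m)^2]. *)
move=> c0; pose s := Num.sqrt (2 * c)^-1.
have s0 : 0 < s by rewrite sqrtr_gt0 invr_gt0 mulr_gt0.
have pk := normal_peak_gt0 (lt0r_neq0 s0).
have -> : (\int[lebesgue_measure]_z (expR (- (c * (z - m) ^+ 2)))%:E =
    \int[lebesgue_measure]_z (((normal_peak s)^-1)%:E * (normal_pdf m s z)%:E))%E.
  apply: eq_integral => z _.
  rewrite -EFinM normal_pdfE ?gt_eqF// mulKf ?gt_eqF// /normal_fun.
  congr (expR _)%:E; rewrite sqr_sqrtr ?invr_ge0 ?mulr_ge0 ?ltW//.
  by field; rewrite gt_eqF.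
rewrite ge0_integralZl//.
- by rewrite integral_normal_pdf mule1 ltry.
- by apply/measurable_EFinP; exact: measurable_normal_pdf.
- by move=> x _; rewrite lee_fin normal_pdf_ge0.
- by rewrite lee_fin invr_ge0 ltW.
Qed.

Definition rho (d : nat) (y x : 'rV[R]_d) : R := \sum_(i < d) (x ord0 i - y ord0 i) ^+ 2.

Lemma integral_gauss_rV_fin (d : nat) (c : R) (y : 'rV[R]_d) : 0 < c ->
  (\int[mu d]_x (expR (- (c * rho y x)))%:E < +oo)%E.
Proof.
move=> c0.
under eq_integral do rewrite /rho big_distrr/= -sumrN expR_sum.
rewrite (integral_rV_prod (g := fun i z => expR (- (c * (z - y ord0 i) ^+ 2)))).
(* In the extended reals finiteness passes to products together with nonnegativity, hence the
   two-sided invariant. *)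
- suff /andP[] : (0 <= \prod_(i < d) \int[lebesgue_measure]_z
      (expR (- (c * (z - y ord0 i) ^+ 2)))%:E < +oo)%E by [].
  elim/big_ind: _ => [|a b /andP[a0 ao] /andP[b0 bo]|i _].
  + by rewrite lee01 ltry.
  + by rewrite mule_ge0// lte_mul_pinfty// ge0_fin_numE.
  by rewrite integral_gauss_fin// andbT; apply: integral_ge0 => z _; rewrite lee_fin expR_ge0.
- move=> i; apply: measurableT_comp => //; apply: measurableT_comp => //.
  apply: measurable_funM => //; apply: measurable_funX.
  exact: measurable_funB.
- by move=> i z; exact: expR_ge0.
Qed.

End boxes.

(** * Directional derivatives and the complex Gaussian kernel *)

Section directional_derivatives.
Context (R : realType) (V : normedModType R).
Implicit Types (f g : V -> R) (x v : V).

Lemma dirD f g x v a b : is_derive x v f a -> is_derive x v g b ->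
  is_derive x v (fun z => f z + g z) (a + b).
Proof. exact: is_deriveD. Qed.

Lemma dirN f x v a : is_derive x v f a -> is_derive x v (fun z => - f z) (- a).
Proof. exact: is_deriveN. Qed.

Lemma dirB f g x v a b : is_derive x v f a -> is_derive x v g b ->
  is_derive x v (fun z => f z - g z) (a - b).
Proof. by move=> fa gb; apply: dirD => //; exact: dirN. Qed.

Lemma dirM f g x v a b : is_derive x v f a -> is_derive x v g b ->
  is_derive x v (fun z => f z * g z) (a * g x + f x * b).
Proof.
move=> fa gb; apply: (is_derive_eq (is_deriveM fa gb)).
by rewrite /GRing.scale/= addrC mulrC.
Qed.

(** Both difference quotients are the same function of [h]. Directional derivatives thus become
    one-variable derivatives, to which the chain rule [is_derive1_comp] applies. *)
Lemma dir_line f x v a :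
  is_derive x v f a <-> is_derive (0 : R) (1 : R) (fun h : R => f (h *: v + x)) a.
Proof.
have E : (fun h : R => h^-1 *: ((f \o shift x) (h *: v) - f x)) =
  (fun h : R => h^-1 *: (((fun h : R => f (h *: v + x)) \o shift 0) (h *: (1 : R))
    - f (0 *: v + x))).
  by apply/funext => h /=; rewrite addr0 scale0r add0r /GRing.scale/= mulr1.
split => -[df Df]; split.
- by rewrite /derivable -E.
- by rewrite /derive -E.
- by rewrite /derivable E.
- by rewrite /derive E.
Qed.

Lemma dir_comp f (g : R -> R) x v a b : is_derive x v f a ->
  is_derive (f x) (1 : R) g b -> is_derive x v (fun z => g (f z)) (b * a).
Proof.
move=> /dir_line fa gb; apply/dir_line.
apply: (@is_derive1_comp R g (fun h => f (h *: v + x))) => //.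
by rewrite scale0r add0r.
Qed.

Lemma dir_invariant f x v : (forall h : R, f (h *: v + x) = f x) ->
  is_derive x v f 0.
Proof.
move=> fx; apply/dir_line.
rewrite (_ : (fun _ => _) = cst (f x)); last exact/funext.
exact: is_derive_cst.
Qed.

Lemma dir_cst (c : R) x v : is_derive x v (fun=> c) 0.
Proof. exact: is_derive_cst. Qed.

Lemma dirZ (c : R) f x v a : is_derive x v f a ->
  is_derive x v (fun z => c * f z) (c * a).
Proof. by move=> fa; apply: (is_derive_eq (dirM (dir_cst c x v) fa)); rewrite mul0r add0r. Qed.

Lemma dir_sum (n : nat) (F : 'I_n -> V -> R) (a : 'I_n -> R) x v :
  (forall i, is_derive x v (F i) (a i)) ->
  is_derive x v (fun z => \sum_(i < n) F i z) (\sum_(i < n) a i).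
Proof.
move=> Fa; rewrite (_ : (fun _ => _) = \sum_(i < n) F i); last first.
  by apply/funext => z; rewrite fct_sumE.
exact: is_derive_sum.
Qed.

End directional_derivatives.

Section coordinates.
Context (R : realType) (d : nat).
Implicit Types (x y : 'rV[R]_d) (F : 'rV[R]_d -> R).

Lemma shift_coord (h : R) x (k j : 'I_d) :
  (h *: delta_mx ord0 k + x) ord0 j = (j == k)%:R * h + x ord0 j.
Proof. by rewrite !mxE eqxx/= mulrC. Qed.

Lemma dir_coord x (k j : 'I_d) :
  is_derive x (delta_mx ord0 k) (fun z : 'rV[R]_d => z ord0 j) (j == k)%:R.
Proof.
apply/dir_line.
rewrite (_ : (fun _ => _) = (fun h => (j == k)%:R * h + x ord0 j)); last first.
  by apply/funext => h; rewrite shift_coord.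
apply: (is_derive_eq (dirD (dirZ _ (is_derive_id _ _)) (dir_cst _ _ _))).
by rewrite mulr1 addr0.
Qed.

Lemma dir_upd F (k : 'I_d) (z a : R) x :
  is_derive (upd k z x) (delta_mx ord0 k) F a ->
  is_derive z (1 : R) (fun s => F (upd k s x)) a.
Proof.
move=> /dir_line Fa; apply/dir_line.
rewrite (_ : (fun _ => _) = (fun h => F (h *: delta_mx ord0 k + upd k z x)))//.
apply/funext => h; congr F; apply/rowP => j.
rewrite shift_coord !mxE /GRing.scale/= mulr1; case: ifPn => _.
  by rewrite mul1r.
by rewrite mul0r add0r.
Qed.

Lemma dir_rho y x (k : 'I_d) :
  is_derive x (delta_mx ord0 k) (rho y) (2 * ((x : 'rV[R]_d) ord0 k - y ord0 k)).
Proof.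
have H j : is_derive x (delta_mx ord0 k)
   (fun z : 'rV[R]_d => (z ord0 j - y ord0 j) ^+ 2)
   (if j == k then 2 * (x ord0 k - y ord0 k) else 0).
  have D1 := dirB (dir_coord x k j) (dir_cst (y ord0 j) x (delta_mx ord0 k)).
  apply: (is_derive_eq (dirM D1 D1)); rewrite subr0.
  by have [->|_] := eqVneq j k; rewrite /=; ring.
apply: (is_derive_eq (dir_sum H)).
by rewrite -big_mkcond big_pred1_eq.
Qed.

End coordinates.

Section continuity.
Context (R : realType) (T : topologicalType).
Implicit Types f g : T -> R.

Lemma ctsD f g : continuous f -> continuous g -> continuous (fun x => f x + g x).
Proof. by move=> cf cg x; apply: cvgD; [exact: cf|exact: cg]. Qed.
Lemma ctsN f : continuous f -> continuous (fun x => - f x).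
Proof. by move=> cf x; apply: cvgN; exact: cf. Qed.
Lemma ctsM f g : continuous f -> continuous g -> continuous (fun x => f x * g x).
Proof. by move=> cf cg x; apply: cvgM; [exact: cf|exact: cg]. Qed.
Lemma ctsC (c : R) : continuous (fun _ : T => c).
Proof. by move=> x; exact: cvg_cst. Qed.
Lemma ctsX f n : continuous f -> continuous (fun x => f x ^+ n).
Proof.
move=> cf; elim: n => [|n IH]; first exact: ctsC.
rewrite (_ : (fun _ => _) = (fun x => f x * f x ^+ n)); first exact: ctsM.
by apply/funext => x; rewrite exprS.
Qed.
Lemma ctsV f : (forall x, f x != 0) -> continuous f -> continuous (fun x => (f x)^-1).
Proof. by move=> f0 cf x; apply: cvgV => //; exact: cf. Qed.
Lemma cts_comp f (g : R -> R) : continuous f -> continuous g ->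
  continuous (fun x => g (f x)).
Proof. by move=> cf cg x; apply: (cvg_comp f g); [exact: cf|exact: cg]. Qed.
Lemma cts_sum (I : Type) (r : seq I) (P : pred I) (F : I -> T -> R) :
  (forall i, continuous (F i)) -> continuous (fun x => \sum_(i <- r | P i) F i x).
Proof.
move=> cF; elim: r => [|i r IH].
  by rewrite (_ : (fun _ => _) = fun=> 0); [exact: ctsC|apply/funext => x; rewrite big_nil].
rewrite (_ : (fun _ => _) = fun x => if P i then F i x + \sum_(j <- r | P j) F j x
   else \sum_(j <- r | P j) F j x); last by apply/funext => x; rewrite big_cons.
by case: (P i) => //; exact: ctsD.
Qed.
Lemma cts_prod (I : Type) (r : seq I) (P : pred I) (F : I -> T -> R) :
  (forall i, continuous (F i)) -> continuous (fun x => \prod_(i <- r | P i) F i x).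
Proof.
move=> cF; elim: r => [|i r IH].
  by rewrite (_ : (fun _ => _) = fun=> 1); [exact: ctsC|apply/funext => x; rewrite big_nil].
rewrite (_ : (fun _ => _) = fun x => if P i then F i x * \prod_(j <- r | P j) F j x
   else \prod_(j <- r | P j) F j x); last by apply/funext => x; rewrite big_cons.
by case: (P i) => //; exact: ctsM.
Qed.

End continuity.

Lemma cts_fst (R : realType) (T : topologicalType) : continuous (fun w : R * T => w.1).
Proof. by move=> w; exact: cvg_fst. Qed.

Lemma cts_coord2 (R : realType) (d : nat) (k : 'I_d) :
  continuous (fun w : R * 'rV[R]_d => w.2 ord0 k).
Proof.
move=> w; apply: (cvg_comp (fun w : R * 'rV[R]_d => w.2) (fun x : 'rV[R]_d => x ord0 k)).
  exact: cvg_snd.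
exact: coord_continuous.
Qed.

Lemma cts_rho2 (R : realType) (d : nat) (y : 'rV[R]_d) :
  continuous (fun w : R * 'rV[R]_d => rho y w.2).
Proof.
apply: cts_sum => i; apply: ctsX; apply: ctsD; first exact: cts_coord2.
exact: ctsC.
Qed.

Section kernel.
Context (R : realType) (d : nat) (e t0 th : R) (y : 'rV[R]_d).
Hypothesis e0 : 0 < e.
Local Notation u k x := (x ord0 k - y ord0 k).

(* With z = e + i (s - t0), kN = |z|^2 and 1/z = kal - i kbe, and
   kp + i kq = exp(i th) z^(-d/2) exp(- |x - y|^2 / (2 z)) is an explicit solution
   of the free equation; suffixes x, xx, s stand for its derivatives. *)
Definition kN (s : R) : R := e ^+ 2 + (s - t0) ^+ 2.
Definition kal (s : R) : R := e / kN s.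
Definition kbe (s : R) : R := (s - t0) / kN s.
Definition kA (s : R) (x : 'rV[R]_d) : R :=
  - (d%:R / 4) * ln (kN s) - kal s * rho y x / 2.
Definition kT (s : R) (x : 'rV[R]_d) : R :=
  kbe s * rho y x / 2 - d%:R / 2 * atan ((s - t0) / e) + th.
Definition kp s x : R := expR (kA s x) * cos (kT s x).
Definition kq s x : R := expR (kA s x) * sin (kT s x).
Definition kpx k s (x : 'rV[R]_d) : R := - (kal s * u k x) * kp s x - kbe s * u k x * kq s x.
Definition kqx k s (x : 'rV[R]_d) : R := - (kal s * u k x) * kq s x + kbe s * u k x * kp s x.
Definition kpxx k s (x : 'rV[R]_d) : R := - kal s * kp s x - kbe s * kq s x
  - kal s * u k x * kpx k s x - kbe s * u k x * kqx k s x.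
Definition kqxx k s (x : 'rV[R]_d) : R := - kal s * kq s x + kbe s * kp s x
  - kal s * u k x * kqx k s x + kbe s * u k x * kpx k s x.
Definition kps s x : R := - 2^-1 * \sum_(k < d) kqxx k s x.
Definition kqs s x : R := 2^-1 * \sum_(k < d) kpxx k s x.

Lemma kN_gt0 s : 0 < kN s.
Proof. by rewrite ltr_pwDl ?exprn_gt0 ?sqr_ge0. Qed.

Lemma kN_neq0 s : kN s != 0. Proof. by rewrite gt_eqF// kN_gt0. Qed.

Lemma dir_kA s x k : is_derive x (delta_mx ord0 k) (kA s) (- (kal s * u k x)).
Proof.
apply: (is_derive_eq (dirB (dir_cst (- (d%:R / 4) * ln (kN s)) _ _)
  (dirM (dirZ (kal s) (dir_rho y x k)) (dir_cst (2^-1) _ _)))).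
by field.
Qed.

Lemma dir_kT s x k : is_derive x (delta_mx ord0 k) (kT s) (kbe s * u k x).
Proof.
apply: (is_derive_eq (dirD (dirB (dirM (dirZ (kbe s) (dir_rho y x k)) (dir_cst (2^-1) _ _))
  (dir_cst (d%:R / 2 * atan ((s - t0) / e)) _ _)) (dir_cst th _ _))).
by field.
Qed.

Lemma dir_shifted_coord x k : is_derive x (delta_mx ord0 k) (fun z : 'rV[R]_d => u k z) 1.
Proof.
apply: (is_derive_eq (dirB (dir_coord x k k) (dir_cst _ _ _))).
by rewrite eqxx subr0.
Qed.

Lemma dir_kp s x k : is_derive x (delta_mx ord0 k) (kp s) (kpx k s x).
Proof.
apply: (is_derive_eq (dirM (dir_comp (dir_kA s x k) (is_derive_expR _))
  (dir_comp (dir_kT s x k) (is_derive_cos _)))).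
by rewrite /kpx /kp /kq; ring.
Qed.

Lemma dir_kq s x k : is_derive x (delta_mx ord0 k) (kq s) (kqx k s x).
Proof.
apply: (is_derive_eq (dirM (dir_comp (dir_kA s x k) (is_derive_expR _))
  (dir_comp (dir_kT s x k) (is_derive_sin _)))).
by rewrite /kqx /kp /kq; ring.
Qed.

Lemma dir_kpx s x k : is_derive x (delta_mx ord0 k) (kpx k s) (kpxx k s x).
Proof.
apply: (is_derive_eq (dirB (dirM (dirN (dirZ (kal s) (dir_shifted_coord x k))) (dir_kp s x k))
  (dirM (dirZ (kbe s) (dir_shifted_coord x k)) (dir_kq s x k)))).
by rewrite /kpxx; ring.
Qed.

Lemma dir_kqx s x k : is_derive x (delta_mx ord0 k) (kqx k s) (kqxx k s x).
Proof.
apply: (is_derive_eq (dirD (dirM (dirN (dirZ (kal s) (dir_shifted_coord x k))) (dir_kq s x k))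
  (dirM (dirZ (kbe s) (dir_shifted_coord x k)) (dir_kp s x k)))).
by rewrite /kqxx; ring.
Qed.

Lemma der_kN s : is_derive s (1 : R) kN (2 * (s - t0)).
Proof.
have D := dirB (is_derive_id s (1 : R)) (dir_cst t0 _ _).
apply: (is_derive_eq (dirD (dir_cst (e ^+ 2) _ _) (dirM D D))).
by ring.
Qed.

(** Real part of [d(1/z)/ds = - i / z^2] for [1/z = kal - i kbe]; the imaginary part is
    [der_kbe]. *)
Lemma der_kal s : is_derive s (1 : R) kal (- (2 * kal s * kbe s)).
Proof.
apply: (is_derive_eq (dirZ e (is_deriveV (kN_neq0 s) (der_kN s)))).
by rewrite /kal /kbe /GRing.scale/=; field; rewrite kN_neq0.
Qed.

Lemma kal2_kbe2 s : kal s ^+ 2 + kbe s ^+ 2 = (kN s)^-1.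
Proof.
rewrite /kal /kbe !exprMn -mulrDl -/(kN s).
by field; rewrite kN_neq0.
Qed.

Lemma der_kbe s : is_derive s (1 : R) kbe (kal s ^+ 2 - kbe s ^+ 2).
Proof.
apply: (is_derive_eq (dirM (dirB (is_derive_id s (1 : R)) (dir_cst t0 _ _))
  (is_deriveV (kN_neq0 s) (der_kN s)))).
rewrite /kal /kbe /GRing.scale/= subr0 mul1r.
have E : e ^+ 2 = kN s - (s - t0) ^+ 2 by rewrite /kN; ring.
rewrite !exprMn E.
by field; rewrite kN_neq0.
Qed.

Lemma der_kA s x : is_derive s (1 : R) (kA^~ x)
  (- (d%:R / 2) * kbe s + rho y x * kal s * kbe s).
Proof.
apply: (is_derive_eq (dirB (dirZ (- (d%:R / 4))
    (dir_comp (der_kN s) (is_derive1_ln (kN_gt0 s))))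
  (dirM (dirM (der_kal s) (dir_cst (rho y x) _ _)) (dir_cst 2^-1 _ _)))).
by rewrite /kal /kbe; field; rewrite kN_neq0.
Qed.

Lemma der_kT s x : is_derive s (1 : R) (kT^~ x)
  (rho y x * (kal s ^+ 2 - kbe s ^+ 2) / 2 - d%:R / 2 * kal s).
Proof.
apply: (is_derive_eq (dirD (dirB
  (dirM (dirM (der_kbe s) (dir_cst (rho y x) _ _)) (dir_cst 2^-1 _ _))
  (dirZ (d%:R / 2) (dir_comp
    (dirM (dirB (is_derive_id s (1 : R)) (dir_cst t0 _ _)) (dir_cst e^-1 _ _))
    (is_derive1_atan _)))) (dir_cst th _ _))).
have -> : 1 + ((s - t0) / e) ^+ 2 = kN s / e ^+ 2.
  by rewrite /kN; field; rewrite gt_eqF.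
rewrite /kal; field.
by rewrite kN_neq0 gt_eqF.
Qed.

(** Imaginary part of [Laplacian w = (- d / z + rho / z^2) w] with [w = kp + i kq]; the real part is
    [sum_kpxx]. *)
Lemma sum_kqxx s x : \sum_(k < d) kqxx k s x =
  d%:R * (kbe s * kp s x - kal s * kq s x) +
  rho y x * ((kal s ^+ 2 - kbe s ^+ 2) * kq s x - 2 * kal s * kbe s * kp s x).
Proof.
rewrite /rho mulr_suml -[d in d%:R]card_ord -sum1_card natr_sum mulr_suml -big_split/=.
by apply: eq_bigr => k _; rewrite /kqxx /kqx /kpx; ring.
Qed.

Lemma sum_kpxx s x : \sum_(k < d) kpxx k s x =
  - d%:R * (kal s * kp s x + kbe s * kq s x) +
  rho y x * ((kal s ^+ 2 - kbe s ^+ 2) * kp s x + 2 * kal s * kbe s * kq s x).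
Proof.
rewrite /rho mulr_suml -[d in d%:R]card_ord -sum1_card natr_sum mulNr mulr_suml -sumrN -big_split/=.
by apply: eq_bigr => k _; rewrite /kpxx /kqx /kpx; ring.
Qed.

(** As [kps] and [kqs] are defined by the right-hand side of the equation, this and [der_kq] express
    that the kernel is an exact solution. *)
Lemma der_kp s x : is_derive s (1 : R) (kp^~ x) (kps s x).
Proof.
apply: (is_derive_eq (dirM (dir_comp (der_kA s x) (is_derive_expR _))
  (dir_comp (der_kT s x) (is_derive_cos _)))).
by rewrite /kps sum_kqxx /kp /kq; field.
Qed.

Lemma der_kq s x : is_derive s (1 : R) (kq^~ x) (kqs s x).
Proof.
apply: (is_derive_eq (dirM (dir_comp (der_kA s x) (is_derive_expR _))
  (dir_comp (der_kT s x) (is_derive_sin _)))).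
by rewrite /kqs sum_kpxx /kp /kq; field.
Qed.

Local Notation cts2 F := (continuous (fun w : R * 'rV[R]_d => F w.1 w.2)).

Lemma cts_s : continuous (fun w : R * 'rV[R]_d => w.1 - t0).
Proof. by apply: ctsD; [exact: cts_fst|exact: ctsC]. Qed.

Lemma cts_kN : continuous (fun w : R * 'rV[R]_d => kN w.1).
Proof. by apply: ctsD; [exact: ctsC|apply: ctsX; exact: cts_s]. Qed.

Lemma cts_kal : continuous (fun w : R * 'rV[R]_d => kal w.1).
Proof.
apply: ctsM; first exact: ctsC.
by apply: ctsV; [move=> w; exact: kN_neq0|exact: cts_kN].
Qed.

Lemma cts_kbe : continuous (fun w : R * 'rV[R]_d => kbe w.1).
Proof.
apply: ctsM; first exact: cts_s.
by apply: ctsV; [move=> w; exact: kN_neq0|exact: cts_kN].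
Qed.

Lemma cts_kA : cts2 kA.
Proof.
apply: ctsD.
  apply: ctsM; first exact: ctsC.
  move=> w; apply: (cvg_comp (fun w : R * 'rV[R]_d => kN w.1) (@ln R)).
    exact: cts_kN.
  by apply: continuous_ln; exact: kN_gt0.
apply: ctsN; apply: ctsM; last exact: ctsC.
by apply: ctsM; [exact: cts_kal|exact: cts_rho2].
Qed.

Lemma cts_kT : cts2 kT.
Proof.
apply: ctsD; last exact: ctsC.
apply: ctsD.
  apply: ctsM; last exact: ctsC.
  by apply: ctsM; [exact: cts_kbe|exact: cts_rho2].
apply: ctsN; apply: ctsM; first exact: ctsC.
apply: (@cts_comp _ _ (fun w : R * 'rV[R]_d => (w.1 - t0) / e)).
  by apply: ctsM; [exact: cts_s|exact: ctsC].
by move=> z; exact: continuous_atan.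
Qed.

Lemma cts_kp : cts2 kp.
Proof.
apply: ctsM.
  by apply: (cts_comp cts_kA) => z; exact: continuous_expR.
by apply: (cts_comp cts_kT) => z; exact: continuous_cos.
Qed.

Lemma cts_kq : cts2 kq.
Proof.
apply: ctsM.
  by apply: (cts_comp cts_kA) => z; exact: continuous_expR.
by apply: (cts_comp cts_kT) => z; exact: continuous_sin.
Qed.

Lemma cts_u k : continuous (fun w : R * 'rV[R]_d => u k w.2).
Proof. by apply: ctsD; [exact: cts_coord2|exact: ctsC]. Qed.

Lemma cts_kalu k : continuous (fun w : R * 'rV[R]_d => kal w.1 * u k w.2).
Proof. by apply: ctsM; [exact: cts_kal|exact: cts_u]. Qed.

Lemma cts_kbeu k : continuous (fun w : R * 'rV[R]_d => kbe w.1 * u k w.2).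
Proof. by apply: ctsM; [exact: cts_kbe|exact: cts_u]. Qed.

Lemma cts_kpx k : cts2 (kpx k).
Proof.
apply: ctsD.
  by apply: ctsM; [apply: ctsN; exact: cts_kalu|exact: cts_kp].
by apply: ctsN; apply: ctsM; [exact: cts_kbeu|exact: cts_kq].
Qed.

Lemma cts_kqx k : cts2 (kqx k).
Proof.
apply: ctsD.
  by apply: ctsM; [apply: ctsN; exact: cts_kalu|exact: cts_kq].
by apply: ctsM; [exact: cts_kbeu|exact: cts_kp].
Qed.

Lemma cts_kpxx k : cts2 (kpxx k).
Proof.
apply: ctsD; first apply: ctsD; first apply: ctsD.
- by apply: ctsM; [apply: ctsN; exact: cts_kal|exact: cts_kp].
- by apply: ctsN; apply: ctsM; [exact: cts_kbe|exact: cts_kq].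
- by apply: ctsN; apply: ctsM; [exact: cts_kalu|exact: cts_kpx].
- by apply: ctsN; apply: ctsM; [exact: cts_kbeu|exact: cts_kqx].
Qed.

Lemma cts_kqxx k : cts2 (kqxx k).
Proof.
apply: ctsD; first apply: ctsD; first apply: ctsD.
- by apply: ctsM; [apply: ctsN; exact: cts_kal|exact: cts_kq].
- by apply: ctsM; [exact: cts_kbe|exact: cts_kp].
- by apply: ctsN; apply: ctsM; [exact: cts_kalu|exact: cts_kqx].
- by apply: ctsM; [exact: cts_kbeu|exact: cts_kpx].
Qed.

Lemma cts_kps : cts2 kps.
Proof. by apply: ctsM; [exact: ctsC|apply: cts_sum; exact: cts_kqxx]. Qed.

Lemma cts_kqs : cts2 kqs.
Proof. by apply: ctsM; [exact: ctsC|apply: cts_sum; exact: cts_kpxx]. Qed.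

End kernel.

(** * Gaussian-weighted integrals *)

Section weighted_integral.
Context (R : realType) (d : nat) (c : R) (y : 'rV[R]_d).
Hypothesis c0 : 0 < c.
Local Notation mu := (@lebesgue_rV R d).
Implicit Types h : 'rV[R]_d -> R.

Definition wt (x : 'rV[R]_d) : R := expR (- (c * rho y x)).
Definition wint h : \bar R := (\int[mu]_x (h x * wt x)%:E)%E.
Definition wmass : R := fine (\int[mu]_x (wt x)%:E)%E.

Lemma rho_ge0 x : 0 <= rho y x.
Proof. by apply: sumr_ge0 => i _; exact: sqr_ge0. Qed.

Lemma measurable_rho : measurable_fun [set: 'rV[R]_d] (rho y).
Proof.
apply: measurable_sum => i; apply: measurable_funX.
by apply: measurable_funB => //; exact: measurable_coord.
Qed.

Lemma measurable_wt : measurable_fun [set: 'rV[R]_d] wt.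
Proof.
apply: measurableT_comp => //; apply: measurableT_comp => //.
by apply: measurable_funM => //; exact: measurable_rho.
Qed.

Lemma wt_ge0 x : 0 <= wt x. Proof. exact: expR_ge0. Qed.

Lemma wt_le1 x : wt x <= 1.
Proof. by rewrite -expR0 ler_expR oppr_le0 mulr_ge0 ?rho_ge0// ltW. Qed.

Lemma wmassE : (\int[mu]_x (wt x)%:E)%E = wmass%:E.
Proof.
rewrite /wmass fineK// ge0_fin_numE ?integral_gauss_rV_fin//.
by apply: integral_ge0 => x _; rewrite lee_fin wt_ge0.
Qed.

Lemma wmass_ge0 : 0 <= wmass.
Proof. by apply: fine_ge0; apply: integral_ge0 => x _; rewrite lee_fin wt_ge0. Qed.

Lemma measurable_mulwt h : measurable_fun [set: 'rV[R]_d] h ->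
  measurable_fun [set: 'rV[R]_d] (fun x => (h x * wt x)%:E).
Proof. by move=> mh; apply/measurable_EFinP/measurable_funM => //; exact: measurable_wt. Qed.

Lemma le_wint h1 h2 : measurable_fun [set: 'rV[R]_d] h1 ->
  measurable_fun [set: 'rV[R]_d] h2 -> (forall x, 0 <= h1 x <= h2 x) ->
  (wint h1 <= wint h2)%E.
Proof.
move=> m1 m2 h12; apply: ge0_le_integral => //.
- by move=> x _; have /andP[h10 _] := h12 x; rewrite lee_fin mulr_ge0 ?wt_ge0.
- exact: measurable_mulwt.
- exact: measurable_mulwt.
- by move=> x _; have /andP[_ h] := h12 x; rewrite lee_fin ler_wpM2r ?wt_ge0.
Qed.

Lemma wintD h1 h2 : measurable_fun [set: 'rV[R]_d] h1 ->
  measurable_fun [set: 'rV[R]_d] h2 ->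
  (forall x, 0 <= h1 x) -> (forall x, 0 <= h2 x) ->
  wint (fun x => h1 x + h2 x) = (wint h1 + wint h2)%E.
Proof.
move=> m1 m2 h1p h2p; rewrite -ge0_integralD//.
- by apply: eq_integral => x _; rewrite mulrDl EFinD.
- by move=> x _; rewrite lee_fin mulr_ge0 ?wt_ge0.
- exact: measurable_mulwt.
- by move=> x _; rewrite lee_fin mulr_ge0 ?wt_ge0.
- exact: measurable_mulwt.
Qed.

(** [Lnorm] with exponent [+oo] is an essential supremum only over a space of positive measure. *)
Lemma lebesgue_rV_gt0 : (0 < mu [set: 'rV[R]_d])%E.
Proof.
apply: (@lt_le_trans _ _ (mu (box 0 1))).
  by rewrite [ltRHS](lebesgue_box 0 ler01) lte_fin exprn_gt0.
by apply: le_measure; rewrite ?inE//; exact: measurable_box.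
Qed.

(* With eta the norm, [h <= eta ((h / eta)^p + 1)] treats all finite p >= 1
   at once and makes a dual exponent unnecessary. *)
Lemma wint_le_Lnorm (p : \bar R) h (eta : R) : (1 <= p)%E -> 0 < eta ->
  measurable_fun [set: 'rV[R]_d] h -> (forall x, 0 <= h x) ->
  (Lnorm mu p (EFin \o h) <= eta%:E)%E -> (wint h <= (eta * (1 + wmass))%:E)%E.
Proof.
move=> p1 e0 mh h0.
have mw := measurable_wt.
rewrite unlock; case: p p1 => [p| |//] p1; last first.
  rewrite lebesgue_rV_gt0 => /ess_supP hE.
  apply: (@le_trans _ _ (\int[mu]_x (eta%:E * (wt x)%:E))%E); last first.
    rewrite ge0_integralZl//.
    - by rewrite wmassE -EFinM lee_fin ler_wpM2l ?(ltW e0)// lerDr.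
    - exact/measurable_EFinP.
    - by move=> x _; rewrite lee_fin wt_ge0.
    - by rewrite lee_fin ltW.
  apply: ae_ge0_le_integral => //.
  - by move=> x _; rewrite lee_fin mulr_ge0 ?wt_ge0.
  - exact: measurable_mulwt.
  - by move=> x _; rewrite -EFinM lee_fin mulr_ge0 ?wt_ge0 ?ltW.
  - under eq_fun do rewrite -EFinM.
    by apply/measurable_EFinP; exact: measurable_funM.
  - move: hE; apply: filterS => x /= hx _.
    rewrite -EFinM lee_fin ler_wpM2r ?wt_ge0// -lee_fin.
    by move: hx; rewrite /= ger0_norm.
rewrite lee_fin in p1; have p0 : 0 < p by rewrite (lt_le_trans ltr01).
set I := (\int[mu]_x _)%E => IE.
have I0 : (0 <= I)%E by apply: integral_ge0 => x _; exact: poweR_ge0.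
have {IE} : (I <= (eta `^ p)%:E)%E.
  have -> : I = ((I `^ p^-1) `^ p)%E.
    by rewrite -poweRrM mulVf ?poweRe1// gt_eqF.
  rewrite -poweR_EFin; apply: gt0_ler_poweR => //; first exact: ltW.
  - by rewrite in_itv/= poweR_ge0 leey.
  - by rewrite in_itv/= lee_fin ltW// leey.
rewrite /I (eq_integral (fun x => (h x `^ p)%:E)); last first.
  by move=> x _; rewrite /= ger0_norm// poweR_EFin.
(* [a = eta^(1 - p)], so that [a h^p = eta (h / eta)^p], and the bound on the integral of [h^p]
   becomes [a eta^p = eta]. *)
move=> IE; set a := eta * (eta `^ p)^-1.
have a0 : 0 <= a by rewrite mulr_ge0 ?invr_ge0 ?powR_ge0 ?ltW.
have mhp : measurable_fun [set: 'rV[R]_d] (fun x => h x `^ p).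
  exact: (measurableT_comp (measurable_powR p) mh).
apply: (@le_trans _ _ (\int[mu]_x (a%:E * (h x `^ p)%:E + eta%:E * (wt x)%:E))%E).
  apply: ge0_le_integral => //.
  - by move=> x _; rewrite lee_fin mulr_ge0 ?wt_ge0.
  - exact: measurable_mulwt.
  - under eq_fun do rewrite -!EFinM -EFinD.
    by apply/measurable_EFinP; apply: measurable_funD; exact: measurable_funM.
  move=> x _; rewrite -!EFinM -EFinD lee_fin.
  have ep : 0 < eta `^ p by rewrite powR_gt0.
  have hp0 : 0 <= a * h x `^ p by rewrite mulr_ge0 ?powR_ge0.
  (* Below [eta] the weighted term pays; above it [h / eta >= 1] is at most its [p]-th power, and
     the weight, at most 1, is dropped. *)
  have [hx|hx] := leP (h x) eta.
    by rewrite -[leLHS]add0r lerD// ler_wpM2r ?wt_ge0.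
  rewrite -[leLHS]addr0 lerD//; last by rewrite mulr_ge0 ?wt_ge0 ?ltW.
  apply: (@le_trans _ _ (h x)); first by rewrite ler_piMr ?wt_le1.
  have q1 : 1 <= h x / eta by rewrite ler_pdivlMr// mul1r ltW.
  have -> : a * h x `^ p = eta * (h x / eta) `^ p.
    rewrite powRM ?invr_ge0 ?(ltW e0)// -(powR_inv1 (ltW e0)) -powRrM mulN1r powRN /a.
    by rewrite mulrA mulrAC.
  by rewrite -ler_pdivrMl// mulrC le1r_powR.
rewrite ge0_integralD//.
- rewrite !ge0_integralZl//.
  + rewrite wmassE mulrDr mulr1 EFinD EFinM leeD//.
    apply: (@le_trans _ _ (a%:E * (eta `^ p)%:E)%E); first by rewrite lee_wpmul2l ?lee_fin.
    by rewrite -EFinM lee_fin /a mulrVK// unitfE gt_eqF// powR_gt0.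
  + exact/measurable_EFinP.
  + by move=> x _; rewrite lee_fin wt_ge0.
  + by rewrite lee_fin ltW.
  + exact/measurable_EFinP.
  + by move=> x _; rewrite lee_fin powR_ge0.
- by move=> x _; rewrite -EFinM lee_fin mulr_ge0 ?powR_ge0.
- under eq_fun do rewrite -EFinM.
  by apply/measurable_EFinP; exact: measurable_funM.
- by move=> x _; rewrite -EFinM lee_fin mulr_ge0 ?wt_ge0 ?ltW.
- under eq_fun do rewrite -EFinM.
  by apply/measurable_EFinP; exact: measurable_funM.
Qed.

End weighted_integral.

(* Since n may be infinite a priori, compactness alone is not enough: finiteness
   has to be propagated from a. *)
Lemma locally_controlled_bounded (R : realType) (n : R -> \bar R) (a b : R) :
  a <= b -> (n a < +oo)%E ->
  (forall s, a <= s <= b -> exists2 e : R, 0 < e &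
    forall s1 s2, a <= s1 <= b -> a <= s2 <= b ->
      `|s1 - s| < e -> `|s2 - s| < e -> (n s2 <= n s1 + 1)%E) ->
  exists K : R, forall s, a <= s <= b -> (n s <= K%:E)%E.
Proof.
move=> ab na loc.
(* Continuous induction: [S] collects the points up to which [n] has a finite uniform bound, and its
   supremum is shown to reach [b]. *)
pose S : set R := [set z | a <= z <= b /\
  exists K : R, forall s, a <= s <= z -> (n s <= K%:E)%E].
have Sa : S a.
  split; first by rewrite lexx.
  exists (fine (n a)) => s /andP[as_ sa].
  have -> : s = a by apply/eqP; rewrite eq_le sa.
  by case: (n a) na => //= _; rewrite leNye.
have Sub : ubound S b by move=> z [/andP[]].
have hS : has_sup S by split; [exists a|exists b].
pose m := sup S.
have am : a <= m by exact: (sup_upper_bound hS).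
have mb : m <= b by apply: ge_sup => //; exists a.
have [e e0 He] := loc m (introT andP (conj am mb)).
have [z [/andP[az zb] [K HK]] mz] := sup_adherent e0 hS.
have zm : z <= m by apply: (sup_upper_bound hS); split; [exact/andP|exists K].
(* The control around [m = sup S], anchored at some [z] in [S] within [e] of [m], carries the bound
   past [m]. Since [m + e / 2 <= m] is impossible, [w] must be [b]. *)
pose w := Num.min b (m + e / 2).
have Hw : S w.
  split.
    by rewrite ge_min lexx/= le_min ab/= (le_trans am)// lerDl divr_ge0// ltW.
  exists (`|K| + 1) => s /andP[as_]; rewrite /w le_min => /andP[sb sme].
  have [sz|sz] := leP s z.
    apply: le_trans (HK s _) _; first by rewrite as_.
    by rewrite lee_fin (le_trans (ler_norm K))// lerDl.
  apply: (@le_trans _ _ (n z + 1)%E).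
    apply: He; rewrite ?az ?as_//.
      by rewrite ltr_distl; apply/andP; split; [exact: mz|lra].
    by rewrite ltr_distl; apply/andP; split; [exact: lt_trans mz sz|lra].
  rewrite EFinD leeD2r//; apply: le_trans (HK z _) _; first by rewrite az lexx.
  by rewrite lee_fin ler_norm.
have : w <= m by exact: (sup_upper_bound hS).
rewrite /w ge_min => /orP[bm|h]; last by exfalso; lra.
have wb : w = b by rewrite /w; apply: min_l; lra.
by move: Hw; rewrite wb => -[_].
Qed.

(** * Green's formula on a box and the cutoff *)

Section green.
Context (R : realType).

Lemma is_derive_continuous (F : R -> R) (z a : R) :
  is_derive z (1 : R) F a -> {for z, continuous F}.
Proof.
move=> [dF _]; apply: differentiable_continuous.
exact/derivable1_diffP.
Qed.

Lemma integral_derive_eq0 (F f : R -> R) (a b : R) : a < b ->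
  (forall z, is_derive z (1 : R) F (f z)) -> continuous f ->
  F a = 0 -> F b = 0 ->
  (\int[lebesgue_measure]_(z in `[a, b]) (f z)%:E = 0)%E.
Proof.
move=> ab dF cf Fa Fb; rewrite (@continuous_FTC2 _ f F a b)//.
- by rewrite Fa Fb subee.
- exact: continuous_subspaceT.
- split.
  + by move=> z _; have [] := dF z.
  + by apply: cvg_at_right_filter; exact: is_derive_continuous (dF a).
  + by apply: cvg_at_left_filter; exact: is_derive_continuous (dF b).
- move=> z _; rewrite derive1E; have [_] := dF z.
  by move=> <-.
Qed.

Variable d : nat.
Local Notation mu := (@lebesgue_rV R d).
Implicit Types (x y : 'rV[R]_d).

Lemma continuous_upd (k : 'I_d) x : continuous (fun z : R => upd k z x).
Proof.
move=> z B /= /nbhs_ballP[e /= e0 eB]; apply/nbhs_ballP; exists e => // z' zz'.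
apply: eB; split => // i j; rewrite (ord1 i) !mxE; case: ifPn => // _.
exact: ballxx.
Qed.

Lemma patch_indic (A : set 'rV[R]_d) (H : 'rV[R]_d -> R) :
  (EFin \o H) \_ A = fun x => (H x * \1_A x)%:E.
Proof.
apply/funext => x; rewrite patchE indicE; case: ifPn => _.
  by rewrite mulr1.
by rewrite mulr0.
Qed.

Lemma continuous_box_bound y (r : R) (H : 'rV[R]_d -> R) : continuous H ->
  exists2 M, 0 <= M & forall x, box y r x -> `|H x| <= M.
Proof.
move=> cH.
have : compact [set H x | x in box y r].
  apply: continuous_compact; last exact: compact_box.
  exact: continuous_subspaceT.
move=> /compact_bounded[M [Mr HM]]; exists (`|M| + 1) => [|x Bx].
  by rewrite addr_ge0.
apply: (HM (`|M| + 1)); first by rewrite ltr_pwDr// ler_norm.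
by exists x.
Qed.

(** A line in direction [k] either misses the box or meets it in the full interval. Putting the
    centre value in coordinate [k] makes the first factor a test of the other coordinates; if
    [r < 0] both sides vanish. *)
Lemma indic_box_upd (k : 'I_d) y (r z : R) x :
  \1_(box y r) (upd k z x) =
  \1_(box y r) (upd k (y ord0 k) x) * \1_`[y ord0 k - r, y ord0 k + r] z :> R.
Proof.
rewrite !indic_box (bigD1 k)//= [in RHS](bigD1 k)//= !mxE eqxx.
rewrite (eq_bigr (fun i => \1_`[y ord0 i - r, y ord0 i + r] (x ord0 i))); last first.
  by move=> i /negbTE ik; rewrite mxE ik.
rewrite [in RHS](eq_bigr (fun i => \1_`[y ord0 i - r, y ord0 i + r] (x ord0 i))); last first.
  by move=> i /negbTE ik; rewrite mxE ik.
have [r0|r0] := leP 0 r.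
  rewrite [in RHS]indicE [X in (X : bool)%:R]mem_set ?mul1r 1?mulrC//=.
  by rewrite in_itv/= lerBlDr !lerDl r0.
rewrite [X in X * _]indicE memNset ?mul0r; last first.
  by rewrite /= in_itv/= => /andP[h1 h2]; lra.
rewrite [X in _ = _ * X]indicE memNset ?mulr0//.
by rewrite /= in_itv/= => /andP[h1 h2]; lra.
Qed.

(** On each line in direction [k] the integrand is the derivative of [Vx W - V Wx], which vanishes
    at both ends because [W] and [Wx] do on the faces; nothing is asked of [V] there.
    [integral_lines_eq0] then integrates over the remaining coordinates. *)
Lemma green_box (k : 'I_d) y (r : R) (V Vx Vxx W Wx Wxx : 'rV[R]_d -> R) :
  0 < r ->
  (forall x, is_derive x (delta_mx ord0 k) V (Vx x)) ->
  (forall x, is_derive x (delta_mx ord0 k) Vx (Vxx x)) ->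
  (forall x, is_derive x (delta_mx ord0 k) W (Wx x)) ->
  (forall x, is_derive x (delta_mx ord0 k) Wx (Wxx x)) ->
  continuous V -> continuous Vxx -> continuous W -> continuous Wxx ->
  (forall x, `|x ord0 k - y ord0 k| = r -> W x = 0 /\ Wx x = 0) ->
  (\int[mu]_(x in box y r) (Vxx x * W x - V x * Wxx x)%:E = 0)%E.
Proof.
move=> r0 dV dVx dW dWx cV cVxx cW cWxx W0.
pose H x := Vxx x * W x - V x * Wxx x.
have cH : continuous H.
  by apply: ctsD; [exact: ctsM|apply: ctsN; exact: ctsM].
rewrite integral_mkcond (patch_indic _ H).
have [M M0 HM] := continuous_box_bound y r cH.
apply: (integral_lines_eq0 (k := k) (y := y) (ltW r0) M0).
- apply: measurable_funM; first exact: continuous_measurable_rV.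
  by apply: measurable_indic; exact: measurable_box.
- move=> x; rewrite normrM [X in _ * X <= _]ger0_norm; last by rewrite indicE.
  rewrite indicE; have [Bx|_] := boolP (x \in box y r); last by rewrite !mulr0.
  by rewrite !mulr1; apply: HM; exact/set_mem.
move=> x.
pose c : R := \1_(box y r) (upd k (y ord0 k) x).
pose J : set R := `[y ord0 k - r, y ord0 k + r]%classic.
have -> : (\int[lebesgue_measure]_z (H (upd k z x) * \1_(box y r) (upd k z x))%:E =
   \int[lebesgue_measure]_(z in J)
     (c * H (upd k z x))%:E)%E.
  rewrite [RHS]integral_mkcond; apply: eq_integral => z _.
  rewrite indic_box_upd -/c -/J patchE [\1_J z]indicE mulrA [_ * c]mulrC.
  by case: ifPn => _; rewrite ?mulr1 ?mulr0.
apply: (integral_derive_eq0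
  (F := fun z => c * (Vx (upd k z x) * W (upd k z x) - V (upd k z x) * Wx (upd k z x)))).
- by lra.
- move=> z; apply: (is_derive_eq (dirZ c (dirB
    (dirM (dir_upd (dVx _)) (dir_upd (dW _))) (dirM (dir_upd (dV _)) (dir_upd (dWx _)))))).
  by rewrite /H; ring.
- apply: ctsM; first exact: ctsC.
  move=> z; apply: (cvg_comp (fun z => upd k z x) H); [exact: continuous_upd|exact: cH].
- have [|-> ->] := W0 (upd k (y ord0 k - r) x); last by rewrite !mulr0 subrr mulr0.
  by rewrite mxE eqxx addrAC subrr sub0r normrN gtr0_norm.
- have [|-> ->] := W0 (upd k (y ord0 k + r) x); last by rewrite !mulr0 subrr mulr0.
  by rewrite mxE eqxx addrAC subrr add0r gtr0_norm.
Qed.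

End green.

Section cutoff.
Context (R : realType) (d : nat) (y : 'rV[R]_d) (r : R).
Hypothesis r0 : 0 < r.
Local Notation u k x := (x ord0 k - y ord0 k).
Implicit Types (x : 'rV[R]_d) (k : 'I_d).

(* A polynomial cutoff suffices: it is only used on the box, at the boundary of
   which it vanishes together with its first derivative. *)
Definition eta (v : R) : R := (1 - v ^+ 2 / r ^+ 2) ^+ 2.
Definition eta1 (v : R) : R := - (4 * v / r ^+ 2) * (1 - v ^+ 2 / r ^+ 2).
Definition eta2 (v : R) : R := - (4 / r ^+ 2) + 12 * v ^+ 2 / r ^+ 4.
Definition chi (x : 'rV[R]_d) : R := \prod_(k < d) eta (u k x).
(** The prime is not a derivative: this is the part of the cutoff that is constant in direction [k],
    so differentiating [chi] along [k] only affects one factor [eta]. *)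
Definition chi' (k : 'I_d) (x : 'rV[R]_d) : R := \prod_(j < d | j != k) eta (u j x).
Definition chix (k : 'I_d) (x : 'rV[R]_d) : R := eta1 (u k x) * chi' k x.
Definition chixx (k : 'I_d) (x : 'rV[R]_d) : R := eta2 (u k x) * chi' k x.

Lemma chiE k x : chi x = eta (u k x) * chi' k x.
Proof. by rewrite /chi (bigD1 k). Qed.

Lemma der_eta v : is_derive v (1 : R) eta (eta1 v).
Proof.
have Dv := is_derive_id v (1 : R).
have D := dirB (dir_cst (1 : R) v (1 : R)) (dirM (dirM Dv Dv) (dir_cst (r ^+ 2)^-1 v (1 : R))).
apply: (is_derive_eq (dirM D D)).
by rewrite /eta1 /=; field; rewrite gt_eqF.
Qed.

Lemma der_eta1 v : is_derive v (1 : R) eta1 (eta2 v).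
Proof.
have Dv := is_derive_id v (1 : R).
have D := dirB (dir_cst (1 : R) v (1 : R)) (dirM (dirM Dv Dv) (dir_cst (r ^+ 2)^-1 v (1 : R))).
apply: (is_derive_eq (dirM (dirN (dirM (dirZ 4 Dv) (dir_cst (r ^+ 2)^-1 v (1 : R)))) D)).
by rewrite /eta2 /=; field; rewrite gt_eqF.
Qed.

Lemma dir_chi' x k : is_derive x (delta_mx ord0 k) (chi' k) 0.
Proof.
apply: dir_invariant => h; apply: eq_bigr => j /negbTE jk.
by rewrite shift_coord jk mul0r add0r.
Qed.

Lemma dir_chi x k : is_derive x (delta_mx ord0 k) chi (chix k x).
Proof.
rewrite (_ : chi = fun x => eta (u k x) * chi' k x); last first.
  by apply/funext => z; exact: chiE.
apply: (is_derive_eq (dirM (dir_comp (dir_shifted_coord y x k) (der_eta _)) (dir_chi' x k))).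
by rewrite /chix; ring.
Qed.

Lemma dir_chix x k : is_derive x (delta_mx ord0 k) (chix k) (chixx k x).
Proof.
apply: (is_derive_eq (dirM (dir_comp (dir_shifted_coord y x k) (der_eta1 _)) (dir_chi' x k))).
by rewrite /chixx; ring.
Qed.

Lemma chi_boundary x k : `|u k x| = r -> chi x = 0 /\ chix k x = 0.
Proof.
move=> ur; have : (u k x) ^+ 2 = r ^+ 2 by rewrite -ur real_normK ?num_real.
rewrite (chiE k) /chix /eta /eta1 => ->.
by rewrite divff ?expf_neq0 ?gt_eqF// subrr expr2 !mulr0 !mul0r.
Qed.

Lemma box_ratio x k : box y r x -> 0 <= (u k x) ^+ 2 / r ^+ 2 <= 1.
Proof.
move=> /(_ k) h; rewrite divr_ge0 ?sqr_ge0//= ler_pdivrMr ?exprn_gt0// mul1r.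
by rewrite -[leLHS]real_normK ?num_real// ler_pXn2r// nnegrE// ltW.
Qed.

Lemma eta_le1 x k : box y r x -> 0 <= eta (u k x) <= 1.
Proof.
move=> /(box_ratio k); rewrite /eta.
set w := _ / _ => /andP[w0 w1]; rewrite sqr_ge0/= expr_le1 ?subr_ge0//.
by rewrite gerBl.
Qed.

Lemma chi'_le1 x k : box y r x -> 0 <= chi' k x <= 1.
Proof.
move=> Bx; apply/andP; split.
  by apply: prodr_ge0 => j _; have /andP[] := eta_le1 j Bx.
by apply: prodr_ile1 => j _; exact: eta_le1.
Qed.

Lemma chi_le1 x : box y r x -> 0 <= chi x <= 1.
Proof.
move=> Bx; apply/andP; split.
  by apply: prodr_ge0 => j _; have /andP[] := eta_le1 j Bx.
by apply: prodr_ile1 => j _; exact: eta_le1.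
Qed.

Lemma chix_le x k : box y r x -> `|chix k x| <= 4 * `|u k x| / r ^+ 2.
Proof.
move=> Bx; have := box_ratio k Bx; have /andP[c0 c1] := chi'_le1 k Bx.
rewrite /chix /eta1; set w := _ ^+ 2 / _ => /andP[w0 w1].
have r20 : 0 <= (r ^+ 2)^-1 by rewrite invr_ge0 exprn_ge0// ltW.
have w10 : 0 <= 1 - w by rewrite subr_ge0.
rewrite !normrM normrN !normrM (ger0_norm c0) (ger0_norm w10) (ger0_norm r20).
rewrite (@ger0_norm _ 4)// -mulrA ler_piMr//; first by rewrite !mulr_ge0.
by rewrite mulr_ile1// gerBl.
Qed.

Lemma chixx_le x k : box y r x -> `|chixx k x| <= 12 / r ^+ 2.
Proof.
move=> Bx; have := box_ratio k Bx; have /andP[c0 c1] := chi'_le1 k Bx.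
(* With the ratio [w] in [[0, 1]] the numerator [- 4 + 12 w] lies in [[- 4, 8]]; 12 is a convenient
   overestimate. *)
have E : eta2 (u k x) = (- 4 + 12 * ((u k x) ^+ 2 / r ^+ 2)) / r ^+ 2.
  by rewrite /eta2; field; rewrite gt_eqF.
rewrite /chixx E; set w := _ ^+ 2 / _ => /andP[w0 w1].
have r20 : 0 <= (r ^+ 2)^-1 by rewrite invr_ge0 exprn_ge0// ltW.
rewrite !normrM (ger0_norm c0) (ger0_norm r20).
rewrite -[leRHS]mulr1; apply: ler_pM => //; first by rewrite mulr_ge0.
rewrite ler_wpM2r// ler_norml.
by apply/andP; split; lra.
Qed.

Lemma cts_uR (T : topologicalType) (F : T -> 'rV[R]_d) k :
  continuous F -> continuous (fun w => u k (F w)).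
Proof.
move=> cF; apply: ctsD; last exact: ctsC.
move=> w; apply: (cvg_comp F (fun x : 'rV[R]_d => x ord0 k)); first exact: cF.
exact: coord_continuous.
Qed.

Lemma cts_eta : continuous eta.
Proof.
apply: ctsX; apply: ctsD; first exact: ctsC; apply: ctsN; apply: ctsM; last exact: ctsC.
by apply: ctsX => z; exact: cvg_id.
Qed.

Lemma cts_eta1 : continuous eta1.
Proof.
have ci : continuous (fun z : R => z) by move=> z; exact: cvg_id.
apply: ctsM.
  by apply: ctsN; apply: ctsM; last exact: ctsC; apply: ctsM => //; exact: ctsC.
apply: ctsD; first exact: ctsC; apply: ctsN; apply: ctsM; last exact: ctsC.
exact: ctsX.
Qed.

Lemma cts_eta2 : continuous eta2.
Proof.
have ci : continuous (fun z : R => z) by move=> z; exact: cvg_id.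
apply: ctsD; first exact: ctsC; apply: ctsM; last exact: ctsC.
by apply: ctsM; [exact: ctsC|exact: ctsX].
Qed.

Lemma cts_chi : continuous chi.
Proof.
apply: cts_prod => k; apply: (cts_comp _ cts_eta).
by apply: (cts_uR (F := id)) => x; exact: cvg_id.
Qed.

Lemma cts_chi' k : continuous (chi' k).
Proof.
apply: cts_prod => j; apply: (cts_comp _ cts_eta).
by apply: (cts_uR (F := id)) => x; exact: cvg_id.
Qed.

Lemma cts_chix k : continuous (chix k).
Proof.
apply: ctsM; last exact: cts_chi'.
apply: (cts_comp _ cts_eta1).
by apply: (cts_uR (F := id)) => x; exact: cvg_id.
Qed.

Lemma cts_chixx k : continuous (chixx k).
Proof.
apply: ctsM; last exact: cts_chi'.
apply: (cts_comp _ cts_eta2).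
by apply: (cts_uR (F := id)) => x; exact: cvg_id.
Qed.

End cutoff.

(** * Pairing a solution with the kernel *)

Section at_point.
Context (R : realType) (T : topologicalType) (p : T).
Implicit Types f g : T -> R.

Lemma atD f g : {for p, continuous f} -> {for p, continuous g} ->
  {for p, continuous (fun x => f x + g x)}.
Proof. by move=> cf cg; apply: cvgD; [exact: cf|exact: cg]. Qed.
Lemma atM f g : {for p, continuous f} -> {for p, continuous g} ->
  {for p, continuous (fun x => f x * g x)}.
Proof. by move=> cf cg; apply: cvgM; [exact: cf|exact: cg]. Qed.
Lemma at_sum (I : Type) (r : seq I) (F : I -> T -> R) :
  (forall i, {for p, continuous (F i)}) ->
  {for p, continuous (fun x => \sum_(i <- r) F i x)}.
Proof.
move=> cF; elim: r => [|i r IH].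
  rewrite (_ : (fun _ => _) = fun=> 0); last by apply/funext => x; rewrite big_nil.
  exact: cvg_cst.
rewrite (_ : (fun _ => _) = fun x => F i x + \sum_(j <- r) F j x).
  exact: atD.
by apply/funext => x; rewrite big_cons.
Qed.

End at_point.

Section wave.
Context (R : realType) (d : nat).
Implicit Types (V : R -> 'rV[R]_d -> R) (s : R) (x : 'rV[R]_d).
Local Notation mu := (@lebesgue_rV R d).
Local Notation "'ct' F s x" := {for (s, x), continuous (fun w : R * 'rV[R]_d => F w.1 w.2)}
  (at level 10, F at level 9, s at level 9, x at level 9).

(* V1 and V2 are the real and imaginary parts of a classical solution; its
   time derivatives are read off the equation. *)
Record wave (V1 V2 : R -> 'rV[R]_d -> R)
    (V1x V2x V1xx V2xx : 'I_d -> R -> 'rV[R]_d -> R) : Prop := Wave {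
  wave_t1 : forall s x, 0 < s ->
    is_derive s (1 : R) (V1^~ x) (- 2^-1 * \sum_(k < d) V2xx k s x);
  wave_t2 : forall s x, 0 < s ->
    is_derive s (1 : R) (V2^~ x) (2^-1 * \sum_(k < d) V1xx k s x);
  wave_x1 : forall k s x, 0 < s -> is_derive x (delta_mx ord0 k) (V1 s) (V1x k s x);
  wave_x2 : forall k s x, 0 < s -> is_derive x (delta_mx ord0 k) (V2 s) (V2x k s x);
  wave_xx1 : forall k s x, 0 < s -> is_derive x (delta_mx ord0 k) (V1x k s) (V1xx k s x);
  wave_xx2 : forall k s x, 0 < s -> is_derive x (delta_mx ord0 k) (V2x k s) (V2xx k s x);
  wave_c1 : forall s x, 0 < s -> ct V1 s x;
  wave_c2 : forall s x, 0 < s -> ct V2 s x;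
  wave_cxx1 : forall k s x, 0 < s -> ct (V1xx k) s x;
  wave_cxx2 : forall k s x, 0 < s -> ct (V2xx k) s x }.

Lemma at_slice V s : (forall x, ct V s x) -> continuous (V s).
Proof.
move=> cV x; apply: (cvg_comp (fun x : 'rV[R]_d => (s, x))
  (fun w : R * 'rV[R]_d => V w.1 w.2)); last exact: cV.
by apply: (@cvg_pair _ _ _ (nbhs x) (nbhs s) (nbhs x) _ _ _ (fun=> s) id);
  [exact: cvg_cst|exact: cvg_id].
Qed.

Lemma at_snd (F : 'rV[R]_d -> R) s x : continuous F -> ct (fun=> F) s x.
Proof.
move=> cF; apply: (cvg_comp (fun w : R * 'rV[R]_d => w.2) F); last exact: cF.
exact: cvg_snd.
Qed.

Lemma strip_bound V (y : 'rV[R]_d) (r a b : R) :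
  (forall s x, a <= s <= b -> ct V s x) ->
  exists2 M, 0 <= M & forall s x, a <= s <= b -> box y r x -> `|V s x| <= M.
Proof.
move=> cV; pose A : set (R * 'rV[R]_d) := `[a, b]%classic `*` box y r.
have : compact [set V w.1 w.2 | w in A].
  apply: continuous_compact; last first.
    by apply: compact_setX; [exact: segment_compact|exact: compact_box].
  apply: continuous_in_subspaceT => -[s x] /set_mem[/= + _].
  by rewrite in_itv/= => sab; exact: cV.
move=> /compact_bounded[M [Mr HM]]; exists (`|M| + 1) => [|s x sab Bx].
  by rewrite addr_ge0.
apply: (HM (`|M| + 1)); first by rewrite ltr_pwDr// ler_norm.
by exists (s, x) => //; split => //=; rewrite in_itv.
Qed.

Section evolution.
Variables (V1 V2 : R -> 'rV[R]_d -> R) (V1x V2x V1xx V2xx : 'I_d -> R -> 'rV[R]_d -> R).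
Hypothesis HV : wave V1 V2 V1x V2x V1xx V2xx.
Variables (e t0 th : R) (y : 'rV[R]_d) (r : R).
Hypotheses (e0 : 0 < e) (r0 : 0 < r).

Local Notation p := (kp e t0 th y).
Local Notation q := (kq e t0 th y).
Local Notation px := (kpx e t0 th y).
Local Notation qx := (kqx e t0 th y).
Local Notation pxx := (kpxx e t0 th y).
Local Notation qxx := (kqxx e t0 th y).
Local Notation ps := (kps e t0 th y).
Local Notation qs := (kqs e t0 th y).
Local Notation X := (chi y r).
Local Notation Xx := (chix y r).
Local Notation Xxx := (chixx y r).

(* The kernel solves the equation, so that only the terms carrying a derivative
   of the cutoff survive in the derivative of the pairing. *)
Definition resP s x : R := 2^-1 * \sum_(k < d) (Xxx k x * q s x + 2 * Xx k x * qx k s x).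
Definition resQ s x : R := - 2^-1 * \sum_(k < d) (Xxx k x * p s x + 2 * Xx k x * px k s x).
Definition pairing s x : R := V1 s x * (X x * p s x) + V2 s x * (X x * q s x).
Definition dpairing s x : R :=
  (- 2^-1 * \sum_(k < d) V2xx k s x) * (X x * p s x) + V1 s x * (X x * ps s x) +
  ((2^-1 * \sum_(k < d) V1xx k s x) * (X x * q s x) + V2 s x * (X x * qs s x)).
Definition residual s x : R := V1 s x * resP s x + V2 s x * resQ s x.
Definition flux k s x : R :=
  (V1xx k s x * (X x * q s x) -
     V1 s x * (Xxx k x * q s x + 2 * Xx k x * qx k s x + X x * qxx k s x)) -
  (V2xx k s x * (X x * p s x) -
     V2 s x * (Xxx k x * p s x + 2 * Xx k x * px k s x + X x * pxx k s x)).

(** Leibniz: the Laplacian of cutoff times kernel is cutoff times Laplacian of the kernel plus the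
    terms kept in [resP] and [resQ]. Adding and subtracting these turns the rest into the
    antisymmetric expressions of Green's formula. *)
Lemma dpairingE s x : dpairing s x = residual s x + 2^-1 * \sum_(k < d) flux k s x.
Proof.
rewrite /dpairing /residual /flux /resP /resQ /kps /kqs.
rewrite !(mulr_sumr, mulr_suml) -!big_split/=.
by apply: eq_bigr => k _; field.
Qed.

Lemma der_pairing s x : 0 < s -> is_derive s (1 : R) (pairing^~ x) (dpairing s x).
Proof.
move=> s0; apply: (is_derive_eq (dirD
  (dirM (wave_t1 HV x s0) (dirZ (X x) (der_kp t0 th y e0 s x)))
  (dirM (wave_t2 HV x s0) (dirZ (X x) (der_kq t0 th y e0 s x))))).
by [].
Qed.

Lemma ct_chi s x : ct (fun=> X) s x. Proof. by apply: at_snd; exact: cts_chi. Qed.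
Lemma ct_chix k s x : ct (fun=> Xx k) s x. Proof. by apply: at_snd; exact: cts_chix. Qed.
Lemma ct_chixx k s x : ct (fun=> Xxx k) s x. Proof. by apply: at_snd; exact: cts_chixx. Qed.

Lemma ct_pairing s x : 0 < s -> ct pairing s x.
Proof.
move=> s0; apply: atD; apply: atM.
- exact: (wave_c1 HV).
- by apply: atM; [exact: ct_chi|exact: cts_kp].
- exact: (wave_c2 HV).
- by apply: atM; [exact: ct_chi|exact: cts_kq].
Qed.

Lemma at_cst (T : topologicalType) (z : T) (a : R) : {for z, continuous (fun _ : T => a)}.
Proof. exact: cvg_cst. Qed.

Lemma ct_dpairing s x : 0 < s -> ct dpairing s x.
Proof.
move=> s0; apply: atD; apply: atD; apply: atM.
- by apply: atM; [exact: at_cst|apply: at_sum => k; exact: (wave_cxx2 HV)].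
- by apply: atM; [exact: ct_chi|exact: cts_kp].
- exact: (wave_c1 HV).
- by apply: atM; [exact: ct_chi|exact: cts_kps].
- by apply: atM; [exact: at_cst|apply: at_sum => k; exact: (wave_cxx1 HV)].
- by apply: atM; [exact: ct_chi|exact: cts_kq].
- exact: (wave_c2 HV).
- by apply: atM; [exact: ct_chi|exact: cts_kqs].
Qed.

Lemma ct_Pk k s x : ct (fun s x => 2 * Xx k x * px k s x) s x.
Proof.
by apply: atM; [apply: atM; [exact: at_cst|exact: ct_chix]|exact: cts_kpx].
Qed.

Lemma ct_Qk k s x : ct (fun s x => 2 * Xx k x * qx k s x) s x.
Proof.
by apply: atM; [apply: atM; [exact: at_cst|exact: ct_chix]|exact: cts_kqx].
Qed.

Lemma ct_residual s x : 0 < s -> ct residual s x.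
Proof.
move=> s0; apply: atD; apply: atM.
- exact: (wave_c1 HV).
- apply: atM; [exact: at_cst|apply: at_sum => k; apply: atD; last exact: ct_Qk].
  by apply: atM; [exact: ct_chixx|exact: cts_kq].
- exact: (wave_c2 HV).
- apply: atM; [exact: at_cst|apply: at_sum => k; apply: atD; last exact: ct_Pk].
  by apply: atM; [exact: ct_chixx|exact: cts_kp].
Qed.

Lemma at_slice0 V s : 0 < s -> (forall s x, 0 < s -> ct V s x) -> continuous (V s).
Proof. by move=> s0 cV; apply: at_slice => x; exact: cV. Qed.

Lemma dirX (F G H : 'rV[R]_d -> R) k x :
  is_derive x (delta_mx ord0 k) F (G x) -> is_derive x (delta_mx ord0 k) G (H x) ->
  is_derive x (delta_mx ord0 k) (fun z => X z * F z) (Xx k x * F x + X x * G x) /\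
  is_derive x (delta_mx ord0 k) (fun z => Xx k z * F z + X z * G z)
    (Xxx k x * F x + 2 * Xx k x * G x + X x * H x).
Proof.
move=> dF dG; have dX := dir_chi y r0 x k; have dXx := dir_chix y r0 x k; split.
  exact: dirM.
by apply: (is_derive_eq (dirD (dirM dXx dF) (dirM dX dG))); ring.
Qed.

Lemma slice_p s : continuous (p s).
Proof. by apply: at_slice => x; exact: cts_kp. Qed.
Lemma slice_q s : continuous (q s).
Proof. by apply: at_slice => x; exact: cts_kq. Qed.
Lemma slice_px k s : continuous (px k s).
Proof. by apply: at_slice => x; exact: cts_kpx. Qed.
Lemma slice_qx k s : continuous (qx k s).
Proof. by apply: at_slice => x; exact: cts_kqx. Qed.
Lemma slice_pxx k s : continuous (pxx k s).
Proof. by apply: at_slice => x; exact: cts_kpxx. Qed.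
Lemma slice_qxx k s : continuous (qxx k s).
Proof. by apply: at_slice => x; exact: cts_kqxx. Qed.

Lemma slice_Xxx k (F G H : 'rV[R]_d -> R) :
  continuous F -> continuous G -> continuous H ->
  continuous (fun x => Xxx k x * F x + 2 * Xx k x * G x + X x * H x).
Proof.
move=> cF cG cH; apply: ctsD; last by apply: ctsM => //; exact: cts_chi.
apply: ctsD; first by apply: ctsM => //; exact: cts_chixx.
by apply: ctsM => //; apply: ctsM; [exact: ctsC|exact: cts_chix].
Qed.

Lemma integral_flux k s : 0 < s ->
  (\int[mu]_(x in box y r) (flux k s x)%:E = 0)%E.
Proof.
move=> s0.
have continuous_V1 := at_slice0 s0 (wave_c1 HV).
have continuous_V2 := at_slice0 s0 (wave_c2 HV).
have cV1xx := at_slice0 s0 (wave_cxx1 HV (k := k)).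
have cV2xx := at_slice0 s0 (wave_cxx2 HV (k := k)).
have cX := @cts_chi R d y r.
have vanish F G x : `|x ord0 k - y ord0 k| = r ->
    X x * F x = 0 /\ Xx k x * F x + X x * G x = 0 :> R.
  by move=> /(chi_boundary r0)[-> ->]; rewrite !mul0r addr0.
have E1 := @green_box R d k y r (V1 s) (V1x k s) (V1xx k s)
  (fun x => X x * q s x) (fun x => Xx k x * q s x + X x * qx k s x)
  (fun x => Xxx k x * q s x + 2 * Xx k x * qx k s x + X x * qxx k s x) r0
  (fun x => wave_x1 HV k x s0) (fun x => wave_xx1 HV k x s0)
  (fun x => proj1 (dirX (dir_kq e t0 th y s x k) (dir_kqx e t0 th y s x k)))
  (fun x => proj2 (dirX (dir_kq e t0 th y s x k) (dir_kqx e t0 th y s x k)))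
  continuous_V1 cV1xx (ctsM cX (slice_q (s := s))) (slice_Xxx (slice_q (s := s)) (slice_qx (k := k) (s := s)) (slice_qxx (k := k) (s := s))) (vanish _ _).
have E2 := @green_box R d k y r (V2 s) (V2x k s) (V2xx k s)
  (fun x => X x * p s x) (fun x => Xx k x * p s x + X x * px k s x)
  (fun x => Xxx k x * p s x + 2 * Xx k x * px k s x + X x * pxx k s x) r0
  (fun x => wave_x2 HV k x s0) (fun x => wave_xx2 HV k x s0)
  (fun x => proj1 (dirX (dir_kp e t0 th y s x k) (dir_kpx e t0 th y s x k)))
  (fun x => proj2 (dirX (dir_kp e t0 th y s x k) (dir_kpx e t0 th y s x k)))
  continuous_V2 cV2xx (ctsM cX (slice_p (s := s))) (slice_Xxx (slice_p (s := s)) (slice_px (k := k) (s := s)) (slice_pxx (k := k) (s := s))) (vanish _ _).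
under eq_integral do rewrite /flux EFinB.
rewrite integralB_EFin//; last 3 first.
- exact: measurable_box.
- apply: continuous_box_integrable; first exact: ltW.
  by apply: ctsD; [exact: ctsM (ctsM cX (slice_q (s := s)))|apply: ctsN; exact: ctsM (slice_Xxx (slice_q (s := s)) (slice_qx (k := k) (s := s)) (slice_qxx (k := k) (s := s)))].
- apply: continuous_box_integrable; first exact: ltW.
  by apply: ctsD; [exact: ctsM (ctsM cX (slice_p (s := s)))|apply: ctsN; exact: ctsM (slice_Xxx (slice_p (s := s)) (slice_px (k := k) (s := s)) (slice_pxx (k := k) (s := s)))].
by rewrite E1 E2 sube0.
Qed.

Lemma cts_flux k s : 0 < s -> continuous (flux k s).
Proof.
move=> s0.
have continuous_V1 := at_slice0 s0 (wave_c1 HV).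
have continuous_V2 := at_slice0 s0 (wave_c2 HV).
have cV1xx := at_slice0 s0 (wave_cxx1 HV (k := k)).
have cV2xx := at_slice0 s0 (wave_cxx2 HV (k := k)).
have cX := @cts_chi R d y r.
apply: ctsD; last apply: ctsN; apply: ctsD.
- exact: ctsM (ctsM cX (slice_q (s := s))).
- apply: ctsN; exact: ctsM (slice_Xxx (slice_q (s := s)) (slice_qx (k := k) (s := s)) (slice_qxx (k := k) (s := s))).
- exact: ctsM (ctsM cX (slice_p (s := s))).
- apply: ctsN; exact: ctsM (slice_Xxx (slice_p (s := s)) (slice_px (k := k) (s := s)) (slice_pxx (k := k) (s := s))).
Qed.

Definition action s : R := (\int[mu]_(x in box y r) pairing s x)%R.

Lemma Rintegral_dpairing s : 0 < s ->
  (\int[mu]_(x in box y r) dpairing s x = \int[mu]_(x in box y r) residual s x)%R.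
Proof.
move=> s0; have mB := measurable_box y r.
under eq_Rintegral do rewrite dpairingE.
have cf k : continuous (flux k s) by exact: cts_flux.
rewrite RintegralD//.
- rewrite [X in _ + X](_ : _ = 0) ?addr0// /Rintegral.
  under eq_integral do rewrite EFinM -sumEFin.
  rewrite integralZl//.
    rewrite integral_sum//; last first.
      by move=> k; apply: continuous_box_integrable => //; exact: ltW.
    by rewrite big1 ?mule0// => k _; exact: integral_flux.
  under eq_fun do rewrite sumEFin.
  apply: (continuous_box_integrable (F := fun x => \sum_(k < d) flux k s x)).
    exact: ltW.
  exact: cts_sum.
- apply: continuous_box_integrable; first exact: ltW.
  exact: (at_slice0 s0 ct_residual).
- apply: continuous_box_integrable; first exact: ltW.
  by apply: ctsM; [exact: ctsC|exact: cts_sum].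
Qed.

(** Differentiation under the integral on the window from [s / 2] to [2 * s]: it stays away from
    time 0, so compactness bounds [dpairing] there by a constant, integrable on the box. The fluxes
    then integrate to zero. *)
Lemma der_action s : 0 < s ->
  is_derive s (1 : R) action (\int[mu]_(x in box y r) residual s x)%R.
Proof.
move=> s0; rewrite -Rintegral_dpairing//.
have [M M0 HM] : exists2 M, 0 <= M & forall s' x, s / 2 <= s' <= 2 * s ->
    box y r x -> `|dpairing s' x| <= M.
  apply: strip_bound => s' x /andP[h _]; apply: ct_dpairing.
  by rewrite (lt_le_trans _ h)// divr_gt0.
have mB := measurable_box y r.
pose a := s / 2; pose b := 2 * s.
have I0 s' : s' \in `]a, b[ -> 0 < s'.
  by rewrite in_itv/= => /andP[h _]; rewrite (lt_trans _ h)// divr_gt0.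
have Ds' s' x : 0 < s' -> partial1of2 pairing s' x = dpairing s' x.
  by move=> s0'; rewrite partial1of2E; have [_ ->] := der_pairing x s0'.
have sI : `]a, b[%classic s by rewrite /= in_itv/= /a /b; apply/andP; split; lra.
have iI s' : `]a, b[%classic s' -> mu.-integrable (box y r) (EFin \o pairing s').
  move=> /I0 s0'; apply: continuous_box_integrable; first exact: ltW.
  exact: (at_slice0 s0' ct_pairing).
have dI s' x : `]a, b[%classic s' -> box y r x -> derivable (pairing^~ x) s' 1.
  by move=> /I0 s0' _; have [] := der_pairing x s0'.
have iM : mu.-integrable (box y r) (EFin \o (fun=> M)).
  by apply: continuous_box_integrable; [exact: ltW|exact: ctsC].
have GM s' x : `]a, b[%classic s' -> box y r x -> `|partial1of2 pairing s' x| <= M.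
  move=> sI' Bx; rewrite Ds' ?I0//; apply: HM => //.
  by move: sI'; rewrite /= in_itv/= => /andP[/ltW -> /ltW ->].
split.
  exact: (derivable_under_integral mB sI iI dI (fun=> M0) iM GM).
rewrite -derive1E.
rewrite (differentiation_under_integral mB sI iI dI (fun=> M0) iM GM).
by apply: eq_Rintegral => x _; rewrite -Ds'.
Qed.

End evolution.
End wave.

(** * The dispersive estimate *)

Section estimates.
Context (R : realType) (d : nat).
Local Notation mu := (@lebesgue_rV R d).

(** The majorant is integrated over all of R^d, so that one weighted estimate serves boxes of every
    size. *)
Lemma Rintegral_box_le (F G : 'rV[R]_d -> R) (y : 'rV[R]_d) (r K : R) :
  0 < r -> continuous F -> measurable_fun [set: 'rV[R]_d] G ->
  (forall x, 0 <= G x) -> (forall x, box y r x -> `|F x| <= G x) ->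
  (\int[mu]_x (G x)%:E <= K%:E)%E ->
  `|\int[mu]_(x in box y r) F x| <= K.
Proof.
move=> r0 cF mG G0 FG GK; have mB := measurable_box y r.
have iF : mu.-integrable (box y r) (EFin \o F).
  by apply: continuous_box_integrable; [exact: ltW|].
have mF : measurable_fun [set: 'rV[R]_d] (fun x => `|F x|).
  apply: continuous_measurable_rV.
  exact: (cts_comp cF (@norm_continuous R R)).
apply: (le_trans (le_normr_Rintegral mB iF)).
rewrite -lee_fin /Rintegral fineK; last first.
  by apply: integrable_fin_num => //; exact: integrable_norm.
apply: le_trans GK.
apply: (@le_trans _ _ (\int[mu]_(x in box y r) (G x)%:E)%E).
  apply: ge0_le_integral => //.
  - exact/measurable_EFinP/measurable_funTS.
  - by apply/measurable_EFinP; exact: measurable_funTS.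
apply: ge0_subset_integral => //.
- exact/measurable_EFinP.
- by move=> x _; rewrite lee_fin.
Qed.

(** [F] is at least [a] on the small box, up to the error [G]. This separates a main term
    proportional to the volume [(2 h)^d] from an error integrated over R^d, which does not see
    [r]. *)
Lemma Rintegral_box_ge (F G : 'rV[R]_d -> R) (y : 'rV[R]_d) (r h a K : R) :
  0 < h -> h <= r -> 0 <= a -> continuous F -> measurable_fun [set: 'rV[R]_d] G ->
  (forall x, 0 <= G x) ->
  (forall x, box y r x -> a * \1_(box y h) x - G x <= F x) ->
  (\int[mu]_x (G x)%:E <= K%:E)%E ->
  a * (h *+ 2) ^+ d - K <= \int[mu]_(x in box y r) F x.
Proof.
move=> h0 hr a0 cF mG G0 FG GK; have mB := measurable_box y r.
have r0 : 0 < r by exact: lt_le_trans hr.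
have iF : mu.-integrable (box y r) (EFin \o F).
  by apply: continuous_box_integrable; [exact: ltW|].
have GB : (\int[mu]_(x in box y r) (G x)%:E <= K%:E)%E.
  apply: le_trans GK; apply: ge0_subset_integral => //.
  - exact/measurable_EFinP.
  - by move=> x _; rewrite lee_fin.
have iG : mu.-integrable (box y r) (EFin \o G).
  apply/integrableP; split; first by apply/measurable_EFinP; exact: measurable_funTS.
  rewrite (eq_integral (fun x => (G x)%:E)); last by move=> x _; rewrite /= ger0_norm.
  exact: le_lt_trans GB (ltry _).
have mI : measurable_fun [set: 'rV[R]_d] (\1_(box y h) : 'rV[R]_d -> R).
  by apply: measurable_indic; exact: measurable_box.
have iI : mu.-integrable (box y r) (EFin \o (fun x => a * \1_(box y h) x)).
  apply: (@le_integrable _ _ _ _ _ _ _ (EFin \o (fun=> a))) => //.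
  - by apply/measurable_EFinP; apply: measurable_funTS; exact: measurable_funM.
  - move=> x _; rewrite /= lee_fin !ger0_norm//.
      by rewrite indicE; case: (_ \in _); rewrite ?mulr1 ?mulr0.
    by rewrite mulr_ge0.
  - by apply: continuous_box_integrable; [exact: ltW|exact: ctsC].
apply: (@le_trans _ _ (\int[mu]_(x in box y r) (a * \1_(box y h) x - G x))%R); last first.
  apply: le_Rintegral => //.
  rewrite (_ : _ \o _ = fun x => ((a * \1_(box y h) x)%:E - (G x)%:E)%E)//.
  exact: integrableB.
rewrite RintegralB// lerB//.
  rewrite RintegralZl//; last first.
    apply: (@le_integrable _ _ _ _ _ _ _ (EFin \o (fun=> 1))) => //.
    - by apply/measurable_EFinP; apply: measurable_funTS.
    - by move=> x _; rewrite /= lee_fin !ger0_norm.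
    - by apply: continuous_box_integrable; [exact: ltW|exact: ctsC].
  rewrite ler_wpM2l// /Rintegral integral_indic//; last exact: measurable_box.
  rewrite (_ : box y h `&` box y r = box y h); last first.
    by apply/setIidPl => x /= Bx i; exact: le_trans (Bx i) hr.
  by rewrite [X in fine X](lebesgue_box y (ltW h0)).
rewrite -lee_fin /Rintegral fineK//.
by apply: integrable_fin_num.
Qed.

(* Follows from exp v >= (v / (d + 1))^(d + 1) with v = delta^2 / (4 h^2). *)
Lemma gauss_tail (delta : R) : 0 < delta ->
  exists2 Q : R, 0 <= Q & forall h w : R, 0 < h -> h <= 2^-1 -> delta ^+ 2 <= w ->
    (h^-1) ^+ d * expR (- (w / (2 * h ^+ 2))) <= h * Q * expR (- w).
Proof.
move=> d0; have D2 : 0 < delta ^+ 2 by rewrite exprn_gt0.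
have Q0 : 0 < 4 * d.+1%:R / delta ^+ 2 by rewrite divr_gt0 ?mulr_gt0 ?ltr0n.
exists ((4 * d.+1%:R / delta ^+ 2) ^+ d.+1); first exact: exprn_ge0 (ltW Q0).
move=> h w h0 h2 dw.
have hh : 0 < h ^+ 2 by rewrite exprn_gt0.
have h14 : h ^+ 2 <= 4^-1.
  rewrite (_ : 4^-1 = 2^-1 ^+ 2); last by field.
  by rewrite ler_pXn2r ?nnegrE// ltW.
pose v := delta ^+ 2 / (4 * h ^+ 2).
have v0 : 0 < v by rewrite divr_gt0 ?mulr_gt0// exprn_gt0.
(* The exponent is split in two equal halves: one exceeds [w] because [h^2 <= 1/4], the other
   exceeds [v] because [w >= delta^2]. *)
have E1 : expR (- (w / (2 * h ^+ 2))) <= expR (- v) * expR (- w).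
  rewrite -expRD ler_expR.
  have : w + v <= w / (2 * h ^+ 2); last by lra.
  have -> : w / (2 * h ^+ 2) = w / (4 * h ^+ 2) + w / (4 * h ^+ 2) by field; rewrite gt_eqF.
  have w0 : 0 <= w by exact: le_trans (ltW D2) dw.
  apply: lerD; last by rewrite ler_pM2r// invr_gt0 mulr_gt0.
  rewrite ler_pdivlMr ?mulr_gt0//.
  rewrite -[leRHS]mulr1 ler_wpM2l//; lra.
have E2 : expR (- v) <= (h ^+ 2 * (4 * d.+1%:R / delta ^+ 2)) ^+ d.+1.
  have HQ : 0 < h ^+ 2 * (4 * d.+1%:R / delta ^+ 2) by rewrite mulr_gt0.
  rewrite expRN -[leRHS]invrK lef_pV2 ?posrE ?expR_gt0 ?invr_gt0 ?(exprn_gt0 _ HQ)//.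
  rewrite -exprVn (_ : (h ^+ 2 * _)^-1 = v / d.+1%:R); last first.
    by rewrite /v; field; rewrite !gt_eqF ?exprn_gt0 ?ltr0n.
  have -> : expR v = expR (v / d.+1%:R) ^+ d.+1.
    by rewrite -expRM_natr mulfVK// pnatr_eq0.
  have vd : 0 <= v / d.+1%:R by rewrite divr_ge0// ltW.
  rewrite ler_pXn2r ?nnegrE ?expR_ge0//.
  by rewrite (le_trans _ (expR_ge1Dx _))// lerDr.
(* The product is [h^(d+2)]. The power [d + 1] in the bound on the exponential leaves a positive
   power of [h] to spare, which lets the tail vanish with [h]. *)
have Eh : h^-1 ^+ d * (h ^+ 2) ^+ d.+1 <= h.
  rewrite exprSr mulrA -exprMn expr2 mulKf ?gt_eqF// mulrA.
  have h1 : h <= 1 by lra.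
  rewrite ler_piMl ?(ltW h0)// mulr_ile1 ?exprn_ge0 ?(ltW h0)//.
  by rewrite exprn_ile1 ?(ltW h0).
apply: (@le_trans _ _ (h^-1 ^+ d * ((h ^+ 2 * (4 * d.+1%:R / delta ^+ 2)) ^+ d.+1 * expR (- w)))).
  rewrite ler_wpM2l ?exprn_ge0 ?invr_ge0 ?(ltW h0)// (le_trans E1)//.
  by rewrite ler_wpM2r ?expR_ge0.
by rewrite exprMn !mulrA ler_wpM2r ?expR_ge0// ler_wpM2r// exprn_ge0// ltW.
Qed.

Section kernel_bounds.
Variables (e t0 th : R) (y : 'rV[R]_d).
Hypothesis e0 : 0 < e.

(** [|z|^(-d/2)], the modulus of the kernel at its centre. *)
Definition kamp (s : R) : R := expR (- (d%:R / 4) * ln (kN e t0 s)).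

Lemma expR_kA s x : expR (kA e t0 y s x) = kamp s * expR (- (kal e t0 s * rho y x / 2)).
Proof. by rewrite -expRD. Qed.

(** Since [kN = |z|^2], the amplitude is [kN^(-d/4)]; writing [kN] as a fourth power avoids
    fractional exponents. *)
Lemma expR_ln_pow4 (b : R) : 0 < b ->
  expR (- (d%:R / 4) * ln (b ^+ 4)) = b^-1 ^+ d.
Proof.
move=> b0; have -> : b^-1 = expR (- ln b) by rewrite expRN lnK// posrE.
by rewrite lnXn// -expRM_natl -mulr_natr; congr expR; field.
Qed.

Lemma kampE s (b : R) : 0 < b -> kN e t0 s = b ^+ 4 -> kamp s = b^-1 ^+ d.
Proof. by move=> b0 E; rewrite /kamp E expR_ln_pow4. Qed.

Lemma kamp_le s (b : R) : 0 < b -> b ^+ 4 <= kN e t0 s -> kamp s <= b^-1 ^+ d.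
Proof.
move=> b0 E; rewrite -expR_ln_pow4// ler_expR !mulNr lerN2 ler_wpM2l//.
by rewrite ler_ln// posrE ?exprn_gt0// kN_gt0.
Qed.

Lemma kal_ge0 s : 0 <= kal e t0 s.
Proof. by rewrite divr_ge0 ?ltW// kN_gt0. Qed.

(** Like [kbe_le], an instance of [|1/z| <= 1/e], as [e] is the real part of [z]. *)
Lemma kal_le s : kal e t0 s <= e^-1.
Proof.
rewrite ler_pdivrMr ?kN_gt0// mulrC ler_pdivlMr// -expr2 /kN lerDl.
exact: sqr_ge0.
Qed.

Lemma kbe_le s : `|kbe e t0 s| <= e^-1.
Proof.
have N0 := kN_gt0 t0 e0 s.
rewrite normrM [`|_^-1|]ger0_norm ?invr_ge0 ?(ltW N0)// ler_pdivrMr// mulrC ler_pdivlMr//.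
rewrite /kN -[X in _ <= _ + X]real_normK ?num_real//.
by set w := `|_|; have : 0 <= w; [exact: normr_ge0|nra].
Qed.

Lemma normr_kp s x : `|kp e t0 th y s x| <= expR (kA e t0 y s x).
Proof.
rewrite normrM ger0_norm ?expR_ge0// ler_piMr ?expR_ge0//.
by rewrite ler_norml cos_geN1 cos_le1.
Qed.

Lemma normr_kq s x : `|kq e t0 th y s x| <= expR (kA e t0 y s x).
Proof.
rewrite normrM ger0_norm ?expR_ge0// ler_piMr ?expR_ge0//.
by rewrite ler_norml sin_geN1 sin_le1.
Qed.

Lemma comb_bound (a b u p q E : R) : 0 <= E -> `|a| <= e^-1 -> `|b| <= e^-1 ->
  `|p| <= E -> `|q| <= E -> `|- (a * u) * p + b * u * q| <= 2 / e * `|u| * E.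
Proof.
move=> E0 ha hb hp hq; apply: (le_trans (ler_normD _ _)).
rewrite !normrM normrN !normrM.
have -> : 2 / e * `|u| * E = e^-1 * `|u| * E + e^-1 * `|u| * E by ring.
have ei : 0 <= e^-1 by rewrite invr_ge0 ltW.
by apply: lerD; apply: ler_pM => //; rewrite ?mulr_ge0// ler_wpM2r.
Qed.

Lemma normr_kpx k s x :
  `|kpx e t0 th y k s x| <= 2 / e * `|x ord0 k - y ord0 k| * expR (kA e t0 y s x).
Proof.
rewrite (_ : kpx _ _ _ _ _ _ _ = - (kal e t0 s * (x ord0 k - y ord0 k)) *
  kp e t0 th y s x + - kbe e t0 s * (x ord0 k - y ord0 k) * kq e t0 th y s x);
  last by rewrite /kpx; ring.
apply: comb_bound; rewrite ?normrN ?expR_ge0//.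
- by rewrite ger0_norm ?kal_ge0// kal_le.
- exact: kbe_le.
- exact: normr_kp.
- exact: normr_kq.
Qed.

Lemma normr_kqx k s x :
  `|kqx e t0 th y k s x| <= 2 / e * `|x ord0 k - y ord0 k| * expR (kA e t0 y s x).
Proof.
apply: comb_bound; rewrite ?expR_ge0//.
- by rewrite ger0_norm ?kal_ge0// kal_le.
- exact: kbe_le.
- exact: normr_kq.
- exact: normr_kp.
Qed.

(** [F] and [Fx] stand for either part of the kernel and its gradient. By [chixx_le] and [chix_le] a
    summand is at most [(12 + (16 / e) u_k^2) / r^2] times the exponential, [u_k] being the [k]-th
    coordinate of [x - y]; summing over [k] and halving gives the constants. *)
Lemma res_sum_bound (r : R) (F : R) (Fx : 'I_d -> R) s x : 0 < r -> box y r x ->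
  `|F| <= expR (kA e t0 y s x) ->
  (forall k, `|Fx k| <= 2 / e * `|x ord0 k - y ord0 k| * expR (kA e t0 y s x)) ->
  `|2^-1 * \sum_(k < d) (chixx y r k x * F + 2 * chix y r k x * Fx k)| <=
    (6 * d%:R + 8 / e * rho y x) / r ^+ 2 * expR (kA e t0 y s x).
Proof.
move=> r0 Bx hF hFx; rewrite normrM ger0_norm// ler_pdivrMl//.
apply: (le_trans (ler_norm_sum _ _ _)).
set E := expR _ in hF hFx *; have E0 : 0 <= E by exact: expR_ge0.
have r20 : 0 <= (r ^+ 2)^-1 by rewrite invr_ge0 exprn_ge0// ltW.
have -> : 2 * ((6 * d%:R + 8 / e * rho y x) / r ^+ 2 * E) =
    \sum_(k < d) (12 / r ^+ 2 * E + 2 * (4 * `|x ord0 k - y ord0 k| / r ^+ 2) *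
      (2 / e * `|x ord0 k - y ord0 k| * E)).
  under eq_bigr => k _.
    rewrite (_ : _ + _ = (12 + 16 / e * (x ord0 k - y ord0 k) ^+ 2) * ((r ^+ 2)^-1 * E)).
      over.
    by rewrite -[_ ^+ 2 in RHS]real_normK ?num_real//; ring.
  rewrite -mulr_suml big_split/= sumr_const card_ord -mulr_sumr -/(rho y x).
  by rewrite -mulr_natr; ring.
apply: ler_sum => k _; apply: (le_trans (ler_normD _ _)); apply: lerD.
  by rewrite normrM; apply: ler_pM => //; exact: chixx_le.
rewrite normrM; apply: ler_pM => //.
by rewrite normrM (@ger0_norm _ 2)// ler_wpM2l//; exact: chix_le.
Qed.

(** Two copies of the weight are extracted: one makes the solution integrable, the other bounds the
    factor [rho] of [res_sum_bound]. *)
Lemma expR_kA_le (c b s : R) x : 0 < b -> b ^+ 4 <= kN e t0 s -> 2 * c <= kal e t0 s / 2 ->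
  expR (kA e t0 y s x) <= b^-1 ^+ d * (wt c y x * wt c y x).
Proof.
move=> b0 bN cal; rewrite expR_kA; apply: ler_pM; rewrite ?expR_ge0//.
  exact: kamp_le.
rewrite /wt -expRD ler_expR; have := rho_ge0 y x.
set w := rho y x => w0; have : 2 * c * w <= kal e t0 s / 2 * w by rewrite ler_wpM2r.
lra.
Qed.

End kernel_bounds.

End estimates.

(** * Upper bound for the pairing at the final time *)

Section dispersive.
Context (R : realType) (d : nat).
Local Notation mu := (@lebesgue_rV R d).
Variables (V1 V2 : R -> 'rV[R]_d -> R) (V1x V2x V1xx V2xx : 'I_d -> R -> 'rV[R]_d -> R).
Hypothesis HV : wave V1 V2 V1x V2x V1xx V2xx.
Variables (f1 f2 : 'rV[R]_d -> R) (K0 t th : R) (y : 'rV[R]_d).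
Hypotheses (mf1 : measurable_fun [set: 'rV[R]_d] f1)
  (mf2 : measurable_fun [set: 'rV[R]_d] f2).
Hypothesis fK0 : (\int[mu]_x (`|f1 x| + `|f2 x|)%:E <= K0%:E)%E.
Hypothesis t_gt0 : 0 < t.

Definition norm_sum s x : R := `|V1 s x| + `|V2 s x|.
Definition dev0 s x : R := `|V1 s x - f1 x| + `|V2 s x - f2 x|.
Definition dev s' s x : R := `|V1 s x - V1 s' x| + `|V2 s x - V2 s' x|.

(** The exponent [p] is gone: these two hypotheses are what [wint_le_Lnorm] extracts from
    convergence in L_p for any [p >= 1]. *)
Hypothesis cvg_dev0 : forall c eta : R, 0 < c -> 0 < eta ->
  exists2 delta : R, 0 < delta &
    forall s : R, 0 < s < delta -> (wint c y (dev0 s) <= eta%:E)%E.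
Hypothesis cvg_dev : forall c eta s' : R, 0 < c -> 0 < eta -> 0 < s' ->
  exists2 delta : R, 0 < delta &
    forall s : R, 0 < s -> `|s - s'| < delta -> (wint c y (dev s' s) <= eta%:E)%E.

Lemma measurable_norm2 (g1 g2 : 'rV[R]_d -> R) :
  measurable_fun [set: 'rV[R]_d] g1 -> measurable_fun [set: 'rV[R]_d] g2 ->
  measurable_fun [set: 'rV[R]_d] (fun x => `|g1 x| + `|g2 x|).
Proof.
by move=> m1 m2; apply: measurable_funD;
  apply: (measurableT_comp (f := fun z : R => `|z|)).
Qed.

Lemma continuous_V1 s : 0 < s -> continuous (V1 s).
Proof. by move=> s0; apply: at_slice => x; exact: (wave_c1 HV). Qed.

Lemma continuous_V2 s : 0 < s -> continuous (V2 s).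
Proof. by move=> s0; apply: at_slice => x; exact: (wave_c2 HV). Qed.

Lemma measurable_V1 s : 0 < s -> measurable_fun [set: 'rV[R]_d] (V1 s).
Proof. by move=> s0; apply: continuous_measurable_rV; exact: continuous_V1. Qed.

Lemma measurable_V2 s : 0 < s -> measurable_fun [set: 'rV[R]_d] (V2 s).
Proof. by move=> s0; apply: continuous_measurable_rV; exact: continuous_V2. Qed.

Lemma measurable_norm_sum s : 0 < s -> measurable_fun [set: 'rV[R]_d] (norm_sum s).
Proof. by move=> s0; apply: measurable_norm2; [exact: measurable_V1|exact: measurable_V2]. Qed.

Lemma measurable_dev0 s : 0 < s -> measurable_fun [set: 'rV[R]_d] (dev0 s).
Proof.
by move=> s0; apply: measurable_norm2; apply: measurable_funB => //;
  [exact: measurable_V1|exact: measurable_V2].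
Qed.

Lemma measurable_dev s' s : 0 < s' -> 0 < s ->
  measurable_fun [set: 'rV[R]_d] (dev s' s).
Proof.
by move=> s0' s0; apply: measurable_norm2; apply: measurable_funB;
  [exact: measurable_V1|exact: measurable_V1|exact: measurable_V2|exact: measurable_V2].
Qed.

Lemma norm_sum_ge0 s x : 0 <= norm_sum s x. Proof. exact: addr_ge0. Qed.
Lemma dev0_ge0 s x : 0 <= dev0 s x. Proof. exact: addr_ge0. Qed.
Lemma dev_ge0 s' s x : 0 <= dev s' s x. Proof. exact: addr_ge0. Qed.

Lemma norm_sum_le_dev0 s x : norm_sum s x <= dev0 s x + (`|f1 x| + `|f2 x|).
Proof.
rewrite /norm_sum /dev0 addrACA; apply: lerD.
  by rewrite -{1}(subrK (f1 x) (V1 s x)) ler_normD.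
by rewrite -{1}(subrK (f2 x) (V2 s x)) ler_normD.
Qed.

Lemma norm_sum_le_dev s' s1 s2 x : norm_sum s2 x <= norm_sum s1 x + (dev s' s1 x + dev s' s2 x).
Proof.
have H (a b c : R) : `|b| <= `|a| + (`|a - c| + `|b - c|).
  rewrite [X in `|X| <= _](_ : b = a + ((c - a) + (b - c))); last by ring.
  apply: (le_trans (ler_normD _ _)); rewrite lerD2l.
  by apply: (le_trans (ler_normD _ _)); rewrite (distrC c).
have := H (V1 s1 x) (V1 s2 x) (V1 s' x); have := H (V2 s1 x) (V2 s2 x) (V2 s' x).
by rewrite /norm_sum /dev; lra.
Qed.

Lemma wint_norm_sum_init (c s : R) : 0 < c -> 0 < s -> (wint c y (dev0 s) < +oo)%E ->
  (wint c y (norm_sum s) < +oo)%E.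
Proof.
move=> c0 s0 fin.
have mf := measurable_norm2 mf1 mf2.
apply: (@le_lt_trans _ _ (wint c y (fun x => dev0 s x + (`|f1 x| + `|f2 x|)))).
  apply: le_wint => //; first exact: measurable_norm_sum.
    by apply: measurable_funD => //; exact: measurable_dev0.
  by move=> x; rewrite norm_sum_ge0 norm_sum_le_dev0.
rewrite wintD; last 4 first.
- exact: measurable_dev0.
- by [].
- exact: dev0_ge0.
- by move=> x; exact: addr_ge0.
rewrite lte_add_pinfty//; apply: le_lt_trans (ltry K0); apply: le_trans fK0.
apply: ge0_le_integral => //.
- by move=> x _; rewrite lee_fin mulr_ge0 ?wt_ge0// addr_ge0.
- exact: measurable_mulwt.
- exact/measurable_EFinP.
- by move=> x _; rewrite lee_fin ler_piMr ?wt_le1// addr_ge0.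
Qed.

(** Near any [s'] the weighted norm varies by at most 1, two times being compared through [s'] at a
    cost of [2^-1] each. [locally_controlled_bounded] spreads finiteness from [s0] to the whole
    interval. *)
Lemma wint_norm_sum_bounded (c s0 : R) : 0 < c -> 0 < s0 -> s0 <= t ->
  (wint c y (norm_sum s0) < +oo)%E ->
  exists2 K : R, 0 <= K & forall s, s0 <= s <= t -> (wint c y (norm_sum s) <= K%:E)%E.
Proof.
move=> c0 s00 s0t fin.
have [s' /andP[s's0 s't]|K HK] := @locally_controlled_bounded R
  (fun s => wint c y (norm_sum s)) s0 t s0t fin.
  have s'0 : 0 < s' by exact: lt_le_trans s's0.
  have [|delta d0 Hd] := @cvg_dev c 2^-1 s' c0 _ s'0; first by rewrite invr_gt0.
  exists delta => // s1 s2 /andP[h1 _] /andP[h2 _] d1 d2.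
  have p1 : 0 < s1 by exact: lt_le_trans h1.
  have p2 : 0 < s2 by exact: lt_le_trans h2.
  have m1 := measurable_dev s'0 p1; have m2 := measurable_dev s'0 p2.
  apply: (@le_trans _ _ (wint c y (fun x => norm_sum s1 x + (dev s' s1 x + dev s' s2 x)))).
    apply: le_wint; first exact: measurable_norm_sum.
      by apply: measurable_funD; [exact: measurable_norm_sum|exact: measurable_funD].
    by move=> x; rewrite norm_sum_ge0 norm_sum_le_dev.
  rewrite wintD; last 4 first.
  - exact: measurable_norm_sum.
  - exact: measurable_funD.
  - exact: norm_sum_ge0.
  - by move=> x; rewrite addr_ge0 ?dev_ge0.
  rewrite leeD2l// wintD; last 4 first.
  - by [].
  - by [].
  - exact: dev_ge0.
  - exact: dev_ge0.
  have -> : 1%E = (2^-1%:E + 2^-1%:E)%E :> \bar R by rewrite -EFinD; congr EFin; field.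
  by apply: leeD; exact: Hd.
exists `|K| => // s sst; apply: le_trans (HK s sst) _.
by rewrite lee_fin ler_norm.
Qed.

(** The rate [t^(-d/2)] up to the factor [2^(d/2)], lost by starting at a time [s0 <= t / 2], where
    [|z| >= t / 2]. *)
Definition dispersion_rate : R := (Num.sqrt (t / 2))^-1 ^+ d.

Lemma L1_bound_ge0 : 0 <= K0.
Proof.
rewrite -lee_fin; apply: le_trans fK0; apply: integral_ge0 => x _.
by rewrite lee_fin addr_ge0.
Qed.

(** The bound itself is independent of [e]; only the threshold [r1] depends on it, which is what
    later allows the kernel to concentrate. *)
Lemma action_le (e zeta : R) : 0 < e -> 0 < zeta ->
  exists r1 : R, forall r : R, 0 < r -> r1 <= r -> action V1 V2 e t th y r t <= dispersion_rate * K0 + zeta.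
Proof.
move=> e0 z0.
have e2 : 0 < e ^+ 2 by rewrite exprn_gt0.
have et : 0 < e ^+ 2 + t ^+ 2 by rewrite ltr_pwDl// sqr_ge0.
(* For [0 <= s <= t] one has [kal >= e / (e^2 + t^2) = 4 c], the condition under which [expR_kA_le]
   yields two weights. *)
pose c := e / (4 * (e ^+ 2 + t ^+ 2)).
have c0 : 0 < c by rewrite divr_gt0 ?mulr_gt0.
pose b : R := Num.sqrt e; have b0 : 0 < b by rewrite sqrtr_gt0.
have b4 : b ^+ 4 = e ^+ 2 by rewrite (exprM _ 2 2) sqr_sqrtr// ltW.
pose B : R := b^-1 ^+ d; have B0 : 0 < B by rewrite exprn_gt0// invr_gt0.
have Ebd (s : R) x : 0 <= s <= t -> expR (kA e t y s x) <= B * (wt c y x * wt c y x).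
  move=> /andP[s0 st]; rewrite /B; apply: expR_kA_le => //; first by rewrite b4 lerDl sqr_ge0.
  have h1 : (s - t) ^+ 2 <= t ^+ 2.
    by rewrite -[leLHS]real_normK ?num_real// ler_pXn2r ?nnegrE// ?(ltW t_gt0)// ler_norml; lra.
  rewrite (_ : 2 * c = e / (e ^+ 2 + t ^+ 2) / 2); last first.
    by rewrite /c; field; rewrite gt_eqF.
  rewrite ler_pM2r// ler_pM2l// lef_pV2 ?posrE ?kN_gt0//.
  by rewrite lerD2l.
(* The deviation from the initial value is paired with a kernel of size [B = e^(-d/2)], so that it
   costs at most [zeta / 2]. *)
pose eta := zeta / (2 * B).
have eta0 : 0 < eta by rewrite divr_gt0 ?mulr_gt0.
have [delta delta0 Hdelta] := cvg_dev0 c0 eta0.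
pose s0 := Num.min (delta / 2) (t / 2).
have s00 : 0 < s0 by rewrite lt_min !divr_gt0.
have s0d : s0 < delta.
  by rewrite gt_min; apply/orP; left; rewrite ltr_pdivrMr// ltr_pMr// ltr1n.
have s0t : s0 <= t / 2 by rewrite ge_min lexx orbT.
have s0t' : s0 < t by apply: (le_lt_trans s0t); rewrite ltr_pdivrMr// ltr_pMr// ltr1n.
have Hs0 : (wint c y (dev0 s0) <= eta%:E)%E by apply: Hdelta; rewrite s00.
have fin0 := wint_norm_sum_init c0 s00 (le_lt_trans Hs0 (ltry eta)).
have [K Kge0 HK] := wint_norm_sum_bounded c0 s00 (ltW s0t') fin0.
(* The bracket of [res_sum_bound] after multiplication by one weight: [rho * wt <= 1 / c] because
   [exp(c rho) >= 1 + c rho]. *)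
pose C : R := B * (6 * d%:R + 8 / e / c).
have C0 : 0 <= C.
  by rewrite mulr_ge0 ?(ltW B0)// addr_ge0 ?mulr_ge0// ?invr_ge0 ?(ltW c0) ?(ltW e0).
have CE : C = B * (6 * d%:R + 8 / e / c) by [].
clearbody C B.
(* Beyond this radius [r >= 1], hence [r^2 >= r >= 2 C K t / zeta], and the drift [C K t / r^2] is
   at most [zeta / 2]. *)
exists (1 + 2 * (C * K * t) / zeta) => r r0 rr.
have w0 : 0 <= 2 * (C * K * t) / zeta.
  have CK : 0 <= C * K * t := mulr_ge0 (mulr_ge0 C0 Kge0) (ltW t_gt0).
  by apply: divr_ge0 (ltW z0); apply: mulr_ge0 CK.
have r20 : 0 <= (r ^+ 2)^-1 by rewrite invr_ge0 exprn_ge0// ltW.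
have Hres (s : R) x : s0 <= s <= t -> box y r x ->
    `|residual V1 V2 e t th y r s x| <= C / r ^+ 2 * (norm_sum s x * wt c y x).
  move=> /andP[ss st] Bx.
  have s_in : 0 <= s <= t by rewrite (le_trans (ltW s00) ss).
  have W (F : R) (Fx : 'I_d -> R) : `|F| <= expR (kA e t y s x) ->
      (forall k, `|Fx k| <= 2 / e * `|x ord0 k - y ord0 k| * expR (kA e t y s x)) ->
      `|2^-1 * \sum_(k < d) (chixx y r k x * F + 2 * chix y r k x * Fx k)| <=
      C / r ^+ 2 * wt c y x.
    move=> hF hFx; apply: (le_trans (res_sum_bound r0 Bx hF hFx)).
    have q0 : 0 <= 6 * d%:R + 8 / e * rho y x.
      by rewrite addr_ge0 ?mulr_ge0 ?invr_ge0 ?(ltW e0) ?rho_ge0.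
    apply: (@le_trans _ _ ((6 * d%:R + 8 / e * rho y x) / r ^+ 2 *
        (B * (wt c y x * wt c y x)))).
      by rewrite ler_wpM2l ?Ebd// mulr_ge0.
    have -> : (6 * d%:R + 8 / e * rho y x) / r ^+ 2 * (B * (wt c y x * wt c y x)) =
      B / r ^+ 2 * wt c y x * ((6 * d%:R + 8 / e * rho y x) * wt c y x) by ring.
    have -> : C / r ^+ 2 * wt c y x = B / r ^+ 2 * wt c y x * (6 * d%:R + 8 / e / c).
      by rewrite CE; ring.
    apply: ler_wpM2l; first by rewrite !mulr_ge0 ?wt_ge0 ?(ltW B0).
    rewrite mulrDl lerD//; first by rewrite ler_piMr ?wt_le1 ?mulr_ge0.
    rewrite -mulrA ler_wpM2l ?mulr_ge0 ?invr_ge0 ?(ltW e0)//.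
    rewrite /wt expRN ler_pdivrMr ?expR_gt0// mulrC ler_pdivlMr// mulrC.
    by rewrite (le_trans _ (expR_ge1Dx _))// lerDr.
  rewrite /residual; apply: (le_trans (ler_normD _ _)).
  rewrite (normrM (V1 s x)) (normrM (V2 s x)) /norm_sum mulrDl mulrDr; apply: lerD.
    rewrite [leRHS]mulrCA ler_wpM2l//; apply: W; first exact: normr_kq.
    by move=> k; exact: normr_kqx.
  rewrite [leRHS]mulrCA ler_wpM2l// /resQ mulNr normrN; apply: W; first exact: normr_kp.
  by move=> k; exact: normr_kpx.
have Hder (s : R) : s0 <= s <= t ->
    `|\int[mu]_(x in box y r) residual V1 V2 e t th y r s x| <= C / r ^+ 2 * K.
  move=> sst; have sp : 0 < s by case/andP: sst => h _; exact: lt_le_trans h.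
  apply: (Rintegral_box_le (G := fun x => C / r ^+ 2 * (norm_sum s x * wt c y x))) => //.
  - by apply: at_slice => x; apply: (ct_residual HV).
  - apply: measurable_funM => //; apply: measurable_funM; last exact: measurable_wt.
    exact: measurable_norm_sum.
  - by move=> x; rewrite !mulr_ge0 ?norm_sum_ge0 ?wt_ge0.
  - by move=> x Bx; exact: Hres.
  under eq_integral do rewrite EFinM.
  rewrite ge0_integralZl//.
  - by rewrite [X in (_ <= X)%E]EFinM lee_wpmul2l ?lee_fin ?mulr_ge0//; exact: HK.
  - by apply: measurable_mulwt; exact: measurable_norm_sum.
  - by move=> x _; rewrite lee_fin mulr_ge0 ?norm_sum_ge0 ?wt_ge0.
  - by rewrite lee_fin mulr_ge0.
have Hact0 : action V1 V2 e t th y r s0 <= dispersion_rate * K0 + zeta / 2.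
  apply: (le_trans (ler_norm _)).
  have mf := measurable_norm2 mf1 mf2.
  have sq0 : 0 < Num.sqrt (t / 2) by rewrite sqrtr_gt0 divr_gt0.
  have Dt0 : 0 <= dispersion_rate by rewrite exprn_ge0// invr_ge0 ltW.
  apply: (Rintegral_box_le (G := fun x => B * (dev0 s0 x * wt c y x) +
    dispersion_rate * (`|f1 x| + `|f2 x|))) => //.
  - by apply: at_slice => x; apply: (ct_pairing HV).
  - apply: measurable_funD; apply: measurable_funM => //.
    by apply: measurable_funM; [exact: measurable_dev0|exact: measurable_wt].
  - by move=> x; rewrite addr_ge0// !mulr_ge0 ?dev0_ge0 ?wt_ge0 ?(ltW B0)// addr_ge0.
  - move=> x Bx; apply: (@le_trans _ _ (norm_sum s0 x * expR (kA e t y s0 x))).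
      have /andP[X0 X1] := chi_le1 r0 Bx.
      have Hk (F : R) : `|F| <= expR (kA e t y s0 x) -> `|chi y r x * F| <= expR (kA e t y s0 x).
        move=> hF; rewrite normrM (ger0_norm X0); apply: le_trans hF.
        by rewrite ler_piMl.
      rewrite /norm_sum mulrDl; apply: (le_trans (ler_normD _ _)); rewrite !normrM -!normrM.
      apply: lerD; rewrite normrM ler_wpM2l//; apply: Hk.
        exact: normr_kp.
      exact: normr_kq.
    apply: (@le_trans _ _ ((dev0 s0 x + (`|f1 x| + `|f2 x|)) * expR (kA e t y s0 x))).
      by rewrite ler_wpM2r ?expR_ge0 ?norm_sum_le_dev0.
    rewrite mulrDl; apply: lerD.
      rewrite mulrCA ler_wpM2l ?dev0_ge0//; apply: (le_trans (Ebd _ _ _)).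
        by rewrite (ltW s00) ltW.
      by rewrite ler_wpM2l ?(ltW B0)// ler_piMr ?wt_ge0 ?wt_le1.
    rewrite mulrC ler_wpM2r ?addr_ge0// expR_kA.
    (* The part carried by [f] must not be charged to [B], which depends on [e]. The Gaussian factor
       is dropped and the amplitude is estimated through [t - s0 >= t / 2]. *)
    apply: (@le_trans _ _ (kamp d e t s0)).
      rewrite ler_piMr ?expR_ge0// -[X in _ <= X]expR0 ler_expR oppr_le0.
      by apply: mulr_ge0 => //; apply: mulr_ge0; [exact: kal_ge0|exact: rho_ge0].
    apply: kamp_le => //; rewrite (exprM _ 2 2) sqr_sqrtr ?divr_ge0 ?(ltW t_gt0)//.
    rewrite /kN -[leLHS]add0r lerD ?(ltW e2)//.
    rewrite -[leRHS]real_normK ?num_real// ler_pXn2r ?nnegrE ?divr_ge0 ?(ltW t_gt0)//.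
    by rewrite distrC ger0_norm; lra.
  under eq_integral do rewrite EFinD EFinM [X in (_ + X)%E]EFinM.
  rewrite ge0_integralD//; last 4 first.
  - by move=> x _; rewrite -EFinM lee_fin !mulr_ge0 ?dev0_ge0 ?wt_ge0 ?(ltW B0).
  - under eq_fun do rewrite -EFinM.
    apply/measurable_EFinP; apply: measurable_funM => //.
    by apply: measurable_funM; [exact: measurable_dev0|exact: measurable_wt].
  - by move=> x _; rewrite -EFinM lee_fin mulr_ge0// addr_ge0.
  - under eq_fun do rewrite -EFinM.
    by apply/measurable_EFinP; exact: measurable_funM.
  rewrite addrC EFinD leeD//; last first.
    rewrite ge0_integralZl//; last 3 first.
    - by apply: measurable_mulwt; exact: measurable_dev0.
    - by move=> x _; rewrite lee_fin mulr_ge0 ?dev0_ge0 ?wt_ge0.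
    - by rewrite lee_fin ltW.
    apply: (@le_trans _ _ (B%:E * eta%:E)%E).
      by rewrite lee_wpmul2l// lee_fin ltW.
    rewrite -EFinM lee_fin /eta.
    have -> : B * (zeta / (2 * B)) = zeta / 2 by field; rewrite gt_eqF.
    by [].
  rewrite ge0_integralZl//; last first.
    exact/measurable_EFinP.
  by rewrite [X in (_ <= X)%E]EFinM lee_wpmul2l.
(* The residual integral is bounded on all of [[s0, t]], so the mean value theorem suffices and no
   integration in time is needed. *)
have [|||z zin Hz] := @MVT R (action V1 V2 e t th y r)
    (fun s => (\int[mu]_(x in box y r) residual V1 V2 e t th y r s x)%R) s0 t.
- exact: s0t'.
- move=> z; rewrite in_itv/= => /andP[sz zt]; apply: (der_action HV) => //.
  exact: lt_trans sz.
- apply: continuous_in_subspaceT => z /set_mem/=; rewrite in_itv/= => /andP[sz zt].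
  apply: is_derive_continuous (der_action HV t th y e0 r0 _).
  exact: lt_le_trans sz.
rewrite -(subrK (action V1 V2 e t th y r s0) (action V1 V2 e t th y r t)) Hz.
have -> : dispersion_rate * K0 + zeta = zeta / 2 + (dispersion_rate * K0 + zeta / 2) by field.
apply: lerD => //.
have zin' : s0 <= z <= t by move: zin; rewrite in_itv/= => /andP[/ltW -> /ltW ->].
apply: (@le_trans _ _ (C / r ^+ 2 * K * t)).
  apply: (le_trans (ler_norm _)); rewrite normrM; apply: ler_pM => //; first exact: Hder.
  by rewrite ger0_norm ?subr_ge0 ?(ltW s0t')// gerBl ltW.
have -> : C / r ^+ 2 * K * t = (2 * (C * K * t) / zeta) * (zeta / 2) / r ^+ 2.
  by field; rewrite !gt_eqF.
rewrite ler_pdivrMr ?exprn_gt0// mulrC ler_wpM2l ?divr_ge0 ?(ltW z0)//.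
have r1 : 1 <= r by rewrite (le_trans _ rr)// lerDl.
rewrite expr2 (@le_trans _ _ r)//; first by rewrite (le_trans _ rr)// lerDr.
by rewrite ler_peMr// ltW.
Qed.

End dispersive.

(** * Concentration of the kernel at the final time *)

Section concentration.
Context (R : realType) (d : nat).
Local Notation mu := (@lebesgue_rV R d).

(* At the final time the kernel is h^-d exp(- |x - y|^2 / (2 h^2)).  On the box
   of half-side h its exponential is at least exp(- d/2) and the cutoff at least
   (9/16)^d; the remaining factor 2^d comes from the volume of the box. *)
Definition concentration_const : R := 2^-1 * (9 / 8) ^+ d * expR (- (d%:R / 2)).

Lemma concentration_const_gt0 : 0 < concentration_const.
Proof. by rewrite !mulr_gt0 ?expR_gt0// exprn_gt0// divr_gt0. Qed.

Section wave_pair.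
Variables (V1 V2 : R -> 'rV[R]_d -> R) (V1x V2x V1xx V2xx : 'I_d -> R -> 'rV[R]_d -> R).
Hypothesis HV : wave V1 V2 V1x V2x V1xx V2xx.
Variables (t th : R) (y : 'rV[R]_d).
Hypothesis t_gt0 : 0 < t.

Definition rotated_part x : R := cos th * V1 t x + sin th * V2 t x.

Lemma rotated_part_le x : `|rotated_part x| <= norm_sum V1 V2 t x.
Proof.
apply: (le_trans (ler_normD _ _)); rewrite !normrM; apply: lerD.
  by rewrite ler_piMl// ler_norml cos_geN1 cos_le1.
by rewrite ler_piMl// ler_norml sin_geN1 sin_le1.
Qed.

Lemma cts_rotated_part : continuous rotated_part.
Proof.
apply: ctsD; (apply: ctsM; first exact: ctsC).
  exact: (continuous_V1 HV).
exact: (continuous_V2 HV).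
Qed.

(** At [s = t] the parameter [z] is the real number [h^2], so the kernel has constant phase [th] and
    the pairing sees the solution only through the real part of [exp(- i th) v]. *)
Lemma pairing_final (h r : R) x : 0 < h ->
  pairing V1 V2 (h ^+ 2) t th y r t x =
  rotated_part x * chi y r x * (h^-1 ^+ d * expR (- (rho y x / (2 * h ^+ 2)))).
Proof.
move=> h0; have N4 : kN (h ^+ 2) t t = h ^+ 4.
  by rewrite /kN subrr expr0n/= addr0 -exprM.
have A : expR (kA (h ^+ 2) t y t x) = h^-1 ^+ d * expR (- (rho y x / (2 * h ^+ 2))).
  rewrite expR_kA (kampE d h0 N4); congr (_ * expR _).
  by rewrite /kal N4; field; rewrite gt_eqF.
have T : kT (h ^+ 2) t th y t x = th.
  by rewrite /kT /kbe subrr !mul0r atan0 mulr0 subrr add0r.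
by rewrite /pairing /kp /kq A T /rotated_part; ring.
Qed.

(** Close to [y] the integrand is nonnegative, and at least a fixed multiple of [h^-d] on the box of
    half-side [h]; farther away [gauss_tail] makes it small. The width [h] is fixed before [r], as
    the threshold of [action_le] requires. *)
Lemma action_ge (M zeta : R) : 0 < rotated_part y -> 0 < zeta -> 0 <= M ->
  (wint 1 y (norm_sum V1 V2 t) <= M%:E)%E ->
  exists2 h : R, 0 < h & forall r, 2 * h <= r ->
    concentration_const * rotated_part y - zeta <= action V1 V2 (h ^+ 2) t th y r t.
Proof.
move=> U0 z0 M0 HM.
have [delta d0 Hd] : exists2 delta : R, 0 < delta & forall x : 'rV[R]_d,
    (forall i, `|x ord0 i - y ord0 i| < delta) -> rotated_part y / 2 < rotated_part x.
  have : \forall x \near y, rotated_part y / 2 < rotated_part x.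
    by apply: (cvgr_gt (rotated_part y) (cts_rotated_part (x:=y))); rewrite ltr_pdivrMr// ltr_pMr// ltr1n.
  move=> /nbhs_ballP[delta /= d0 Hd]; exists delta => // x Hx.
  by apply: Hd; split => // i j; rewrite (ord1 i) /ball/= distrC.
have [Q Q0 HQ] := gauss_tail d d0.
(* The three bounds serve [gauss_tail], the inclusion of the small box in the [delta]-neighbourhood,
   and the tail [h Q M <= zeta]; the [+ 1] keeps the denominator positive. *)
pose h := Num.min (Num.min 2^-1 (delta / 2)) (zeta / (Q * M + 1)).
have QM : 0 < Q * M + 1 by rewrite ltr_wpDl ?mulr_ge0.
have zq : 0 < zeta / (Q * M + 1) by rewrite divr_gt0.
have dd : 0 < delta / 2 by rewrite divr_gt0.
have h0 : 0 < h by rewrite /h !lt_min dd zq invr_gt0 ltr0n.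
have h1 : h <= 2^-1 by rewrite !ge_min lexx.
have hd : h <= delta / 2 by rewrite !ge_min lexx !orbT.
have hz : h <= zeta / (Q * M + 1) by rewrite !ge_min lexx !orbT.
clearbody h.
exists h => // r hr; have r0 : 0 < r by apply: lt_le_trans hr; rewrite mulr_gt0.
pose a := rotated_part y / 2 * (9 / 16) ^+ d * (h^-1 ^+ d * expR (- (d%:R / 2))).
have a0 : 0 <= a.
  by rewrite !mulr_ge0 ?expR_ge0 ?(ltW U0) ?exprn_ge0 ?invr_ge0 ?(ltW h0)// divr_ge0.
have -> : concentration_const * rotated_part y = a * (h *+ 2) ^+ d.
  have -> : (h *+ 2) ^+ d = h ^+ d * 2 ^+ d by rewrite -[h *+ 2]mulr_natr exprMn.
  have -> : concentration_const = 2^-1 * ((9 / 16) ^+ d * 2 ^+ d) * expR (- (d%:R / 2)).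
    by rewrite -exprMn /concentration_const; congr (_ * _ ^+ _ * _); field.
  have hh : h^-1 ^+ d * h ^+ d = 1 by rewrite -exprMn mulVf ?expr1n ?gt_eqF.
  rewrite /a -[LHS]mulr1 -hh; field.
  by rewrite !expf_neq0 ?invr_neq0 ?gt_eqF.
have c1 : 0 < 1 :> R by [].
have m1 := measurable_norm_sum HV t_gt0.
apply: (@le_trans _ _ (a * (h *+ 2) ^+ d - h * Q * M)).
  rewrite lerB// -mulrA; apply: (@le_trans _ _ (zeta / (Q * M + 1) * (Q * M))).
    by rewrite ler_wpM2r// mulr_ge0.
  by rewrite mulrAC ler_pdivrMr// ler_wpM2l ?(ltW z0)// lerDl.
apply: (Rintegral_box_ge (G := fun x => h * Q * (norm_sum V1 V2 t x * wt 1 y x))) => //.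
- by apply: le_trans hr; rewrite mulrDl mul1r lerDl ltW.
- by apply: at_slice => x; apply: (ct_pairing HV) => //; rewrite exprn_gt0.
- apply: measurable_funM => //; apply: measurable_funM => //; exact: measurable_wt.
- by move=> x; rewrite !mulr_ge0 ?norm_sum_ge0 ?wt_ge0 ?(ltW h0).
- move=> x Bx; rewrite pairing_final//.
  have /andP[X0 X1] := chi_le1 r0 Bx.
  set E : R := h^-1 ^+ d * _.
  have E0 : 0 <= E by rewrite mulr_ge0 ?expR_ge0 ?exprn_ge0 ?invr_ge0 ?(ltW h0).
  have G0 : 0 <= h * Q * (norm_sum V1 V2 t x * wt 1 y x).
    by rewrite !mulr_ge0 ?norm_sum_ge0 ?wt_ge0 ?(ltW h0).
  (* Near [y] the sign of the integrand allows [G] to be discarded; far from it the indicator is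
     zero and [G] alone bounds the integrand. *)
  have [near|far] := pselect (forall i, `|x ord0 i - y ord0 i| < delta).
    have ux := Hd x near.
    have ux0 : 0 <= rotated_part x by apply: le_trans (ltW ux); rewrite divr_ge0 ?(ltW U0).
    have F0 : 0 <= rotated_part x * chi y r x * E by exact: mulr_ge0 (mulr_ge0 ux0 X0) E0.
    rewrite lerBlDr; apply: (@le_trans _ _ (rotated_part x * chi y r x * E)); last by rewrite lerDl.
    rewrite indicE; have [|_] := boolP (x \in box y h); last by rewrite mulr0.
    move=> /set_mem Bh; rewrite mulr1 /a; apply: ler_pM => //.
    + by rewrite mulr_ge0 ?divr_ge0 ?(ltW U0)// exprn_ge0.
    + by rewrite mulr_ge0 ?expR_ge0 ?exprn_ge0 ?invr_ge0 ?(ltW h0).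
    + apply: ler_pM; rewrite ?divr_ge0 ?(ltW U0) ?exprn_ge0 ?(ltW ux)//.
      rewrite /chi -[d in X in X <= _]card_ord -prodr_const.
      apply: ler_prod => i _; rewrite divr_ge0//=.
      have := Bh i => ui; rewrite /eta.
      (* On the small box each coordinate is at most [h <= r / 2], so a factor of the cutoff is at
         least [(1 - 1/4)^2 = 9/16]. *)
      have : (x ord0 i - y ord0 i) ^+ 2 / r ^+ 2 <= 1 / 4; last first.
        by move: (_ / r ^+ 2) => w w4; nra.
      rewrite ler_pdivrMr ?exprn_gt0// -[leLHS]real_normK ?num_real//.
      have rr : (2 * h) ^+ 2 <= r ^+ 2.
        by rewrite ler_pXn2r ?nnegrE ?(ltW r0)// mulr_ge0 ?(ltW h0).
      have uu : `|x ord0 i - y ord0 i| ^+ 2 <= h ^+ 2.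
        by rewrite ler_pXn2r ?nnegrE ?(ltW h0).
      by lra.
    + rewrite ler_wpM2l ?exprn_ge0 ?invr_ge0 ?(ltW h0)// ler_expR lerN2.
      rewrite ler_pdivrMr ?mulr_gt0 ?exprn_gt0//.
      have -> : d%:R / 2 * (2 * h ^+ 2) = \sum_(i < d) h ^+ 2.
        by rewrite sumr_const card_ord -mulr_natr; field.
      apply: ler_sum => i _; rewrite -[leLHS]real_normK ?num_real//.
      by rewrite ler_pXn2r ?nnegrE ?(ltW h0)//; exact: Bh.
  have [i Hi] : exists i, delta <= `|x ord0 i - y ord0 i|.
    by apply/not_existsP => H; apply: far => i; rewrite ltNge; apply/negP; exact: H.
  rewrite indicE memNset ?mulr0; last first.
    move=> /(_ i) Bh; have : delta <= delta / 2 by exact: le_trans Hi (le_trans Bh hd).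
    by rewrite leNgt ltr_pdivrMr// ltr_pMr// ltr1n.
  rewrite sub0r; suff : `|rotated_part x * chi y r x * E| <=
      h * Q * (norm_sum V1 V2 t x * wt 1 y x) by rewrite ler_norml => /andP[].
  rewrite (normrM (rotated_part x * _)) (normrM (rotated_part x)) (ger0_norm X0) (ger0_norm E0).
  have Drho : delta ^+ 2 <= rho y x.
    rewrite /rho (bigD1 i)//= -[leLHS]addr0; apply: lerD; last first.
      by apply: sumr_ge0 => j _; exact: sqr_ge0.
    by rewrite -[leRHS]real_normK ?num_real// ler_pXn2r ?nnegrE ?(ltW d0).
  have HE : E <= h * Q * wt 1 y x.
    by apply: (le_trans (HQ h _ h0 h1 Drho)); rewrite /wt mul1r.
  rewrite [leRHS]mulrCA; apply: ler_pM => //; first by rewrite mulr_ge0.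
  by apply: le_trans (rotated_part_le x); rewrite ler_piMr.
under eq_integral do rewrite EFinM.
rewrite ge0_integralZl//.
- by rewrite [X in (_ <= X)%E]EFinM lee_wpmul2l// lee_fin mulr_ge0 ?(ltW h0).
- exact: measurable_mulwt.
- by move=> x _; rewrite lee_fin mulr_ge0 ?norm_sum_ge0 ?wt_ge0.
- by rewrite lee_fin mulr_ge0 ?(ltW h0).
Qed.

End wave_pair.

(** [action_ge] and [action_le] enclose the same number, with error [zeta / 2] each. First [h] is
    chosen, then [r] past both thresholds, and [zeta] is arbitrary. *)
Lemma wave_dispersive (V1 V2 : R -> 'rV[R]_d -> R)
    (V1x V2x V1xx V2xx : 'I_d -> R -> 'rV[R]_d -> R)
    (f1 f2 : 'rV[R]_d -> R) (K0 t th : R) (y : 'rV[R]_d) :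
  wave V1 V2 V1x V2x V1xx V2xx ->
  measurable_fun [set: 'rV[R]_d] f1 -> measurable_fun [set: 'rV[R]_d] f2 ->
  (\int[mu]_x (`|f1 x| + `|f2 x|)%:E <= K0%:E)%E -> 0 < t ->
  (forall c eta : R, 0 < c -> 0 < eta -> exists2 delta : R, 0 < delta &
    forall s : R, 0 < s < delta -> (wint c y (dev0 V1 V2 f1 f2 s) <= eta%:E)%E) ->
  (forall c eta s' : R, 0 < c -> 0 < eta -> 0 < s' -> exists2 delta : R, 0 < delta &
    forall s : R, 0 < s -> `|s - s'| < delta -> (wint c y (dev V1 V2 s' s) <= eta%:E)%E) ->
  rotated_part V1 V2 t th y <= dispersion_rate d t * K0 / concentration_const.
Proof.
move=> HV mf1 mf2 fK t0 c0 c1.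
have [U0|U0] := leP (rotated_part V1 V2 t th y) 0.
  apply: (le_trans U0); rewrite divr_ge0 ?(ltW concentration_const_gt0)// mulr_ge0 ?(L1_bound_ge0 fK)//.
  by rewrite exprn_ge0// invr_ge0 sqrtr_ge0.
rewrite ler_pdivlMr ?concentration_const_gt0// mulrC; apply/ler_addgt0Pr => zeta z0.
have z2 : 0 < zeta / 2 by rewrite divr_gt0.
have [M M0 HM] : exists2 M : R, 0 <= M & (wint 1 y (norm_sum V1 V2 t) <= M%:E)%E.
  have [delta d0 Hd] := c0 1 1 ltr01 ltr01.
  pose s0 := Num.min (delta / 2) t.
  have s00 : 0 < s0 by rewrite lt_min t0 divr_gt0.
  have s0d : s0 < delta.
    by rewrite gt_min; apply/orP; left; rewrite ltr_pdivrMr// ltr_pMr// ltr1n.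
  have s0t : s0 <= t by rewrite ge_min lexx orbT.
  have H0 : (wint 1 y (dev0 V1 V2 f1 f2 s0) < +oo)%E.
    by apply: le_lt_trans (Hd s0 _) (ltry _); rewrite s00.
  have fin := wint_norm_sum_init HV mf1 mf2 fK ltr01 s00 H0.
  have [K Kge HK] := wint_norm_sum_bounded HV c1 ltr01 s00 s0t fin.
  by exists K => //; apply: HK; rewrite s0t lexx.
have [h h0 Hh] := action_ge HV t0 U0 z2 M0 HM.
have h20 : 0 < h ^+ 2 by rewrite exprn_gt0.
have [r1 Hr1] := action_le HV th mf1 mf2 fK t0 c0 c1 h20 z2.
pose r := Num.max r1 (2 * h).
have r0 : 0 < r by rewrite lt_max mulr_gt0 ?orbT.
have r1r : r1 <= r by rewrite le_max lexx.
have A1 := Hr1 r r0 r1r.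
have A2 : concentration_const * rotated_part V1 V2 t th y - zeta / 2 <= action V1 V2 (h ^+ 2) t th y r t.
  by apply: Hh; rewrite le_max lexx orbT.
have := le_trans A2 A1; lra.
Qed.

End concentration.

(** * Complex-valued solutions *)

Section complex_parts.
Context (R : realType).
Implicit Types a b : R[i].
Local Notation Re := complex.Re.
Local Notation Im := complex.Im.

Lemma ReB a b : Re (a - b) = Re a - Re b. Proof. by case: a b => [? ?] []. Qed.
Lemma ImB a b : Im (a - b) = Im a - Im b. Proof. by case: a b => [? ?] []. Qed.

Lemma Re_sumE (n : nat) (F : 'I_n -> R[i]) :
  Re (\sum_(k < n) F k) = \sum_(k < n) Re (F k).
Proof. by elim/big_rec2: _ => // k b a _ <-; case: (F k) a => [? ?] []. Qed.

Lemma Im_sumE (n : nat) (F : 'I_n -> R[i]) :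
  Im (\sum_(k < n) F k) = \sum_(k < n) Im (F k).
Proof. by elim/big_rec2: _ => // k b a _ <-; case: (F k) a => [? ?] []. Qed.

(** Puts the scalar of the equation in constructor form, so that products with it compute on real
    and imaginary parts. *)
Lemma half_complexE : 2^-1 = (2^-1 +i* 0)%C :> R[i].
Proof.
have two : 2 = (2 +i* 0)%C :> R[i] by apply/eqP; rewrite eq_complex/= addr0 !eqxx.
have t0 : (2 : R[i]) != 0 by rewrite pnatr_eq0.
apply: (mulfI t0); rewrite mulfV// two; apply/esym/eqP; rewrite eq_complex/=.
by rewrite !(mulr0, mul0r) subr0 addr0 mulfV ?pnatr_eq0// !eqxx.
Qed.

Lemma Re_half b : Re (2^-1 * b) = 2^-1 * Re b.
Proof. by rewrite half_complexE; case: b => x y /=; rewrite mul0r subr0. Qed.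

Lemma Im_half b : Im (2^-1 * b) = 2^-1 * Im b.
Proof. by rewrite half_complexE; case: b => x y /=; rewrite mul0r addr0. Qed.

Lemma Re_Ni a : Re (- (0 +i* 1)%C * a) = Im a.
Proof. by case: a => x y /=; ring. Qed.

Lemma Im_Ni a : Im (- (0 +i* 1)%C * a) = - Re a.
Proof. by case: a => x y /=; ring. Qed.

Lemma normcE a : Normc.normc a = Num.sqrt (Re a ^+ 2 + Im a ^+ 2).
Proof. by case: a. Qed.

Lemma normc_ge0 a : 0 <= Normc.normc a.
Proof. by rewrite normcE sqrtr_ge0. Qed.

Lemma normRe_le a : `|Re a| <= Normc.normc a.
Proof. by rewrite normcE -sqrtr_sqr ler_wsqrtr// lerDl sqr_ge0. Qed.

Lemma normIm_le a : `|Im a| <= Normc.normc a.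
Proof. by rewrite normcE -sqrtr_sqr ler_wsqrtr// lerDr sqr_ge0. Qed.

Lemma normc_le a : Normc.normc a <= `|Re a| + `|Im a|.
Proof.
rewrite normcE -[leRHS]ger0_norm ?addr_ge0// -sqrtr_sqr ler_wsqrtr//.
rewrite sqrrD !real_normK ?num_real// lerD2r lerDl.
by rewrite mulrn_wge0// mulr_ge0.
Qed.

Lemma measurable_normc (dd : measure_display) (T : measurableType dd) (F : T -> R[i]) :
  cmeasurable F -> measurable_fun [set: T] (fun x => Normc.normc (F x)).
Proof.
move=> [mR mI]; rewrite (_ : (fun _ => _) =
    (fun x => Num.sqrt (Re (F x) ^+ 2 + Im (F x) ^+ 2))); last first.
  by apply/funext => x; exact: normcE.
apply: (measurableT_comp (f := @Num.sqrt R)).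
  by apply: continuous_measurable_fun; exact: sqrt_continuous.
by apply: measurable_funD; exact: measurable_funX.
Qed.

Lemma cmeasurableB (dd : measure_display) (T : measurableType dd) (F G : T -> R[i]) :
  cmeasurable F -> cmeasurable G -> cmeasurable (fun x => F x - G x).
Proof.
move=> [mF1 mF2] [mG1 mG2]; split.
  rewrite (_ : (fun _ => _) = (fun x => Re (F x) - Re (G x))).
    exact: measurable_funB.
  by apply/funext => x; exact: ReB.
rewrite (_ : (fun _ => _) = (fun x => Im (F x) - Im (G x))).
  exact: measurable_funB.
by apply/funext => x; exact: ImB.
Qed.

End complex_parts.

Lemma near_ereal_le (R : realType) (T : Type) (F : set_system T) {FF : Filter F}
    (h : T -> \bar R) (eta : R) : 0 < eta -> h @ F --> 0%E ->
  \forall x \near F, (h x <= eta%:E)%E.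
Proof.
move=> e0 Hc; have := Hc _ (@nbhs_open_ereal_lt R 0 (fun=> eta) e0).
move=> H; have {}H : F [set x | (h x < eta%:E)%E] by exact: H.
by apply: (filterS _ H) => x /= /ltW.
Qed.

Section solution.
Context (R : realType) (d : nat).
Local Notation mu := (@lebesgue_rV R d).
Local Notation Re := complex.Re.
Local Notation Im := complex.Im.
Implicit Types (f : 'rV[R]_d -> R[i]) (v : R -> 'rV[R]_d -> R[i]).

Lemma solution_wave v : C12 v -> free_schrodinger v ->
  wave (fun s x => Re (v s x)) (fun s x => Im (v s x))
    (fun k s x => Re (dx v k s x)) (fun k s x => Im (dx v k s x))
    (fun k s x => Re (dx (dx v k) k s x)) (fun k s x => Im (dx (dx v k) k s x)).
Proof.
move=> Cv Ev; split.
- move=> s x s0; have [_ [[dR _] _] _] := Cv s x s0.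
  split => //; have := congr1 (@complex.Im R) (Ev s x s0).
  by rewrite Im_Ni Im_half Im_sumE /dt /cderive/= mulNr => <-; rewrite opprK.
- move=> s x s0; have [_ [[_ dI] _] _] := Cv s x s0.
  split => //; have := congr1 (@complex.Re R) (Ev s x s0).
  by rewrite Re_Ni Re_half Re_sumE /dt /cderive/=.
- by move=> k s x s0; have [_ _ /(_ k)[[dR _] _ _ _]] := Cv s x s0; split.
- by move=> k s x s0; have [_ _ /(_ k)[[_ dI] _ _ _]] := Cv s x s0; split.
- by move=> k s x s0; have [_ _ /(_ k)[_ [dR _] _ _]] := Cv s x s0; split.
- by move=> k s x s0; have [_ _ /(_ k)[_ [_ dI] _ _]] := Cv s x s0; split.
- by move=> s x s0; have [[]] := Cv s x s0.
- by move=> s x s0; have [[]] := Cv s x s0.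
- move=> k s x s0; have [_ _ Hk] := Cv s x s0; have [_ _ _ [cR _]] := Hk k.
  exact: cR.
- move=> k s x s0; have [_ _ Hk] := Cv s x s0; have [_ _ _ [_ cI]] := Hk k.
  exact: cI.
Qed.

Lemma solution_cmeasurable v s : C12 v -> free_schrodinger v -> 0 < s -> cmeasurable (v s).
Proof.
move=> Cv Ev s0; have HV := solution_wave Cv Ev; split.
  exact: (measurable_V1 HV).
exact: (measurable_V2 HV).
Qed.

Lemma wint_parts_le (c eta : R) (p : \bar R) (y : 'rV[R]_d) (F : 'rV[R]_d -> R[i]) :
  0 < c -> 0 < eta -> (1 <= p)%E -> cmeasurable F ->
  (Lpnorm p F <= (eta / (2 * (1 + wmass c y)))%:E)%E ->
  (wint c y (fun x => (`|Re (F x)| + `|Im (F x)|)%R) <= eta%:E)%E.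
Proof.
move=> c0 e0 p1 mF HF.
have w0 := wmass_ge0 c y.
have w1 : 0 < 1 + wmass c y by rewrite ltr_pwDl.
have mN := measurable_normc mF.
have e1 : 0 < eta / (2 * (1 + wmass c y)) by rewrite divr_gt0 ?mulr_gt0.
have H := wint_le_Lnorm y c0 p1 e1 mN (fun x => normc_ge0 (F x)) HF.
apply: (@le_trans _ _ (wint c y (fun x => Normc.normc (F x) + Normc.normc (F x)))).
  apply: le_wint.
  - by apply: measurable_norm2; [exact: mF.1|exact: mF.2].
  - exact: measurable_funD.
  - by move=> x; rewrite addr_ge0//= lerD ?normRe_le ?normIm_le.
rewrite wintD//; try by move=> x; exact: normc_ge0.
apply: (le_trans (leeD H H)); rewrite -EFinD lee_fin.
have -> : eta / (2 * (1 + wmass c y)) * (1 + wmass c y) = eta / 2.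
  by field; rewrite gt_eqF.
by rewrite -splitr.
Qed.

(** The factor 4 is crude: [|Re f| + |Im f| <= 2 |f|] gives one factor 2, and bounding the modulus
    of [v] by [|Re v| + |Im v|] the other. *)
Lemma solution_dispersive f v (K t : R) (y : 'rV[R]_d) :
  cmeasurable f -> schrodinger_solution f v -> (Lpnorm 1%E f <= K%:E)%E -> 0 < t ->
  Normc.normc (v t y) <= 4 / concentration_const R d * (dispersion_rate d t * K).
Proof.
move=> mf [Cv Ev [p p1 [Hinit Hcurve]]] fK t0.
have HV := solution_wave Cv Ev.
have mv s : 0 < s -> cmeasurable (v s) by exact: solution_cmeasurable.
have mN := measurable_normc mf.
have fK2 : (\int[mu]_x (`|Re (f x)| + `|Im (f x)|)%:E <= (2 * K)%:E)%E.
  apply: (@le_trans _ _ (\int[mu]_x ((Normc.normc (f x))%:E + (Normc.normc (f x))%:E))%E).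
    apply: ge0_le_integral => //.
    - by apply/measurable_EFinP; apply: measurable_norm2; [exact: mf.1|exact: mf.2].
    - by apply: emeasurable_funD; exact/measurable_EFinP.
    - by move=> x _; rewrite -EFinD lee_fin lerD ?normRe_le ?normIm_le.
  rewrite ge0_integralD//; try by [move=> x _; rewrite lee_fin normc_ge0|exact/measurable_EFinP].
  have -> : (\int[mu]_x (Normc.normc (f x))%:E = Lpnorm 1%E f)%E.
    rewrite /Lpnorm Lnorm1; apply: eq_integral => x _.
    by rewrite gee0_abs// lee_fin normc_ge0.
  by rewrite mulr_natl mulr2n EFinD leeD.
have c0 (c eta : R) : 0 < c -> 0 < eta -> exists2 delta : R, 0 < delta &
    forall s : R, 0 < s < delta ->
    (wint c y (dev0 (fun s x => Re (v s x)) (fun s x => Im (v s x))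
      (fun x => Re (f x)) (fun x => Im (f x)) s) <= eta%:E)%E.
  move=> cp ep; have w1 : 0 < 1 + wmass c y by rewrite ltr_pwDl// wmass_ge0.
  have e1 : 0 < eta / (2 * (1 + wmass c y)) by rewrite divr_gt0 ?mulr_gt0.
  have FF : Filter (0 : R)^'+ by exact: _.
  have := @near_ereal_le _ _ _ FF _ _ e1 Hinit.
  move=> /nbhs_ballP[delta /= d0 Hd]; exists delta => // s /andP[s0 sd].
  have := Hd s; rewrite /ball/= sub0r normrN gtr0_norm// => /(_ sd s0).
  move=> /(wint_parts_le cp ep p1 (cmeasurableB (mv s s0) mf)).
  rewrite /dev0; congr (_ <= _)%E; apply: eq_integral => x _.
  by rewrite ReB ImB.
have c1 (c eta s' : R) : 0 < c -> 0 < eta -> 0 < s' -> exists2 delta : R, 0 < delta &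
    forall s : R, 0 < s -> `|s - s'| < delta ->
    (wint c y (dev (fun s x => Re (v s x)) (fun s x => Im (v s x)) s' s) <= eta%:E)%E.
  move=> cp ep s'0; have w1 : 0 < 1 + wmass c y by rewrite ltr_pwDl// wmass_ge0.
  have e1 : 0 < eta / (2 * (1 + wmass c y)) by rewrite divr_gt0 ?mulr_gt0.
  have FF : Filter (nbhs s') by exact: _.
  have := @near_ereal_le _ _ _ FF _ _ e1 (Hcurve s' s'0).
  move=> /nbhs_ballP[delta /= d0 Hd]; exists delta => // s s0 ss.
  have := Hd s; rewrite /ball/= distrC => /(_ ss).
  move=> /(wint_parts_le cp ep p1 (cmeasurableB (mv s s0) (mv s' s'0))).
  rewrite /dev; congr (_ <= _)%E; apply: eq_integral => x _.
  by rewrite ReB ImB.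
(* The phases [0], [pi], [pi / 2] and [- pi / 2] bound [Re], [- Re], [Im] and [- Im] of the
   solution. *)
pose U th := @wave_dispersive R d _ _ _ _ _ _ _ _ (2 * K) t th y HV mf.1 mf.2 fK2 t0 c0 c1.
pose B := dispersion_rate d t * (2 * K) / concentration_const R d.
have R1 : Re (v t y) <= B.
  by have := U 0; rewrite /rotated_part cos0 sin0 mul1r mul0r addr0.
have R2 : - Re (v t y) <= B.
  by have := U pi; rewrite /rotated_part cospi sinpi mulN1r mul0r addr0.
have I1 : Im (v t y) <= B.
  by have := U (pi / 2); rewrite /rotated_part cos_pihalf sin_pihalf mul1r mul0r add0r.
have I2 : - Im (v t y) <= B.
  by have := U (- (pi / 2)); rewrite /rotated_part cosN sinN cos_pihalf sin_pihalf mulN1r mul0r add0r.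
apply: (le_trans (normc_le _)).
have -> : 4 / concentration_const R d * (dispersion_rate d t * K) = B + B by rewrite /B; field; rewrite gt_eqF ?concentration_const_gt0.
by apply: lerD; rewrite ler_norml; apply/andP; split; rewrite // lerNl.
Qed.

End solution.

(** * The Gaussian wave packet *)

Section sup_norm.
Context (R : realType) (d : nat).
Local Notation mu := (@lebesgue_rV R d).
Implicit Types F : 'rV[R]_d -> R[i].

Lemma LpnormyE F : Lpnorm +oo%E F = ess_sup mu (fun x => (Normc.normc (F x))%:E).
Proof.
rewrite /Lpnorm unlock lebesgue_rV_gt0; congr ess_sup; apply/funext => x /=.
by rewrite ger0_norm// normc_ge0.
Qed.

Lemma Lpnormy_leP F (c : \bar R) :
  {ae mu, forall x, ((Normc.normc (F x))%:E <= c)%E} <-> (Lpnorm +oo%E F <= c)%E.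
Proof. by rewrite LpnormyE; split=> [/ess_supP|/ess_supP]. Qed.

(** If the value at [x0] exceeded the essential supremum, continuity would place a whole box, of
    positive measure, inside the exceptional null set. *)
Lemma Lpnormy_ge F (x0 : 'rV[R]_d) :
  continuous (fun x => Normc.normc (F x)) ->
  ((Normc.normc (F x0))%:E <= Lpnorm +oo%E F)%E.
Proof.
move=> cF; rewrite leNgt; apply/negP => lt.
have [N [mN N0 HN]] := (Lpnormy_leP F _).2 (lexx (Lpnorm +oo%E F)).
have : (0 <= Lpnorm +oo%E F)%E by exact: Lnorm_ge0.
move: lt HN; case: (Lpnorm +oo%E F) => [a| |]//; rewrite lte_fin => aF HN _.
have : \forall x \near x0, a < Normc.normc (F x).
  exact: (cvgr_gt (Normc.normc (F x0)) (cF x0)).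
move=> /nbhs_ballP[r /= r0 Hr].
have r2 : 0 < r / 2 by rewrite divr_gt0.
have : (mu (box x0 (r / 2)) <= mu N)%E.
  apply: le_measure; rewrite ?inE//; first exact: measurable_box.
  move=> x Bx; apply: HN => /=; apply/negP; rewrite -ltNge lte_fin; apply: Hr.
  split => // i j; rewrite (ord1 i) /ball/= distrC; apply: le_lt_trans (Bx j) _.
  by rewrite ltr_pdivrMr// ltr_pMr// ltr1n.
rewrite [X in (_ <= X)%E -> _]N0 [X in (X <= _)%E -> _](lebesgue_box x0 (ltW r2)) leNgt lte_fin exprn_gt0//.
by rewrite mulrn_wgt0.
Qed.

End sup_norm.

Section gaussian_wave.
Context (R : realType) (d : nat).
Local Notation mu := (@lebesgue_rV R d).
Local Notation Re := complex.Re.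
Local Notation Im := complex.Im.

Local Notation p := (@kp R d 1 0 0 0).
Local Notation q := (@kq R d 1 0 0 0).
Local Notation px := (@kpx R d 1 0 0 0).
Local Notation qx := (@kqx R d 1 0 0 0).
Local Notation pxx := (@kpxx R d 1 0 0 0).
Local Notation qxx := (@kqxx R d 1 0 0 0).
Local Notation ps := (@kps R d 1 0 0 0).
Local Notation qs := (@kqs R d 1 0 0 0).

Implicit Types (s t : R) (x : 'rV[R]_d).

Definition gauss_wave (s : R) (x : 'rV[R]_d) : R[i] := (p s x +i* q s x)%C.

Lemma dt_gauss_wave : dt gauss_wave = fun s x => (ps s x +i* qs s x)%C.
Proof.
apply/funext => s; apply/funext => x; rewrite /dt /cderive/=.
have [_ ->] := der_kp 0 0 0 ltr01 s x; have [_ ->] := der_kq 0 0 0 ltr01 s x.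
by [].
Qed.

Lemma dx_gauss_wave k : dx gauss_wave k = fun s x => (px k s x +i* qx k s x)%C.
Proof.
apply/funext => s; apply/funext => x; rewrite /dx /cderive/=.
have [_ ->] := dir_kp 1 0 0 0 s x k; have [_ ->] := dir_kq 1 0 0 0 s x k.
by [].
Qed.

Lemma dxx_gauss_wave k : dx (dx gauss_wave k) k = fun s x => (pxx k s x +i* qxx k s x)%C.
Proof.
apply/funext => s; apply/funext => x; rewrite dx_gauss_wave /dx /cderive/=.
have [_ ->] := dir_kpx 1 0 0 0 s x k; have [_ ->] := dir_kqx 1 0 0 0 s x k.
by [].
Qed.

Lemma gauss_wave_C12 : C12 gauss_wave.
Proof.
move=> t x t0 jc; rewrite /jc; split.
- by split; [exact: cts_kp|exact: cts_kq].
- split.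
    split; [by have [] := der_kp 0 0 0 ltr01 t x|by have [] := der_kq 0 0 0 ltr01 t x].
  by rewrite dt_gauss_wave; split; [exact: cts_kps|exact: cts_kqs].
- move=> k; split.
  + split; [by have [] := dir_kp 1 0 0 0 t x k|by have [] := dir_kq 1 0 0 0 t x k].
  + rewrite dx_gauss_wave.
    split; [by have [] := dir_kpx 1 0 0 0 t x k|by have [] := dir_kqx 1 0 0 0 t x k].
  + by rewrite dx_gauss_wave; split; [exact: cts_kpx|exact: cts_kqx].
  + by rewrite dxx_gauss_wave; split; [exact: cts_kpxx|exact: cts_kqxx].
Qed.

Lemma gauss_wave_free_schrodinger : free_schrodinger gauss_wave.
Proof.
move=> t x t0; apply/eqP; rewrite eq_complex; apply/andP; split; apply/eqP.
  rewrite Re_Ni Re_half Re_sumE dt_gauss_wave [LHS]/= /kqs; congr (_ * _).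
  by apply: eq_bigr => k _; rewrite dxx_gauss_wave.
rewrite Im_Ni Im_half Im_sumE dt_gauss_wave [LHS]/= /kps mulNr opprK; congr (_ * _).
by apply: eq_bigr => k _; rewrite dxx_gauss_wave.
Qed.

Lemma normc_gauss_wave s x : Normc.normc (gauss_wave s x) = expR (kA 1 0 0 s x).
Proof.
rewrite normcE /= /kp /kq !exprMn -mulrDr cos2Dsin2 mulr1 sqrtr_sqr.
by rewrite ger0_norm// expR_ge0.
Qed.

Lemma kal1E s : kal 1 0 s = (kN 1 0 s)^-1 :> R.
Proof. by rewrite /kal mul1r. Qed.

(** Free [a] and [b] cover both [kps] and [kqs]. The dangerous factor [rho kal] is tamed by the
    exponential of [- kal rho / 2], uniformly in time, since [exp u >= 1 + u]. *)
Lemma time_derivative_bound s x (a b : R) :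
  `|a| <= expR (kA 1 0 0 s x) -> `|b| <= expR (kA 1 0 0 s x) ->
  `|2^-1 * (d%:R * (kbe 1 0 s * a - kal 1 0 s * b) +
    rho 0 x * ((kal 1 0 s ^+ 2 - kbe 1 0 s ^+ 2) * b - 2 * kal 1 0 s * kbe 1 0 s * a))|
  <= d%:R + 2.
Proof.
set E := expR _ => aE bE.
have r0 := rho_ge0 0 x.
have al0 := @kal_ge0 R 1 0 ltr01 s.
have al1 : kal 1 0 s <= 1 :> R by rewrite -[leRHS]invr1; exact: kal_le.
have be1 : `|kbe 1 0 s| <= 1 :> R by rewrite -[leRHS]invr1; exact: kbe_le.
(* For [e = 1], [kal = 1 / kN = |z|^-2]. Both quadratic coefficients of [rho] are therefore at most
   [kal], the rate in the exponent. *)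
have sq : kal 1 0 s ^+ 2 + kbe 1 0 s ^+ 2 = kal 1 0 s :> R.
  by rewrite kal2_kbe2// kal1E.
have N1 : 1 <= kN 1 0 s :> R by rewrite /kN expr1n lerDl sqr_ge0.
have EE : E <= expR (- (kal 1 0 s * rho 0 x / 2)).
  rewrite /E expR_kA ler_piMl ?expR_ge0//.
  apply: (@le_trans _ _ (1^-1 ^+ d)); last by rewrite invr1 expr1n.
  by apply: kamp_le => //; rewrite expr1n.
have E0 : 0 <= E by exact: expR_ge0.
have E1 : E <= 1.
  apply: (le_trans EE); rewrite -[X in _ <= X]expR0 ler_expR oppr_le0.
  by apply: mulr_ge0 => //; apply: mulr_ge0.
have rE : rho 0 x * kal 1 0 s * E <= 2.
  have w0 : 0 <= rho 0 x * kal 1 0 s by exact: mulr_ge0.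
  apply: (@le_trans _ _ (rho 0 x * kal 1 0 s * expR (- (kal 1 0 s * rho 0 x / 2)))).
    by rewrite ler_wpM2l.
  rewrite expRN ler_pdivrMr ?expR_gt0//.
  have := expR_ge1Dx (kal 1 0 s * rho 0 x / 2); lra.
move: al0 al1 be1 sq EE rE; move: (kal 1 0 s) (kbe 1 0 s) => al be al0 al1 be1 sq EE rE.
have h1 : `|be * a - al * b| <= 2.
  apply: (le_trans (ler_normB _ _)); rewrite !normrM (ger0_norm al0).
  have -> : 2 = 1 * 1 + 1 * 1 :> R by ring.
  by apply: lerD; apply: ler_pM => //; apply: le_trans E1.
have h2 : `|(al ^+ 2 - be ^+ 2) * b - 2 * al * be * a| <=
    2 * al * E.
  apply: (le_trans (ler_normB _ _)); rewrite !normrM.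
  have -> : 2 * al * E = al * E + al * E by ring.
  have be2 : 0 <= be ^+ 2 by exact: sqr_ge0.
  have al2 : 0 <= al ^+ 2 by exact: sqr_ge0.
  apply: lerD; apply: ler_pM => //.
    by rewrite ler_norml; apply/andP; split; lra.
  rewrite -!normrM ler_norml; apply/andP; split.
    have := sqr_ge0 (al + be); rewrite sqrrD; lra.
  have := sqr_ge0 (al - be); rewrite sqrrB; lra.
rewrite normrM ger0_norm// ler_pdivrMl//; apply: (le_trans (ler_normD _ _)).
rewrite !normrM (ger0_norm r0) (@ger0_norm _ d%:R)//.
have h3 : d%:R * `|be * a - al * b| <= d%:R * 2 by rewrite ler_wpM2l.
have h4 : rho 0 x * `|(al ^+ 2 - be ^+ 2) * b - 2 * al * be * a|
    <= rho 0 x * (2 * al * E) by rewrite ler_wpM2l.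
have -> : 2 * (d%:R + 2) = d%:R * 2 + 4 :> R by ring.
by apply: lerD => //; apply: (le_trans h4); lra.
Qed.

Lemma normr_ps s x : `|ps s x| <= d%:R + 2.
Proof.
rewrite /kps mulNr normrN sum_kqxx; apply: time_derivative_bound.
  exact: normr_kp.
exact: normr_kq.
Qed.

Lemma normr_qs s x : `|qs s x| <= d%:R + 2.
Proof.
rewrite /kqs sum_kpxx.
have := @time_derivative_bound s x (- q s x) (p s x); rewrite normrN.
move=> /(_ (normr_kq _ _ _ _ _ _) (normr_kp _ _ _ _ _ _)).
by congr (`|_| <= _); ring.
Qed.

Lemma lipschitz_of_derivative (F dF : R -> R) (L s t : R) :
  (forall z, is_derive z (1 : R) F (dF z)) -> (forall z, `|dF z| <= L) ->
  `|F s - F t| <= L * `|s - t|.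
Proof.
move=> D B.
have main a b : a < b -> `|F b - F a| <= L * `|b - a|.
  move=> ab; have [|z _ ->] := @MVT R F dF a b ab (fun z _ => D z).
    by apply: continuous_subspaceT => z; exact: is_derive_continuous (D z).
  by rewrite normrM ler_wpM2r.
have [st|ts|->] := ltgtP s t; last by rewrite !subrr normr0 mulr0.
  by rewrite distrC (distrC s); exact: main.
exact: main.
Qed.

Lemma gauss_wave_lipschitz s t x :
  Normc.normc (gauss_wave s x - gauss_wave t x) <= 2 * (d%:R + 2) * `|s - t|.
Proof.
apply: (le_trans (normc_le _)); rewrite ReB ImB/=.
have h1 := lipschitz_of_derivative s t (fun z => der_kp 0 0 0 ltr01 z x)
  (fun z => normr_ps z x).
have h2 := lipschitz_of_derivative s t (fun z => der_kq 0 0 0 ltr01 z x)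
  (fun z => normr_qs z x).
lra.
Qed.

(** The Lipschitz bound in time is uniform in [x], so [p = +oo] is the convenient exponent. A
    general filter covers both the limit at time 0 from the right and continuity at positive
    times. *)
Lemma gauss_wave_curve (t : R) (F : set_system R) (FF : Filter F) : F --> t ->
  (fun s => Lpnorm +oo%E (fun x => gauss_wave s x - gauss_wave t x)) @ F --> 0%E.
Proof.
move=> Ft; apply: (@squeeze_cvge _ _ _ _ (fun=> 0%E) _
  (fun s => (2 * (d%:R + 2) * `|s - t|)%:E)).
- apply: nearW => s; rewrite Lnorm_ge0/=; apply/Lpnormy_leP; apply: aeW => x.
  by rewrite lee_fin gauss_wave_lipschitz.
- exact: cvg_cst.
- apply: cvg_EFin; first exact: nearW.
  have : 2 * (d%:R + 2) * `|s - t| @[s --> F] --> 2 * (d%:R + 2) * `|t - t|.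
    apply: cvgM; first exact: cvg_cst.
    by apply: cvg_norm; apply: cvgB => //; exact: cvg_cst.
  by rewrite subrr normr0 mulr0.
Qed.

Lemma gauss_wave_solution : schrodinger_solution (gauss_wave 0) gauss_wave.
Proof.
split; [exact: gauss_wave_C12|exact: gauss_wave_free_schrodinger|exists +oo%E => //].
  by rewrite leey.
split => [|t t0].
  by apply: gauss_wave_curve; exact: cvg_at_right_filter.
exact: gauss_wave_curve.
Qed.

Lemma cts_normc_gauss_wave s : continuous (fun x => Normc.normc (gauss_wave s x)).
Proof.
under eq_fun do rewrite normc_gauss_wave.
apply: (at_slice (V := fun s x => expR (kA 1 0 0 s x))) => x.
apply: (cts_comp (f := fun w : R * 'rV[R]_d => kA 1 0 0 w.1 w.2)) => [|z].
  exact: cts_kA.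
exact: continuous_expR.
Qed.

Lemma cmeasurable_gauss_wave s : cmeasurable (gauss_wave s).
Proof.
split; apply: continuous_measurable_rV.
  by apply: (at_slice (V := p)) => x; exact: cts_kp.
by apply: (at_slice (V := q)) => x; exact: cts_kq.
Qed.

Lemma gauss_wave_L1 : (Lpnorm 1%E (gauss_wave 0) = (wmass (2^-1) (0 : 'rV[R]_d))%:E)%E.
Proof.
rewrite -wmassE ?invr_gt0// /Lpnorm Lnorm1; apply: eq_integral => x _.
rewrite gee0_abs ?lee_fin ?normc_ge0// normc_gauss_wave expR_kA.
have N1 : kN 1 0 0 = 1 :> R by rewrite /kN subr0 expr1n expr0n addr0.
rewrite (@kampE R d 1 0 0 1)//; last by rewrite expr1n.
by rewrite invr1 expr1n mul1r /wt kal1E N1 invr1 mul1r mulrC.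
Qed.

(** The modulus at the origin is [|z|^(-d/2)], and [|z|^2 = 1 + t^2 <= 16 t^2 = (2 sqrt t)^4] once
    [t >= 1]. *)
Lemma gauss_wave_peak (t : R) : 1 <= t ->
  (((2 * Num.sqrt t)^-1 ^+ d)%:E <= Lpnorm +oo%E (gauss_wave t))%E.
Proof.
move=> t1; have t0 : 0 < t by exact: lt_le_trans t1.
apply: le_trans (Lpnormy_ge 0 (@cts_normc_gauss_wave t)).
rewrite lee_fin normc_gauss_wave expR_kA.
have -> : rho 0 (0 : 'rV[R]_d) = 0.
  by rewrite /rho big1// => i _; rewrite mxE subrr expr0n.
rewrite mulr0 mul0r oppr0 expR0 mulr1.
have b0 : 0 < 2 * Num.sqrt t by rewrite mulr_gt0 ?sqrtr_gt0.
rewrite -expR_ln_pow4// ler_expR !mulNr lerN2 ler_wpM2l//.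
rewrite ler_ln ?posrE ?kN_gt0 ?exprn_gt0//.
rewrite exprMn (exprM (Num.sqrt t) 2 2) sqr_sqrtr ?(ltW t0)// /kN subr0 expr1n.
have : 1 <= t ^+ 2 by rewrite exprn_ege1.
have -> : 2 ^+ 4 = 16 :> R by ring.
lra.
Qed.

End gaussian_wave.

(** * Bounds on V_SR *)

Section rearrangement_spaces.
Context (R : realType) (d : nat).
Local Notation mu := (@lebesgue_rV R d).
Local Notation L1 := (@Lpnorm R d 1%E).
Local Notation Loo := (@Lpnorm R d +oo%E).
Implicit Types (f g : 'rV[R]_d -> R[i]).

Lemma L1normE f : L1 f = (\int[mu]_x (Normc.normc (f x))%:E)%E.
Proof.
rewrite /Lpnorm Lnorm1; apply: eq_integral => x _.
by rewrite gee0_abs// lee_fin normc_ge0.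
Qed.

Lemma normc_sub0 f x : Normc.normc (f x - f x) = 0.
Proof. by rewrite subrr Normc.normc0. Qed.

Lemma L1norm_sub0 f : L1 (fun x => f x - f x) = 0%E.
Proof. by rewrite L1normE; apply: integral0_eq => x _; rewrite normc_sub0. Qed.

Lemma Loonorm_sub0 f : Loo (fun x => f x - f x) = 0%E.
Proof.
apply/eqP; rewrite eq_le Lnorm_ge0 andbT; apply/Lpnormy_leP; apply: aeW => x.
by rewrite normc_sub0.
Qed.

Lemma L1norm_neq0 f : cmeasurable f -> ~ {ae mu, forall x, f x = 0} -> L1 f != 0%E.
Proof.
move=> mf nf; apply/eqP => f0; apply: nf.
have mN : measurable_fun [set: 'rV[R]_d] (fun x => (Normc.normc (f x))%:E).
  by apply/measurable_EFinP; exact: measurable_normc.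
have := Lnorm_eq0_eq0 mN lte01 f0.
apply: filterS => x /(_ I) /= [H].
exact: Normc.eq0_normc.
Qed.

Lemma L1norm_triangle f g : cmeasurable f -> cmeasurable g ->
  (L1 g <= L1 (fun x => (g x - f x)%R) + L1 f)%E.
Proof.
move=> mf mg; rewrite !L1normE -ge0_integralD//.
- apply: ge0_le_integral => //.
  + by move=> x _; rewrite lee_fin normc_ge0.
  + by apply/measurable_EFinP; exact: measurable_normc.
  + apply: emeasurable_funD; apply/measurable_EFinP; last exact: measurable_normc.
    exact: measurable_normc (cmeasurableB mg mf).
  + move=> x _; rewrite -EFinD lee_fin -{1}(subrK (f x) (g x)).
    exact: (le_normcD (g x - f x) (f x)).
- by move=> x _; rewrite lee_fin normc_ge0.
- apply/measurable_EFinP; exact: measurable_normc (cmeasurableB mg mf).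
- by move=> x _; rewrite lee_fin normc_ge0.
- by apply/measurable_EFinP; exact: measurable_normc.
Qed.

Lemma L1norm_indic (A : set 'rV[R]_d) : measurable A ->
  L1 (fun x => (\1_A x)%:C%C) = mu A.
Proof.
move=> mA; rewrite L1normE; transitivity (\int[mu]_x (\1_A x)%:E)%E.
  apply: eq_integral => x _.
  by rewrite normcE/= expr0n addr0 sqrtr_sqr ger0_norm.
by rewrite integral_indic// setIT.
Qed.

(** The L_1 norm of an indicator is the measure of the set, and a cube of side [t^-1] attains the
    supremum. *)
Lemma fundamental_L1 (t : R) : 0 < t -> fundamental L1 (t ^- d) = (t ^- d)%:E.
Proof.
move=> t0; apply/eqP; rewrite eq_le; apply/andP; split.
  by apply: ge_ereal_sup => _ [A [mA Ale] <-]; rewrite L1norm_indic.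
have r0 : 0 <= t^-1 / 2 by rewrite divr_ge0// invr_ge0 ltW.
have E : mu (box 0 (t^-1 / 2)) = (t ^- d)%:E.
  rewrite lebesgue_box//; congr EFin; rewrite -exprVn; congr (_ ^+ _).
  by rewrite mulr2n -splitr.
have mB := measurable_box (0 : 'rV[R]_d) (t^-1 / 2).
apply: ereal_sup_ubound; exists (box 0 (t^-1 / 2)).
  by split => //; rewrite [X in (X <= _)%E]E.
by rewrite L1norm_indic// [LHS]E.
Qed.

(** The dispersive estimate is linear in the L_1 bound, so it passes to limits of solutions. *)
Lemma flow_bound f g (K t : R) : 0 < t -> cmeasurable f -> L1 f = K%:E ->
  schrodinger_flow L1 Loo t f g ->
  (Loo g <= (4 / concentration_const R d * (dispersion_rate d t * K))%:E)%E.
Proof.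
move=> t0 mf fK [f_ [v_ [Hsol Hf Hg]]].
have b0 := concentration_const_gt0 R d.
pose C := 4 / concentration_const R d * dispersion_rate d t.
have C0 : 0 <= C by rewrite !mulr_ge0 ?invr_ge0 ?(ltW b0)// exprn_ge0// invr_ge0 sqrtr_ge0.
have CE L : 4 / concentration_const R d * (dispersion_rate d t * L) = C * L by rewrite mulrA.
clearbody C.
apply/lee_addgt0Pr => e e0.
have C1 : 0 < C + 1 by rewrite ltr_wpDl.
(* The approximation error enters once amplified by [C] through the initial values and once directly
   at time [t]: in total [e]. *)
have e1 : 0 < e / (C + 1) by rewrite divr_gt0.
have FF : Filter \oo by exact: _.
have Nf := @near_ereal_le _ _ _ FF _ _ e1 Hf.
have Ng := @near_ereal_le _ _ _ FF _ _ e1 Hg.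
have [n [nf ng]] := @filter_ex _ \oo _ _ (filterI Nf Ng).
have [mfn soln] := Hsol n.
have fnK : (L1 (f_ n) <= (e / (C + 1) + K)%:E)%E.
  by apply: (le_trans (L1norm_triangle mf mfn)); rewrite EFinD fK leeD2r.
have Hv x := @solution_dispersive R d (f_ n) (v_ n) _ t x mfn soln fnK t0.
apply/Lpnormy_leP; have := (Lpnormy_leP _ _).2 ng.
apply: filterS => x; rewrite !lee_fin => Hx.
apply: (@le_trans _ _ (Normc.normc (v_ n t x) + Normc.normc (v_ n t x - g x))).
  rewrite -[X in _ <= _ + X]normcN opprB.
  rewrite -{1}(subrK (v_ n t x) (g x)) addrC.
  exact: (le_normcD (v_ n t x) (g x - v_ n t x)).
apply: (le_trans (lerD (Hv x) Hx)); rewrite !CE.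
rewrite mulrDr -addrA addrC -addrA lerD2l//.
have -> : e = e / (C + 1) * (C + 1) by rewrite mulfVK ?gt_eqF.
have -> : e / (C + 1) * (C + 1) / (C + 1) = e / (C + 1) by rewrite mulfK ?gt_eqF.
by lra.
Qed.

Lemma powR_half (t : R) : 0 < t -> t `^ (- d%:R / 2) = (Num.sqrt t)^-1 ^+ d.
Proof.
move=> t0; rewrite mulNr powRN mulrC powRrM powR12_sqrt ?(ltW t0)//.
by rewrite powR_mulrn ?sqrtr_ge0// exprVn.
Qed.

(** Dividing by the fundamental function [t^-d] turns the prefactor into [t^(d/2)], the inverse of
    the decay rate. *)
Lemma quotientE (t K : R) (N : \bar R) : 0 < t -> 0 < K ->
  ((t `^ (- d%:R / 2))%:E * N / (K%:E * fundamental L1 (t ^- d)) =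
   (t `^ (- d%:R / 2) * t ^+ d / K)%:E * N)%E.
Proof.
move=> t0 K0; rewrite fundamental_L1// -EFinM inver.
rewrite mulf_eq0 gt_eqF//= gt_eqF ?invr_gt0 ?exprn_gt0//=.
rewrite muleAC -EFinM invfM invrK.
by congr (_%:E * _)%E; ring.
Qed.

(** [(t / 2)^(-d/2)] times [t^(d/2)] leaves [sqrt 2 ^ d]; the norm of [f] cancels, being positive
    and finite. *)
Lemma V_SR_le (t : R) : 0 < t ->
  (V_SR L1 Loo t <= (4 / concentration_const R d * Num.sqrt 2 ^+ d)%:E)%E.
Proof.
move=> t0; apply: ge_ereal_sup => _ [f [g [[mf fin] nf mg flow ->]]].
have := L1norm_neq0 mf nf; have : (0 <= L1 f)%E by exact: Lnorm_ge0.
case E : (L1 f) fin => [K| |]// _; rewrite lee_fin => K0 Kn0.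
have {}K0 : 0 < K by rewrite lt_def K0 andbT.
rewrite quotientE//.
apply: (@le_trans _ _ ((t `^ (- d%:R / 2) * t ^+ d / K)%:E *
    (4 / concentration_const R d * (dispersion_rate d t * K))%:E)%E).
  apply: lee_wpmul2l; last exact: flow_bound flow.
  by rewrite lee_fin !mulr_ge0 ?powR_ge0 ?exprn_ge0 ?invr_ge0 ?(ltW K0) ?(ltW t0).
rewrite -EFinM lee_fin powR_half// /dispersion_rate sqrtrM ?(ltW t0)// sqrtrV//.
set s := Num.sqrt t; have s0 : 0 < s by rewrite sqrtr_gt0.
have -> : t = s ^+ 2 by rewrite sqr_sqrtr ?(ltW t0).
set w := Num.sqrt 2; have w0 : 0 < w by rewrite sqrtr_gt0.
have -> : w ^+ d = s^-1 ^+ d * (s ^+ 2) ^+ d * (s / w)^-1 ^+ d.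
  by rewrite -!exprMn; congr (_ ^+ _); field; rewrite !gt_eqF.
rewrite le_eqVlt; apply/orP; left; apply/eqP.
by field; rewrite !gt_eqF// concentration_const_gt0.
Qed.

Lemma wmass_gt0 (c : R) (y : 'rV[R]_d) : 0 < c -> 0 < wmass c y.
Proof.
move=> c0; rewrite lt_def wmass_ge0 andbT; apply/eqP => w0.
have m1 : measurable_fun [set: 'rV[R]_d] (fun x => (wt c y x)%:E).
  by apply/measurable_EFinP; exact: measurable_wt.
have := lebesgue_rV_gt0 R d.
suff -> : mu [set: 'rV[R]_d] = 0%E by rewrite ltxx.
have : (\int[mu]_x `|(wt c y x)%:E| = 0)%E.
  by under eq_integral do rewrite gee0_abs ?lee_fin ?wt_ge0//; rewrite wmassE// w0.
move/(ae_eq_integral_abs mu measurableT m1) => [N [mN N0 HN]].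
apply/eqP; rewrite -measure_le0 -[X in (_ <= X)%E]N0.
apply: le_measure; rewrite ?inE// => x _; apply: HN => /= /(_ I)[].
by apply/eqP; rewrite gt_eqF// expR_gt0.
Qed.

(** The witness is the Gaussian wave, with constant approximating sequences. Its peak
    [(2 sqrt t)^(-d)] against [t^(d/2)] leaves [2^(-d)], and [wmass 2^-1 0] is the L_1 norm of its
    initial value. *)
Lemma V_SR_ge (t : R) : 1 <= t ->
  (((2 ^+ d * wmass 2^-1 (0 : 'rV[R]_d))^-1)%:E <= V_SR L1 Loo t)%E.
Proof.
move=> t1; have t0 : 0 < t by exact: lt_le_trans t1.
set K := wmass _ _; have K0 : 0 < K by apply: wmass_gt0; rewrite invr_gt0.
pose N := Loo (gauss_wave t).
apply: (@le_trans _ _ ((t `^ (- d%:R / 2))%:E * N /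
    (L1 (gauss_wave 0) * fundamental L1 (t ^- d)))%E); last first.
  apply: ereal_sup_ubound; exists (gauss_wave 0), (gauss_wave t); split => //.
  - by split; [exact: cmeasurable_gauss_wave|rewrite gauss_wave_L1 ltry].
  - move=> [A [mA A0 HA]]; have := lebesgue_rV_gt0 R d.
    suff -> : mu [set: 'rV[R]_d] = 0%E by rewrite ltxx.
    apply/eqP; rewrite -measure_le0 -[X in (_ <= X)%E]A0.
    apply: le_measure; rewrite ?inE// => x _; apply: HA => /= H.
    have := expR_gt0 (kA 1 0 0 0 x); rewrite -normc_gauss_wave H Normc.normc0 ltxx.
    by [].
  - exact: cmeasurable_gauss_wave.
  - exists (fun=> gauss_wave 0), (fun=> @gauss_wave R d); split.
    + by move=> n; split; [exact: cmeasurable_gauss_wave|exact: gauss_wave_solution].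
    + by under eq_fun do rewrite L1norm_sub0; exact: cvg_cst.
    + by under eq_fun do rewrite Loonorm_sub0; exact: cvg_cst.
rewrite gauss_wave_L1 quotientE//.
apply: (@le_trans _ _ ((t `^ (- d%:R / 2) * t ^+ d / K)%:E *
    ((2 * Num.sqrt t)^-1 ^+ d)%:E)%E); last first.
  apply: lee_wpmul2l; last exact: gauss_wave_peak.
  by rewrite lee_fin !mulr_ge0 ?powR_ge0 ?exprn_ge0 ?invr_ge0 ?(ltW K0) ?(ltW t0).
rewrite -EFinM lee_fin powR_half//.
set s := Num.sqrt t; have s0 : 0 < s by rewrite sqrtr_gt0.
have -> : t = s ^+ 2 by rewrite sqr_sqrtr ?(ltW t0).
have -> : (2 ^+ d * K)^-1 = (2^-1) ^+ d / K by rewrite invfM exprVn.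
have -> : 2^-1 ^+ d = s^-1 ^+ d * (s ^+ 2) ^+ d * (2 * s)^-1 ^+ d.
  by rewrite -!exprMn; congr (_ ^+ _); field; rewrite gt_eqF.
by rewrite le_eqVlt; apply/orP; left; apply/eqP; ring.
Qed.

End rearrangement_spaces.

(** * From uniform bounds to the lower limit *)

Lemma limf_einf_bounds (R : realType) (V : R -> \bar R) (a b : R) :
  (forall t, 1 <= t -> (a%:E <= V t)%E) -> (forall t, 1 <= t -> (V t <= b%:E)%E) ->
  (a%:E <= limf_einf V (pinfty_nbhs R) <= b%:E)%E.
Proof.
move=> Va Vb; rewrite limf_einfE; apply/andP; split.
  apply: (@le_trans _ _ (ereal_inf [set V t | t in [set t | 1 <= t]])).
    by apply: le_ereal_inf_tmp => _ [t t1 <-]; exact: Va.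
  apply: ereal_sup_ubound; exists [set t | 1 <= t] => //.
  by exists 1; split => // t /ltW.
apply: ge_ereal_sup => _ [A [M [Mr HM]] <-].
(* A point of the given neighbourhood of infinity at which the upper bound is also available. *)
pose t := Num.max 1 (M + 1).
apply: (@le_trans _ _ (V t)); last by apply: Vb; rewrite le_max lexx.
apply: ereal_inf_lbound; exists t => //; apply: HM.
by rewrite lt_max ltrDl ltr01 orbT.
Qed.

Unset Implicit Arguments.

Theorem theorem5p2 (R : realType) (d : nat) (hd : (0 < d)%N) :
  exists C : R, 0 < C /\
    limf_einf (V_SR (@Lpnorm R d 1%E) (@Lpnorm R d +oo%E)) (pinfty_nbhs R)
      = C%:E.
Proof.
(* Finite bounds on both sides exclude the infinite values, and the lower one is positive. *)
have [] := andP (limf_einf_bounds (@V_SR_ge R d)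
  (fun t t1 => V_SR_le d (lt_le_trans ltr01 t1))).
case: (limf_einf _ _) => [C| |]//; rewrite !lee_fin => C0 _.
exists C; split => //; apply: lt_le_trans C0.
by rewrite invr_gt0 mulr_gt0 ?exprn_gt0// wmass_gt0// invr_gt0.
Qed.
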